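(* Let $c\in\mathbb{C}$ with $\operatorname{Re}(c)>0$ and $\operatorname{Im}(c)>0$, and let $H_c$ be the complex harmonic oscillator on $L^2(\mathbb{R})$. Let $b>0$ and $1/3<p<3$ be constants (independent of $\eta$), and for $\eta>0$ put $$z_\eta = b\eta + c\,\eta^{p}.$$ Then $$\lim_{\eta\to\infty}\|(H_c-z_\eta)^{-1}\|=\infty .$$
   Context: For $c\in\mathbb{C}$ with $\operatorname{Re}(c)>0$, the complex harmonic oscillator $H_c f(x)=-f''(x)+c\,x^2f(x)$ is the m-sectorial operator on $L^2(\mathbb{R})$ associated (via the representation theorem) with the closed m-sectorial form $$Q_c(f,g)=\int_{\mathbb{R}} f'(x)\overline{g'(x)}\,dx + c\int_{\mathbb{R}}x^2 f(x)\overline{g(x)}\,dx,$$ with form domain $W^{1,2}(\mathbb{R})\cap\{f\in L^2(\mathbb{R}):\int x^2|f(x)|^2dx<\infty\}$. The norm is the operator norm on $L^2(\mathbb{R})$, with the convention $\|(H_c-z)^{-1}\|=\infty$ when $z$ belongs to the spectrum of $H_c$. *)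

(* Defs.v *)
From HB Require Import structures.
From mathcomp Require Import all_boot all_order all_algebra.
From mathcomp Require Import all_classical all_reals all_analysis.
From mathcomp Require Import complex.

Set Implicit Arguments.
Unset Strict Implicit.
Unset Printing Implicit Defensive.

Import Order.TTheory GRing.Theory Num.Theory.
Import numFieldNormedType.Exports.

Local Open Scope classical_set_scope.
Local Open Scope ring_scope.

(* Elements of L^2(R; C) are represented by square-integrable Borel functions
   R -> R[i], two of which represent the same element when they agree almost
   everywhere.  Operators are given by their graphs on such representatives;
   the graphs and norms below are invariant under changing a representative
   (within Borel functions) on a null set. *)

Section ComplexL2.
Context {R : realType}.
Local Notation mu := (@lebesgue_measure R).

Definition cintegral (f : R -> R[i]) : R[i] :=
  Complex (\int[mu]_x complex.Re (f x)) (\int[mu]_x complex.Im (f x)).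

Definition L2norm (f : R -> R[i]) : \bar R :=
  'N[mu]_(2%:E)[(fun x => (ComplexField.Normc.normc (f x))%:E)]%E.

Definition L2 : set (R -> R[i]) :=
  [set f | [/\ measurable_fun [set: R] (fun x => complex.Re (f x)),
               measurable_fun [set: R] (fun x => complex.Im (f x)) &
               (L2norm f < +oo)%E]].

Definition L2inner (f g : R -> R[i]) : R[i] :=
  cintegral (fun x => f x * (g x)^*%C).

(* Real-valued test functions suffice for weak derivatives of complex-valued
   functions, by linearity. *)
Definition test_function (phi : R -> R) : Prop :=
  (forall (n : nat) (x : R), derivable (derive1n n phi) x 1) /\
  compact (closure [set x | phi x != 0]).

Definition weak_derivative (f f' : R -> R[i]) : Prop :=
  forall phi : R -> R, test_function phi ->
    cintegral (fun x => f x * (derive1 phi x)%:C%C) =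
    - cintegral (fun x => f' x * (phi x)%:C%C).

Definition W12 : set (R -> R[i]) :=
  [set f | L2 f /\ exists2 f', L2 f' & weak_derivative f f'].

(* A choice of representative of the weak derivative in L^2, which is unique
   up to almost everywhere equality; junk outside W12. *)
Definition wderiv (f : R -> R[i]) : R -> R[i] :=
  xget (cst 0) [set f' | L2 f' /\ weak_derivative f f'].

End ComplexL2.

Section Operators.
Context {R : realType}.
Local Notation mu := (@lebesgue_measure R).
Local Notation fn := (R -> R[i]).

(* The operator given by Kato's first representation theorem for a form Q with
   domain D: (f, h) is in its graph iff f is in D, h is in L^2 and
   Q(f, g) = <h, g> for all g in D. *)
Definition form_operator (D : set fn) (Q : fn -> fn -> R[i]) : set (fn * fn) :=
  [set fh | [/\ D fh.1, L2 fh.2 & forall g, D g -> Q fh.1 g = L2inner fh.2 g]].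

Definition shift_operator (T : set (fn * fn)) (z : R[i]) : set (fn * fn) :=
  [set fh | exists2 k, T (fh.1, k) & fh.2 = (fun x => k x - z * fh.1 x)].

(* T - z maps dom T bijectively onto L^2, with bounded inverse. *)
Definition resolvent_set (T : set (fn * fn)) : set R[i] :=
  [set z | [/\ forall h, L2 h -> exists f, shift_operator T z (f, h),
               forall f1 f2 h, shift_operator T z (f1, h) ->
                 shift_operator T z (f2, h) -> {ae mu, forall x, f1 x = f2 x} &
               exists M : R, forall f h, shift_operator T z (f, h) ->
                 (L2norm f <= M%:E * L2norm h)%E]].

Definition spectrum (T : set (fn * fn)) : set R[i] := ~` resolvent_set T.

(* Operator norm of (T - z)^-1, with value +oo on the spectrum. *)
Definition resolvent_norm (T : set (fn * fn)) (z : R[i]) : \bar R :=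
  if `[< spectrum T z >] then +oo%E
  else ereal_sup [set L2norm fh.1 | fh in
         [set fh | shift_operator T z fh /\ (L2norm fh.2 <= 1)%E]].

Definition osc_domain : set fn :=
  [set f | W12 f /\
    (\int[mu]_x (x ^+ 2 * ComplexField.Normc.normc (f x) ^+ 2)%:E < +oo)%E].

Definition osc_form (c : R[i]) (f g : fn) : R[i] :=
  cintegral (fun x => wderiv f x * (wderiv g x)^*%C) +
  c * cintegral (fun x => (x ^+ 2)%:C%C * f x * (g x)^*%C).

Definition harmonic_oscillator (c : R[i]) : set (fn * fn) :=
  form_operator osc_domain (osc_form c).

End Operators.

(* Main.v *)
(* Write c = a^2, x0 = eta^(p/2), xi = sqrt (b eta), so that z = a^2 x0^2 + xi^2. The
   Gaussians exp (- a x^2 / 2 + beta x) are preserved by the evolution of H_c: with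
   beta = (a x0 - i xi) e^th and a suitable normalization one gets Gaussians F_th with
   (H_c - z) F_th = 2 a (d/dth) F_th. If z is in the resolvent set, pair F_th with
   u = (H_c - z)^-1 k, where k is the normalized conjugate of F_0. By symmetry of the
   form for the bilinear pairing, (d/dth) <u, F_th> = <k, F_th> / (2 a), and the right
   hand side is an explicit exponential. Near th = 0 it is e^(M s^2) up to a cubic error,
   where s = (a x0 - i xi) th / 2, so its integral between s1 and - s1, computed along the
   line of steepest descent, is bounded below. On the other hand
   |<u, F_th>| <= 2 |u| |F_th|, and |F_th| / |F_0| is exponentially small at both ends if
   s1 is chosen along the descending direction of the quadratic part of log |F_th|,
   which exists because Im c > 0. The cubic errors are negligible, at the scale where
   the ends become small, precisely when 1/3 < p < 3. Hence |u| tends to infinity. *)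

Require Import Defs.
From mathcomp Require Import all_boot all_order all_algebra.
From mathcomp Require Import all_classical all_reals all_analysis.
From mathcomp Require Import measurable_realfun complex.
From mathcomp Require Import ring lra.

Import Order.TTheory GRing.Theory Num.Theory.
Import numFieldNormedType.Exports.

Local Open Scope classical_set_scope.
Local Open Scope ring_scope.

Set Implicit Arguments.
Unset Strict Implicit.
Unset Printing Implicit Defensive.

(** * Smooth functions and bumps *)

Section Smooth.
Context {R : realType}.
Implicit Types (f g h : R -> R) (x : R).

(** The vector [u] enters only through pairings with Gaussians. These lie in the form domain, and
    [H - z] multiplies them by a polynomial of degree at most one, so membership of [u] in the form
    domain is all the regularity needed. The pairing is never shown to be holomorphic in th:
    derivatives along complex lines suffice, because the contour is the broken line [- s1], [- r e],
    [r e], [s1] with e a steepest descent direction. The middle segment contributes at least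
    [e^(- |M|)], the outer ones cost a multiple of [(|s1| + r) e^(- X)], and the rest must come from
    the two ends, hence from [|u|]. Scales: put [B = a x0 - i xi] and [th = 2 s / B]; the cubic
    errors have size [|s|^3 / |B|]. Making [|F_th| / |F_0|] of size [e^(- Q)] at the ends takes
    [|s|^2] of order [Q (x0^2 + xi^2) / (x0 xi)], while [|B|^2] is of order [x0^2 + xi^2]. So the
    squared error is of order [Q^3 (x0^2 + xi^2)^2 / (x0 xi)^3]; without [Q^3] this is a power of
    eta, negative exactly when [1/3 < p < 3]. Taking for [Q] a small power of eta leaves a lower
    bound of the form [C e^Q / eta^2]. *)

Definition smooth f := forall n x, derivable (derive1n n f) x 1.

Lemma is_derive_derive1 f x d : is_derive x 1 f d -> derive1 f x = d.
Proof. by move=> fd; rewrite derive1E derive_val. Qed.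

Lemma derivable_is_derive f x : derivable f x 1 -> is_derive x 1 f (derive1 f x).
Proof. by move=> fx; rewrite derive1E; exact: derivableP. Qed.

Lemma is_derive_derivable f x d : is_derive x 1 f d -> derivable f x 1.
Proof. by move=> fd; exact: ex_derive. Qed.

(** Avoids formulas for the n-th derivative: the induction on n only has to know that each
    derivative stays in [S]. The smoothness of basic functions, products and compositions below is
    proved by exhibiting such a family. *)
Lemma smooth_coind (S : set (R -> R)) :
  (forall f, S f -> (forall x, derivable f x 1) /\ S (derive1 f)) ->
  S `<=` smooth.
Proof.
move=> HS f Sf n x.
suff: S (derive1n n f) by move=> /HS[].
by elim: n => // n IH; rewrite derive1nS; exact: (HS _ IH).2.
Qed.

Lemma smooth_coind_is_derive (S : set (R -> R)) :
  (forall f, S f -> exists2 f', S f' & forall x, is_derive x 1 f (f' x)) ->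
  S `<=` smooth.
Proof.
move=> HS; apply: smooth_coind => f /HS[f' Sf' ff']; split.
  by move=> x; exact: is_derive_derivable (ff' x).
by rewrite (_ : derive1 f = f')//; apply/funext => x; exact: is_derive_derive1.
Qed.

Lemma smooth_derivable f x : smooth f -> derivable f x 1.
Proof. by move=> /(_ 0%N). Qed.

Lemma smooth_is_derive f x : smooth f -> is_derive x 1 f (derive1 f x).
Proof. by move=> /(@smooth_derivable _ x) /derivable_is_derive. Qed.

Lemma smooth_derive1 f : smooth f -> smooth (derive1 f).
Proof. by move=> sf n x; rewrite -derive1Sn; exact: sf. Qed.

Lemma smooth_continuous f : smooth f -> continuous f.
Proof.
move=> sf x; apply: differentiable_continuous.
by apply/derivable1_diffP; exact: smooth_derivable.
Qed.

Lemma smooth_cst (a : R) : smooth (cst a).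
Proof.
apply: (@smooth_coind_is_derive [set f | exists a, f = cst a]); last by exists a.
by move=> _ [b ->]; exists (cst 0); [exists 0|move=> x; exact: is_derive_cst].
Qed.

Lemma smooth_id : smooth id.
Proof.
apply: (@smooth_coind_is_derive [set f | f = id \/ exists a, f = cst a]);
  last by left.
move=> f [->|[b ->]].
- by exists (cst 1); [right; exists 1|move=> x; exact: is_derive_id].
- by exists (cst 0); [right; exists 0|move=> x; exact: is_derive_cst].
Qed.

Lemma smooth_expR : smooth (@expR R).
Proof.
apply: (@smooth_coind_is_derive [set f | f = expR]) => // f ->.
by exists expR => // x; exact: is_derive_expR.
Qed.

Lemma smoothD f g : smooth f -> smooth g -> smooth (fun x => f x + g x).
Proof.
move=> sf sg; pose S := [set h | exists f g,
  [/\ smooth f, smooth g & h = (fun x => f x + g x)]].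
apply: (@smooth_coind_is_derive S); last by exists f, g.
move=> _ [f1 [g1 [sf1 sg1 ->]]].
exists (fun x => derive1 f1 x + derive1 g1 x).
  by exists (derive1 f1), (derive1 g1); split; [exact: smooth_derive1..|by []].
by move=> x; apply: is_deriveD; exact: smooth_is_derive.
Qed.

Lemma smooth_cos_sin : smooth (@cos R) /\ smooth (@sin R).
Proof.
have key : forall k : R, smooth (fun x => k * cos x) /\ smooth (fun x => k * sin x).
  (* The scalar absorbs the sign that appears when [cos] is differentiated. *)
  pose S := [set f | exists k : R, f = (fun x => k * cos x) \/ f = (fun x => k * sin x)].
  have : S `<=` smooth.
    apply: (@smooth_coind_is_derive S) => f [k [->|->]].
    - exists (fun x => - k * sin x); first by exists (- k); right.
      by move=> x; apply: is_derive_eq; rewrite /GRing.scale/= mulrN mulNr.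
    - exists (fun x => k * cos x); first by exists k; left.
      by move=> x; apply: is_derive_eq.
  by move=> SS k; split; apply: SS; exists k; [left|right].
split; [move: (key 1).1|move: (key 1).2].
- by rewrite (_ : (fun x => _) = cos)//; apply/funext => x; rewrite mul1r.
- by rewrite (_ : (fun x => _) = sin)//; apply/funext => x; rewrite mul1r.
Qed.

Lemma smooth_cos : smooth (@cos R). Proof. exact: smooth_cos_sin.1. Qed.

Lemma smooth_sin : smooth (@sin R). Proof. exact: smooth_cos_sin.2. Qed.

(** Finite sums of products, the shape that the Leibniz rule preserves. *)
Inductive prod_span (A B : set (R -> R)) : (R -> R) -> Prop :=
| prod_span_mul f g : A f -> B g -> prod_span A B (fun x => f x * g x)
| prod_span_add f g : prod_span A B f -> prod_span A B g ->
    prod_span A B (fun x => f x + g x).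

Lemma smoothM f g : smooth f -> smooth g -> smooth (fun x => f x * g x).
Proof.
move=> sf sg; apply: (@smooth_coind_is_derive (prod_span smooth smooth));
  last exact: prod_span_mul.
move=> h0; elim=> {h0} [{sf sg} {}f {}g sf sg|f1 g1 _ [f' sf' ff'] _ [g' sg' gg']].
- exists (fun x => f x * derive1 g x + g x * derive1 f x).
    apply: prod_span_add; apply: prod_span_mul;
      [exact: sf|exact: smooth_derive1|exact: sg|exact: smooth_derive1].
  by move=> x; apply: is_deriveM; exact: smooth_is_derive.
- exists (fun x => f' x + g' x); first exact: prod_span_add.
  by move=> x; apply: is_deriveD.
Qed.

(** The chain rule leaves the family of compositions, but sums of terms [f (g x) * h x] with [h]
    smooth are stable: the inner derivative is absorbed into [h]. The composition itself is the case
    [h = 1]. *)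
Lemma smooth_comp f g : smooth f -> smooth g -> smooth (fun x => f (g x)).
Proof.
pose A := [set h | exists f g, [/\ smooth f, smooth g & h = (fun x => f (g x))]].
move=> sf sg; apply: (@smooth_coind_is_derive (prod_span A smooth)); last first.
  rewrite (_ : (fun x => f (g x)) = (fun x => f (g x) * cst 1 x)); last first.
    by apply/funext => x; rewrite mulr1.
  by apply: prod_span_mul; [exists f, g|exact: smooth_cst].
move=> h0; elim=> {h0} [_ h [f1 [g1 [sf1 sg1 ->]]] sh|f1 g1 _ [f' sf' ff'] _ [g' sg' gg']].
- exists (fun x => f1 (g1 x) * derive1 h x +
                   derive1 f1 (g1 x) * (derive1 g1 x * h x)).
    apply: prod_span_add.
      apply: prod_span_mul; last exact: smooth_derive1.
      by exists f1, g1; split.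
    apply: (@prod_span_mul _ _ (fun x => derive1 f1 (g1 x))).
      by exists (derive1 f1), g1; split; [exact: smooth_derive1|by []|by []].
    by apply: smoothM; [exact: smooth_derive1|by []].
  move=> x.
  have fg : is_derive x 1 (f1 \o g1) (derive1 f1 (g1 x) * derive1 g1 x).
    by apply: is_derive1_comp; exact: smooth_is_derive.
  have hx := smooth_is_derive x sh.
  have := is_deriveM fg hx; rewrite /GRing.scale/= => fgh.
  by apply: (is_derive_eq fgh); rewrite mulrC [in RHS]mulrCA; ring.
- exists (fun x => f' x + g' x); first exact: prod_span_add.
  by move=> x; apply: is_deriveD.
Qed.

End Smooth.

(** * The flat function [exp (- 1/x)] and its derivatives *)

Section Flat.
Context {R : realType}.
Implicit Types (x a b : R) (k n : nat).

(** Serves the origin, the one point near which [flat] is not given by a single branch of its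
    definition. *)
Lemma is_derive_quadratic (f : R -> R) x d (C : R) :
  (\forall h \near (0 : R), `|f (h + x) - f x - h * d| <= C * h ^+ 2) ->
  is_derive x 1 f d.
Proof.
move=> fC.
suff cvgd : h^-1 *: (f (h *: 1 + x) - f x) @[h --> 0^'] --> d.
  by apply: DeriveDef; [apply/cvg_ex; exists d|exact/cvg_lim].
apply/cvgrPdist_le => e e0; near=> h.
have h0 : h != 0 by near: h; exact: nbhs_dnbhs_neq.
have -> : h *: 1 = h :> R by rewrite /GRing.scale/= mulr1.
have -> : d - h^-1 *: (f (h + x) - f x) = - h^-1 * (f (h + x) - f x - h * d).
  by rewrite /GRing.scale/=; field.
rewrite normrM normrN normfV ler_pdivrMl ?normr_gt0//.
apply: (@le_trans _ _ (C * h ^+ 2)).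
  by near: h; apply: cvg_within.
rewrite -(real_normK (num_real h)).
have -> : C * `|h| ^+ 2 = `|h| * (C * `|h|) by ring.
rewrite ler_wpM2l//.
apply: (@le_trans _ _ ((`|C| + 1) * `|h|)).
  by rewrite ler_wpM2r// (le_trans (ler_norm _))// lerDl.
rewrite -ler_pdivlMl; last by rewrite ltr_wpDl.
near: h; apply: dnbhs0_le; rewrite mulr_gt0// invr_gt0 ltr_wpDl//.
Unshelve. all: by end_near. Qed.

(* The family is closed under differentiation, so [flat 0], which is [exp (- 1/x)]
   extended by [0], is smooth. *)
Definition flat k x : R := if 0 < x then x^-1 ^+ k * expR (- x^-1) else 0.

Lemma flat_ge0 k x : 0 <= flat k x.
Proof.
by rewrite /flat; case: ifPn => // x0; rewrite mulr_ge0 ?expR_ge0 ?exprn_ge0 ?invr_ge0 ?ltW.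
Qed.

Lemma expRN_pow_le k (y : R) : 0 <= y -> y ^+ k * expR (- y) <= k`!%:R.
Proof.
move=> y0; rewrite expRN ler_pdivrMr ?expR_gt0//.
case: k => [|k]; first by rewrite expr0 fact0 mul1r -expR0 ler_expR.
rewrite mulrC -ler_pdivrMr ?ltr0n ?fact_gt0//.
by apply: le_trans (expR_ge1Dxn k y0); rewrite lerDr.
Qed.

Lemma flat_le k x : flat k x <= k`!%:R.
Proof.
rewrite /flat; case: ifPn => // x0; apply: expRN_pow_le.
by rewrite invr_ge0 ltW.
Qed.

(** Two extra powers of [1/x] are still dominated by the exponential. The quadratic bound makes the
    derivative at the origin vanish. *)
Lemma flat_le_sqr k x : flat k x <= (k.+2)`!%:R * x ^+ 2.
Proof.
rewrite /flat; case: ifPn => x0; last by rewrite mulr_ge0// sqr_ge0.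
have y0 : 0 <= x^-1 by rewrite invr_ge0 ltW.
have := ler_wpM2r (sqr_ge0 x) (expRN_pow_le k.+2 y0); apply: le_trans.
rewrite -addn2 exprD mulrAC -(mulrA (x^-1 ^+ k)) -exprMn mulVf ?gt_eqF//.
by rewrite expr1n mulr1.
Qed.

Lemma is_derive_flat k x :
  is_derive x 1 (flat k) (- k%:R * flat k.+1 x + flat k.+2 x).
Proof.
have [x0|x0|->] := ltgtP x 0.
- have -> : - k%:R * flat k.+1 x + flat k.+2 x = 0.
    by rewrite /flat ltNge ltW//= mulr0 addr0.
  apply: near_eq_is_derive (is_derive_cst 0 x 1).
  near=> y; rewrite /flat ltNge ltW//=; near: y; exact: lt_nbhsl.
- have H : is_derive x 1 (fun y => y^-1 ^+ k * expR (- y^-1))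
      (- k%:R * flat k.+1 x + flat k.+2 x).
    have xV : is_derive x 1 (@GRing.inv R) (- x ^- 2).
      have xn0 : id x != 0 by exact: lt0r_neq0.
      have := is_deriveV xn0 (is_derive_id x 1).
      by rewrite /GRing.scale/= mulr1.
    have xX : is_derive x 1 (fun y => y^-1 ^+ k) (- k%:R * x^-1 ^+ k.+1).
      have := is_deriveX k xV; rewrite /GRing.scale/= => H.
      rewrite (_ : (fun _ => _) = (@GRing.inv R : R -> R) ^+ k); last first.
        by apply/funext => y; rewrite fctE.
      apply: (is_derive_eq H); case: k {H} => [|k]; first by rewrite !(mul0r, oppr0).
      by rewrite /= -exprVn -[k.+2]addn2 exprD; ring.
    have xE : is_derive x 1 (fun y => expR (- y^-1)) (expR (- x^-1) * x ^- 2).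
      have xN : is_derive x 1 (fun y : R => - y^-1) (x ^- 2).
        by have := is_deriveN xV; rewrite opprK.
      exact: is_derive1_comp.
    have := is_deriveM xX xE; rewrite /GRing.scale/= => H.
    apply: (is_derive_eq H); rewrite /flat x0 -exprVn -[k.+2]addn2 exprD; ring.
  apply: near_eq_is_derive H.
  near=> y; rewrite /flat ifT//; near: y; exact: lt_nbhsr.
- have f0 j : flat j 0 = 0 by rewrite /flat ltxx.
  rewrite !f0 mulr0 addr0; apply: (@is_derive_quadratic _ _ _ (k.+2)`!%:R).
  near=> h; rewrite addr0 f0 mulr0 !subr0 ger0_norm ?flat_ge0//.
  exact: flat_le_sqr.
Unshelve. all: by end_near. Qed.

Inductive flat_span : (R -> R) -> Prop :=
| flat_span_flat k : flat_span (flat k)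
| flat_span_add (c : R) f g : flat_span f -> flat_span g ->
    flat_span (fun x => c * f x + g x).

Lemma smooth_flat k : smooth (flat k).
Proof.
apply: (@smooth_coind_is_derive _ flat_span); last exact: flat_span_flat.
move=> f; elim=> {f} [j|c f g _ [f' sf' ff'] _ [g' sg' gg']].
- exists (fun x => - j%:R * flat j.+1 x + flat j.+2 x).
    by apply: flat_span_add; exact: flat_span_flat.
  by move=> x; exact: is_derive_flat.
- exists (fun x => c * f' x + g' x); first exact: flat_span_add.
  move=> x; have := is_deriveZ c (ff' x); rewrite /GRing.scale/= => H.
  exact: (is_deriveD H (gg' x)).
Qed.

Lemma derive1_flat0 : derive1 (flat 0) = flat 2.
Proof.
apply/funext => x; rewrite (is_derive_derive1 (is_derive_flat 0 x)).
by rewrite oppr0 mul0r add0r.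
Qed.

Lemma cvg_flat0 (u : R^nat) : u n @[n --> \oo] --> +oo ->
  flat 0 (u n) @[n --> \oo] --> (1 : R).
Proof.
move=> uoo; have /cvgryPgt uP := uoo.
have u0 : (- (u n)^-1) @[n --> \oo] --> (0 : R).
  rewrite -[X in _ --> X]oppr0; apply: cvgN.
  by apply/gtr0_cvgV0; first by near=> n; near: n; exact: uP.
have : expR (- (u n)^-1) @[n --> \oo] --> (1 : R).
  rewrite -expR0; apply: continuous_cvg u0; exact: continuous_expR.
apply: cvg_trans; apply: near_eq_cvg; near=> n.
rewrite /flat ifT ?expr0 ?mul1r//; near: n; exact: uP.
Unshelve. all: by end_near. Qed.

Lemma cvg_flat2 (u : R^nat) : u n @[n --> \oo] --> +oo ->
  flat 2 (u n) @[n --> \oo] --> (0 : R).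
Proof.
move=> uoo; have /cvgryPgt uP := uoo.
have u0 : (u n)^-1 @[n --> \oo] --> (0 : R).
  by apply/gtr0_cvgV0; first by near=> n; near: n; exact: uP.
have u02 : (u n)^-1 ^+ 2 @[n --> \oo] --> (0 : R).
  rewrite (_ : (fun n => _) = (fun n => (u n)^-1 * (u n)^-1)); last first.
    by apply/funext => n; rewrite expr2.
  by rewrite -[X in _ --> X](mulr0 0); exact: cvgM.
apply: (@squeeze_cvgr _ _ _ _ (cst 0) _ _ _ _ _ u02); last exact: cvg_cst.
near=> n.
rewrite flat_ge0/= /flat; case: ifPn => _; last by rewrite sqr_ge0.
rewrite ler_piMr ?sqr_ge0// -expR0 ler_expR oppr_le0 invr_ge0.
by near: n; apply: filterS (uP 0) => n /ltW.
Unshelve. all: by end_near. Qed.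

End Flat.

Section BoundedDominated.
Context {R : realType}.
Local Notation mu := (@lebesgue_measure R).
Implicit Types (f g : R -> R).

Lemma integrable_bounded f g : measurable_fun [set: R] f ->
  mu.-integrable [set: R] (EFin \o g) -> (forall x, `|f x| <= g x) ->
  mu.-integrable [set: R] (EFin \o f).
Proof.
move=> mf ig fg; apply: le_integrable ig => //; first exact/measurable_EFinP.
move=> x _ /=; rewrite lee_fin (le_trans (fg x))//.
by rewrite ler_norm.
Qed.

Lemma integrable_measurable f : mu.-integrable [set: R] (EFin \o f) ->
  measurable_fun [set: R] f.
Proof. by move=> /integrableP[/measurable_EFinP]. Qed.

Lemma Rintegral_dominated (f_ : (R -> R)^nat) f g :
  (forall n, measurable_fun [set: R] (f_ n)) ->
  (forall x, f_ n x @[n --> \oo] --> f x) ->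
  mu.-integrable [set: R] (EFin \o g) ->
  (forall n x, `|f_ n x| <= g x) ->
  mu.-integrable [set: R] (EFin \o f) /\
  \int[mu]_x f_ n x @[n --> \oo] --> \int[mu]_x f x.
Proof.
move=> mf_ f_f ig f_g.
have mf : measurable_fun [set: R] f.
  by apply: (measurable_fun_cvg mf_) => x _; exact: f_f.
have [] := @dominated_convergence _ _ _ mu [set: R] measurableT
  (fun n => EFin \o f_ n) (EFin \o f) (EFin \o g).
- by move=> n; apply/measurable_EFinP; exact: mf_.
- exact/measurable_EFinP.
- apply: aeW => x _ /=; apply/cvg_EFin; first by near=> n.
  exact: f_f.
- exact: ig.
- by apply: aeW => x n _ /=; rewrite lee_fin.
move=> if_ _ fcvg; split=> //.
have : fine (\int[mu]_x (EFin \o f_ n) x)%E @[n --> \oo] --> \int[mu]_x f x.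
  apply: fine_cvg; rewrite fineK; last exact: integrable_fin_num.
  exact: fcvg.
by [].
Unshelve. all: by end_near. Qed.

End BoundedDominated.

(** * Integrable functions are determined by test functions *)

Section NullWeak.
Context {R : realType}.
Local Notation mu := (@lebesgue_measure R).
Implicit Types (f g phi : R -> R) (a b : R).

(** The parameter [n] steepens both flanks: for fixed [a] and [b] the limit in [n] is the indicator
    of the open interval. With [n = 1] and moving end points the same formula gives the cutoffs used
    for integration by parts. *)
Definition bump (n : nat) a b (x : R) : R :=
  flat 0 (n%:R * (x - a)) * flat 0 (n%:R * (b - x)).

Lemma smooth_affine f (k l : R) : smooth f -> smooth (fun x => f (k * x + l)).
Proof.
move=> sf; apply: (@smooth_comp _ f); [exact: sf|apply: smoothD; last exact: smooth_cst].
by apply: smoothM; [exact: smooth_cst|exact: smooth_id].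
Qed.

Lemma smooth_bump n a b : smooth (bump n a b).
Proof.
apply: smoothM.
- rewrite (_ : (fun _ => _) = (fun x => flat 0 (n%:R * x + - (n%:R * a)))).
    by apply: smooth_affine; exact: smooth_flat.
  by apply/funext => x; congr flat; ring.
- rewrite (_ : (fun _ => _) = (fun x => flat 0 (- n%:R * x + n%:R * b))).
    by apply: smooth_affine; exact: smooth_flat.
  by apply/funext => x; congr flat; ring.
Qed.

Lemma bump_out n a b x : ~~ (a < x < b) -> bump n a b x = 0.
Proof.
rewrite /bump /flat negb_and -!leNgt => /orP[xa|bx].
- by rewrite ltNge mulr_ge0_le0 ?subr_le0//= mul0r.
- by rewrite [X in _ * (if X then _ else _)]ltNge mulr_ge0_le0 ?subr_le0//= mulr0.
Qed.

Lemma bump_ge0 n a b x : 0 <= bump n a b x.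
Proof. by rewrite mulr_ge0 ?flat_ge0. Qed.

Lemma bump_le1 n a b x : bump n a b x <= 1.
Proof. by rewrite mulr_ile1 ?flat_ge0 ?flat_le. Qed.

Lemma test_function_smooth phi a b : smooth phi ->
  (forall x, ~~ (a < x < b) -> phi x = 0) -> test_function phi.
Proof.
move=> sphi phi0; split=> //.
apply: (@subclosed_compact _ _ `[a, b]%classic).
- exact: closed_closure.
- exact: segment_compact.
- rewrite [X in _ `<=` X](_ : _ = closure `[a, b]%classic); last first.
    by apply/closure_id; exact: itv_closed.
  apply: closure_subset => x /=; rewrite in_itv/= => nz.
  have : a < x < b by apply: contraNT nz => /phi0 ->.
  by move=> /andP[/ltW-> /ltW->].
Qed.

Lemma test_function_bump n a b : test_function (bump n a b).
Proof.
by apply: (@test_function_smooth _ a b); [exact: smooth_bump|exact: bump_out].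
Qed.

Lemma cvg_bump b x :
  bump n (- n%:R) b x @[n --> \oo] --> (\1_(`]-oo, b[%classic) x : R).
Proof.
rewrite indicE; have [xb|xb] := boolP (x \in `]-oo, b[%classic); last first.
  rewrite (_ : (fun n => _) = cst 0); first exact: cvg_cst.
  apply/funext => n; apply: bump_out; apply: contra xb => /andP[_ xb].
  by rewrite inE/= in_itv.
move: xb; rewrite inE/= in_itv/= => xb.
rewrite -[X in _ --> X](mulr1 1); apply: cvgM; apply: cvg_flat0.
- apply/cvgryPge => A; near=> n.
  have An : A <= n%:R by near: n; exact: nbhs_infty_ger.
  apply: (le_trans An); rewrite ler_peMr// opprK -lerBlDl.
  by near: n; exact: nbhs_infty_ger.
- apply/cvgryPge => A; near=> n.
  rewrite -ler_pdivrMr ?subr_gt0//.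
  by near: n; exact: nbhs_infty_ger.
Unshelve. all: by end_near. Qed.

(* The primitive of [f] vanishes because bumps supported in [`]-n, b[] converge
   boundedly to the indicator of [`]-oo, b[]; then differentiate it. *)
Lemma ae_eq0_of_test f : mu.-integrable [set: R] (EFin \o f) ->
  (forall phi, test_function phi -> \int[mu]_x (f x * phi x) = 0) ->
  {ae mu, forall x, f x = 0}.
Proof.
move=> intf f0.
have mf := integrable_measurable intf.
have itv0 b : \int[mu]_(x in `]-oo, b]) f x = 0.
  rewrite -Rintegral_itv_bndo_bndc; last exact: integrableS intf.
  have [] := @Rintegral_dominated _ (fun n x => f x * bump n (- n%:R) b x)
    (fun x => f x * \1_(`]-oo, b[%classic) x) (fun x => `|f x|).
  - move=> n; apply: measurable_funM => //.
    by apply: continuous_measurable_fun; exact/smooth_continuous/smooth_bump.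
  - by move=> x; apply: cvgM; [exact: cvg_cst|exact: cvg_bump].
  - exact: integrable_norm.
  - move=> n x /=; rewrite normrM ler_piMr// ger0_norm ?bump_ge0//.
    exact: bump_le1.
  move=> _ cv; rewrite Rintegral_mkcond.
  transitivity (\int[mu]_x (f x * \1_(`]-oo, b[%classic) x)).
    by apply: eq_Rintegral => x _; rewrite patchE indicE; case: ifP => _;
      rewrite ?mulr1 ?mulr0.
  rewrite -(cvg_lim _ cv)//; apply/cvg_lim => //.
  rewrite (_ : (fun n => _) = cst 0); first exact: cvg_cst.
  by apply/funext => n; apply: f0; exact: test_function_bump.
have locf : locally_integrable [set: R] f.
  by apply: open_integrable_locally => //; exact: openT.
have inty y : mu.-integrable `]-oo, y] (EFin \o f) by exact: integrableS intf.
have := FTC1Ny inty locf.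
apply: filterS; first exact: (ae_filter_ringOfSetsType mu).
move=> x [_ <-].
rewrite (_ : (fun _ => _) = cst 0); first by rewrite derive1_cst.
by apply/funext => y; exact: itv0.
Qed.

End NullWeak.

(** * Complex-valued integrals and square integrable functions *)

Section Normc.
Context {R : realType}.
Local Notation normc := (@ComplexField.Normc.normc R).
Local Notation Re := (@complex.Re R).
Local Notation Im := (@complex.Im R).
Implicit Types (z w : R[i]).

Lemma normc_sqrt z : normc z = Num.sqrt (Re z ^+ 2 + Im z ^+ 2).
Proof. by case: z. Qed.

Lemma normc_ge0 z : 0 <= normc z.
Proof. by rewrite normc_sqrt sqrtr_ge0. Qed.

Lemma sqr_normcE z : normc z ^+ 2 = Re z ^+ 2 + Im z ^+ 2.
Proof. by rewrite normc_sqrt sqr_sqrtr// addr_ge0 ?sqr_ge0. Qed.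

Lemma normc_Re z : `|Re z| <= normc z.
Proof. by rewrite normc_sqrt -sqrtr_sqr ler_wsqrtr// lerDl sqr_ge0. Qed.

Lemma normc_Im z : `|Im z| <= normc z.
Proof. by rewrite normc_sqrt -sqrtr_sqr ler_wsqrtr// lerDr sqr_ge0. Qed.

Lemma normc_le_ReIm z : normc z <= `|Re z| + `|Im z|.
Proof.
rewrite -[leRHS]ger0_norm ?addr_ge0// -sqrtr_sqr normc_sqrt ler_wsqrtr//.
rewrite sqrrD !real_normK ?num_real// -addrA [X in _ <= _ + X]addrC addrA lerDl.
by rewrite mulrn_wge0// mulr_ge0.
Qed.

Lemma normcM z w : normc (z * w) = normc z * normc w.
Proof. exact: ComplexField.Normc.normcM. Qed.

Lemma ler_normcD z w : normc (z + w) <= normc z + normc w.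
Proof. exact: le_normcD. Qed.

Lemma normc_opp z : normc (- z) = normc z.
Proof. exact: complex.normcN. Qed.

Lemma ler_normcB z w : normc (z - w) <= normc z + normc w.
Proof. by rewrite -(normc_opp w); exact: ler_normcD. Qed.

Lemma normcV z : normc z^-1 = (normc z)^-1.
Proof. exact: ComplexField.Normc.normcV. Qed.

Lemma normc_conj z : normc (z^*)%C = normc z.
Proof. by case: z => a b /=; rewrite sqrrN. Qed.

Lemma normc_real (x : R) : normc x%:C%C = `|x|.
Proof. by rewrite normc_sqrt/= expr0n addr0 sqrtr_sqr. Qed.

Lemma normc_eq0 z : (normc z == 0) = (z == 0).
Proof.
apply/eqP/eqP; first exact: ComplexField.Normc.eq0_normc.
by move=> ->; exact: ComplexField.Normc.normc0.
Qed.

Lemma normc_gt0 z : (0 < normc z) = (z != 0).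
Proof. by rewrite lt0r normc_ge0 andbT normc_eq0. Qed.

Lemma normcX z n : normc (z ^+ n) = normc z ^+ n.
Proof.
elim: n => [|n IH]; first by rewrite !expr0 ComplexField.Normc.normc1.
by rewrite !exprS normcM IH.
Qed.

Lemma Re_mul z w : Re (z * w) = Re z * Re w - Im z * Im w.
Proof. by case: z w => [a b] [c d]. Qed.

Lemma Im_mul z w : Im (z * w) = Re z * Im w + Im z * Re w.
Proof. by case: z w => [a b] [c d]. Qed.

Lemma Re_add z w : Re (z + w) = Re z + Re w.
Proof. by case: z w => [a b] [c d]. Qed.

Lemma Im_add z w : Im (z + w) = Im z + Im w.
Proof. by case: z w => [a b] [c d]. Qed.

Lemma Re_opp z : Re (- z) = - Re z. Proof. by case: z. Qed.

Lemma Im_opp z : Im (- z) = - Im z. Proof. by case: z. Qed.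

Lemma complex_ext z w : Re z = Re w -> Im z = Im w -> z = w.
Proof. by case: z w => [a b] [c d] /= -> ->. Qed.

End Normc.

Section ComplexIntegral.
Context {R : realType}.
Local Notation mu := (@lebesgue_measure R).
Local Notation normc := (@ComplexField.Normc.normc R).
Local Notation Re := (@complex.Re R).
Local Notation Im := (@complex.Im R).
Implicit Types (f g : R -> R[i]) (h : R -> R) (c : R[i]).

Definition cmeasurable f := measurable_fun [set: R] (fun x => Re (f x)) /\
  measurable_fun [set: R] (fun x => Im (f x)).

Definition cintegrable f := mu.-integrable [set: R] (EFin \o (fun x => Re (f x))) /\
  mu.-integrable [set: R] (EFin \o (fun x => Im (f x))).

Lemma cmeasurable_cst c : cmeasurable (fun=> c).
Proof. by split; exact: measurable_cst. Qed.

Lemma cmeasurableM f g : cmeasurable f -> cmeasurable g ->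
  cmeasurable (fun x => f x * g x).
Proof.
move=> [rf jf] [rg jg]; split.
- by under eq_fun do rewrite Re_mul; apply: measurable_funB; exact: measurable_funM.
- by under eq_fun do rewrite Im_mul; apply: measurable_funD; exact: measurable_funM.
Qed.

Lemma cmeasurable_conj f : cmeasurable f -> cmeasurable (fun x => (f x)^*%C).
Proof.
move=> [rf jf]; split.
- by rewrite (_ : (fun _ => _) = (fun x => Re (f x)))//; apply/funext => x; case: (f x).
- rewrite (_ : (fun _ => _) = (fun x => - Im (f x))); last first.
    by apply/funext => x; case: (f x).
  exact: measurableT_comp.
Qed.

Lemma measurable_normc f : cmeasurable f ->
  measurable_fun [set: R] (fun x => normc (f x)).
Proof.
move=> [rf jf]; under eq_fun do rewrite normc_sqrt.
apply: (@measurableT_comp _ _ _ _ _ _ (@Num.sqrt R)).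
  by apply: continuous_measurable_fun; exact: sqrt_continuous.
by apply: measurable_funD; exact: measurable_funX.
Qed.

Lemma cintegrable_cmeasurable f : cintegrable f -> cmeasurable f.
Proof. by move=> [/integrable_measurable ? /integrable_measurable]. Qed.

Lemma cintegrable_bounded f h : cmeasurable f ->
  mu.-integrable [set: R] (EFin \o h) -> (forall x, normc (f x) <= h x) ->
  cintegrable f.
Proof.
move=> [rf jf] ih fh; split; apply: integrable_bounded ih _ => // x.
- exact: le_trans (normc_Re _) (fh x).
- exact: le_trans (normc_Im _) (fh x).
Qed.

Lemma cintegrable_normc f : cintegrable f ->
  mu.-integrable [set: R] (EFin \o (fun x => normc (f x))).
Proof.
move=> fi; have [rf jf] := fi.
apply: (@integrable_bounded _ _ (fun x => `|Re (f x)| + `|Im (f x)|)).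
- by apply: measurable_normc; exact: cintegrable_cmeasurable.
- exact: (integrableD measurableT (integrable_norm rf) (integrable_norm jf)).
- by move=> x; rewrite ger0_norm ?normc_ge0// normc_le_ReIm.
Qed.

Lemma cintegrableD f g : cintegrable f -> cintegrable g ->
  cintegrable (fun x => f x + g x).
Proof.
move=> [rf jf] [rg jg]; split.
- rewrite (_ : _ \o _ = (fun x => ((Re (f x))%:E + (Re (g x))%:E)%E)).
    exact: integrableD.
  by apply/funext => x; rewrite /= Re_add.
- rewrite (_ : _ \o _ = (fun x => ((Im (f x))%:E + (Im (g x))%:E)%E)).
    exact: integrableD.
  by apply/funext => x; rewrite /= Im_add.
Qed.

Lemma cintegrableZl c f : cintegrable f -> cintegrable (fun x => c * f x).
Proof.
move=> fi; apply: (@cintegrable_bounded _ (fun x => normc c * normc (f x))).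
- by apply: cmeasurableM; [exact: cmeasurable_cst|exact: cintegrable_cmeasurable].
- by have := integrableZl measurableT (normc c) (cintegrable_normc fi).
- by move=> x; rewrite normcM.
Qed.

Lemma cintegrableB f g : cintegrable f -> cintegrable g ->
  cintegrable (fun x => f x - g x).
Proof.
move=> fi gi; rewrite (_ : (fun x => _) = (fun x => f x + (-1) * g x)).
  by apply: cintegrableD => //; exact: cintegrableZl.
by apply/funext => x; rewrite mulN1r.
Qed.

Lemma eq_cintegral f g : f =1 g -> cintegral f = cintegral g.
Proof. by move=> /funext ->. Qed.

Lemma cintegralD f g : cintegrable f -> cintegrable g ->
  cintegral (fun x => f x + g x) = cintegral f + cintegral g.
Proof.
move=> [rf jf] [rg jg]; rewrite /cintegral; apply: complex_ext.
- rewrite Re_add/= -RintegralD//.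
  by apply: eq_Rintegral => x _; rewrite Re_add.
- rewrite Im_add/= -RintegralD//.
  by apply: eq_Rintegral => x _; rewrite Im_add.
Qed.

Lemma cintegralZl c f : cintegrable f ->
  cintegral (fun x => c * f x) = c * cintegral f.
Proof.
move=> [rf jf]; have iZ k h : mu.-integrable [set: R] (EFin \o h) ->
    mu.-integrable [set: R] (EFin \o (fun x => k * h x)).
  by move=> ih; have := integrableZl measurableT k ih.
rewrite /cintegral; apply: complex_ext.
- rewrite Re_mul/= -!RintegralZl// -RintegralB//; [|exact: iZ..].
  by apply: eq_Rintegral => x _; rewrite Re_mul.
- rewrite Im_mul/= -!RintegralZl// -RintegralD//; [|exact: iZ..].
  by apply: eq_Rintegral => x _; rewrite Im_mul.
Qed.

Lemma cintegralB f g : cintegrable f -> cintegrable g ->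
  cintegral (fun x => f x - g x) = cintegral f - cintegral g.
Proof.
move=> fi gi; rewrite -[- cintegral g]mulN1r -cintegralZl// -cintegralD//.
  by apply: eq_cintegral => x; rewrite mulN1r.
exact: cintegrableZl.
Qed.

Lemma ae_eq_cintegral f g : cmeasurable f -> cmeasurable g ->
  {ae mu, forall x, f x = g x} -> cintegral f = cintegral g.
Proof.
move=> [rf jf] [rg jg] fg; rewrite /cintegral /Rintegral.
congr (Complex (fine _) (fine _)); apply: ae_eq_integral => //;
  try exact/measurable_EFinP; move: fg;
  (apply: filterS; first exact: (ae_filter_ringOfSetsType mu)) => x fgx _;
  by rewrite /= fgx.
Qed.

(** The factor 2 comes from estimating real and imaginary parts separately; such constants are
    harmless for a resolvent norm tending to infinity. *)
Lemma normc_cintegral_le f : cintegrable f ->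
  normc (cintegral f) <= 2 * \int[mu]_x normc (f x).
Proof.
move=> fi; have [rf jf] := fi; have nf := cintegrable_normc fi.
apply: (le_trans (normc_le_ReIm _)); rewrite /= mulr_natl mulr2n; apply: lerD.
- apply: (le_trans (le_normr_Rintegral _ rf)) => //.
  apply: le_Rintegral => //; first exact: (integrable_norm rf).
  by move=> x _; exact: normc_Re.
- apply: (le_trans (le_normr_Rintegral _ jf)) => //.
  apply: le_Rintegral => //; first exact: (integrable_norm jf).
  by move=> x _; exact: normc_Im.
Qed.

End ComplexIntegral.

(** * Square integrable complex functions and the bilinear pairing *)

Section L2Theory.
Context {R : realType}.
Local Notation mu := (@lebesgue_measure R).
Local Notation normc := (@ComplexField.Normc.normc R).
Implicit Types (f g : R -> R[i]) (c : R[i]).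

Definition sqnorm f : R := \int[mu]_x (normc (f x) ^+ 2).

Lemma Lnorm2_poweR f :
  (L2norm f `^ 2)%E = (\int[mu]_x (normc (f x) ^+ 2)%:E)%E.
Proof.
rewrite /L2norm powR_Lnorm//; apply: eq_integral => x _.
by rewrite /= ger0_norm ?normc_ge0// -powR_mulrn ?normc_ge0.
Qed.

Lemma L2_cmeasurable f : L2 f -> cmeasurable f.
Proof. by case. Qed.

Lemma measurable_sqr_normc f : cmeasurable f ->
  measurable_fun [set: R] (fun x => normc (f x) ^+ 2).
Proof. by move=> mf; apply: measurable_funX; exact: measurable_normc. Qed.

Lemma L2_sqr_integrable f : L2 f ->
  mu.-integrable [set: R] (EFin \o (fun x => normc (f x) ^+ 2)).
Proof.
move=> f2; have [_ _ fy] := f2; apply/integrableP; split.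
  by apply/measurable_EFinP; apply: measurable_sqr_normc; exact: L2_cmeasurable.
under eq_integral do rewrite /= ger0_norm ?sqr_ge0//.
by rewrite -Lnorm2_poweR poweR_lty.
Qed.

Lemma L2normE f : cmeasurable f ->
  mu.-integrable [set: R] (EFin \o (fun x => normc (f x) ^+ 2)) ->
  L2norm f = (Num.sqrt (sqnorm f))%:E.
Proof.
move=> mf fi; rewrite /L2norm unlock.
under eq_integral => x _ do
  rewrite /= ger0_norm ?normc_ge0// powR_mulrn ?normc_ge0//.
have -> : (\int[mu]_x (normc (f x) ^+ 2)%:E)%E = (sqnorm f)%:E.
  by rewrite /sqnorm /Rintegral fineK//; exact: integrable_fin_num fi.
by rewrite poweR_EFin powR12_sqrt// Rintegral_ge0// => x _; rewrite sqr_ge0.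
Qed.

Lemma L2_of_integrable f : cmeasurable f ->
  mu.-integrable [set: R] (EFin \o (fun x => normc (f x) ^+ 2)) -> L2 f.
Proof. by move=> mf fi; have [rf jf] := mf; split=> //; rewrite L2normE// ltry. Qed.

Lemma L2_bounded f (h : R -> R) : cmeasurable f ->
  mu.-integrable [set: R] (EFin \o h) ->
  (forall x, normc (f x) ^+ 2 <= h x) -> L2 f.
Proof.
move=> mf ih fh; apply: L2_of_integrable => //.
apply: integrable_bounded ih _; first exact: measurable_sqr_normc.
by move=> x; rewrite ger0_norm ?sqr_ge0.
Qed.

Lemma L2_fineK f : L2 f -> (fine (L2norm f))%:E = L2norm f.
Proof.
by move=> [_ _ fy]; rewrite fineK// ge0_fin_numE// /L2norm Lnorm_ge0.
Qed.

Lemma L2M f g : L2 f -> L2 g -> cintegrable (fun x => f x * g x).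
Proof.
move=> f2 g2; have fi := L2_sqr_integrable f2; have gi := L2_sqr_integrable g2.
apply: (@cintegrable_bounded _ _ (fun x => normc (f x) ^+ 2 + normc (g x) ^+ 2)).
- by apply: cmeasurableM; exact: L2_cmeasurable.
- exact: (integrableD measurableT fi gi).
- move=> x; rewrite normcM.
  have := sqr_ge0 (normc (f x) - normc (g x)).
  have := normc_ge0 (f x); have := normc_ge0 (g x); nra.
Qed.

(** Hölder's inequality with exponents 2 and 2, applied to the moduli. The pairing is bilinear,
    without conjugation, because it is later differentiated along complex directions of the
    parameter of [g]. *)
Lemma normc_cintegralM_le f g : L2 f -> L2 g ->
  normc (cintegral (fun x => f x * g x)) <=
  2 * (fine (L2norm f) * fine (L2norm g)).
Proof.
move=> f2 g2; have fg := L2M f2 g2.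
apply: (le_trans (normc_cintegral_le fg)); rewrite ler_wpM2l//.
rewrite -lee_fin EFinM !L2_fineK//.
have := @hoelder _ _ _ mu (fun x => normc (f x)) (fun x => normc (g x)) 2 2.
move=> /(_ (measurable_normc (L2_cmeasurable f2))
           (measurable_normc (L2_cmeasurable g2)) (ltr0Sn _ 1) (ltr0Sn _ 1)).
have -> : 2^-1 + 2^-1 = 1 :> R by lra.
move=> /(_ erefl); apply: le_trans; rewrite Lnorm1.
rewrite /Rintegral fineK; last first.
  by apply: integrable_fin_num => //; exact: cintegrable_normc fg.
rewrite le_eqVlt; apply/orP; left; apply/eqP; apply: eq_integral => x _ /=.
by rewrite normcM ger0_norm// mulr_ge0 ?normc_ge0.
Qed.

End L2Theory.

(** * Weak derivatives *)

Section TestFunctions.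
Context {R : realType}.
Local Notation mu := (@lebesgue_measure R).
Implicit Types (f g u v phi : R -> R).

Definition square_integrable f := measurable_fun [set: R] f /\
  mu.-integrable [set: R] (EFin \o (fun x => f x ^+ 2)).

Lemma square_integrableM f g : square_integrable f -> square_integrable g ->
  mu.-integrable [set: R] (EFin \o (fun x => f x * g x)).
Proof.
move=> [mf fi] [mg gi].
apply: (@integrable_bounded _ _ (fun x => f x ^+ 2 + g x ^+ 2)).
- exact: measurable_funM.
- exact: (integrableD measurableT fi gi).
- move=> x; have := sqr_ge0 (f x - g x); have := sqr_ge0 (f x + g x) => h1 h2.
  by rewrite ler_norml; apply/andP; split; nra.
Qed.

Lemma square_integrable_norm f : square_integrable f ->
  square_integrable (fun x => `|f x|).
Proof.
move=> [mf fi]; split; first exact: measurableT_comp.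
rewrite (_ : (fun x => _) = (fun x => f x ^+ 2))//.
by apply/funext => x; rewrite real_normK// num_real.
Qed.

Lemma square_integrableD f g : square_integrable f -> square_integrable g ->
  square_integrable (fun x => f x + g x).
Proof.
move=> sf sg; have [mf fi] := sf; have [mg gi] := sg.
split; first exact: measurable_funD.
have fgi := square_integrableM sf sg.
rewrite (_ : _ \o _ = (fun x => ((f x ^+ 2)%:E + (g x ^+ 2)%:E +
   (f x * g x)%:E + (f x * g x)%:E)%E)).
  by do 3 apply: integrableD => //.
by apply/funext => x /=; rewrite -!EFinD; congr EFin; ring.
Qed.

Lemma test_function_mul f phi : smooth f -> test_function phi ->
  test_function (fun x => f x * phi x).
Proof.
move=> sf [sphi cphi]; split; first exact: smoothM.
apply: subclosed_compact cphi _; first exact: closed_closure.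
by apply: closure_subset => x /=; apply: contra => /eqP ->; rewrite mulr0.
Qed.

Lemma test_function_derive1 phi : test_function phi -> test_function (derive1 phi).
Proof.
move=> [sphi cphi]; split; first exact: smooth_derive1.
apply: subclosed_compact cphi _; first exact: closed_closure.
rewrite [X in _ `<=` X](_ : _ = closure (closure [set x | phi x != 0])); last first.
  by apply/closure_id; exact: closed_closure.
apply: closure_subset => x /=; apply: contraPP => /= nx.
apply/negP; rewrite negbK.
have : open (~` closure [set x | phi x != 0]) by apply/closed_openC/closed_closure.
rewrite openE => /(_ x nx) xnbhs.
have : is_derive x 1 phi 0.
  apply: near_eq_is_derive (is_derive_cst 0 x 1).
  apply: filterS xnbhs => y ny; apply/eqP; rewrite eq_sym.
  by apply: contrapT => /negP phiy; apply: ny; exact: subset_closure.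
by move=> /is_derive_derive1 ->.
Qed.

Lemma test_function_support phi : test_function phi ->
  exists2 M : R, 0 < M & forall x, M <= `|x| -> phi x = 0.
Proof.
move=> [_ /compact_bounded[M [Mr HM]]].
exists (`|M| + 1); first by rewrite ltr_wpDl.
move=> x xM; apply/eqP; apply: contraT => phix.
have := HM ((`|M| + `|x|) / 2).
have Mx : M < (`|M| + `|x|) / 2.
  have := ler_norm M; rewrite ltr_pdivlMr//; lra.
have cx : closure [set x | phi x != 0] x by exact: subset_closure.
move=> /(_ Mx x cx) /=.
rewrite ler_pdivlMr//; lra.
Qed.

Lemma Rintegral_support f (M : R) : (forall x, M <= `|x| -> f x = 0) ->
  \int[mu]_x f x = \int[mu]_(x in `[- M, M]) f x.
Proof.
move=> f0; rewrite [RHS]Rintegral_mkcond; apply: eq_Rintegral => x _.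
rewrite patchE; case: ifPn => // xM; apply: f0.
move: xM; rewrite notin_setE/= in_itv/= => /negP; rewrite negb_and -!ltNge.
move=> /orP[xM|xM]; first by rewrite ler_normr; apply/orP; right; lra.
by rewrite ler_normr; apply/orP; left; lra.
Qed.

Lemma integrable_test phi : test_function phi ->
  mu.-integrable [set: R] (EFin \o phi).
Proof.
move=> tphi; have [sphi _] := tphi.
have [M M0 phi0] := test_function_support tphi.
rewrite (_ : _ \o _ = (EFin \o phi) \_ `[- M, M]%classic).
  apply/(integrable_mkcond _ _).1 => //.
  apply: continuous_compact_integrable; first exact: segment_compact.
  by apply: continuous_subspaceT; exact: smooth_continuous.
apply/funext => x; rewrite patchE; case: ifPn => // xM; rewrite /= phi0//.
move: xM; rewrite notin_setE/= in_itv/= => /negP; rewrite negb_and -!ltNge.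
move=> /orP[xM|xM]; first by rewrite ler_normr; apply/orP; right; lra.
by rewrite ler_normr; apply/orP; left; lra.
Qed.

Lemma square_integrable_test phi : test_function phi -> square_integrable phi.
Proof.
move=> tphi; have [sphi _] := tphi; split.
  by apply: continuous_measurable_fun; exact: smooth_continuous.
have := integrable_test (test_function_mul sphi tphi).
by rewrite (_ : (fun x => _) = (fun x => phi x ^+ 2)).
Qed.

Lemma Rintegral_derive1_test phi : test_function phi ->
  \int[mu]_x (derive1 phi x) = 0.
Proof.
move=> tphi; have [sphi _] := tphi.
have [M M0 phi0] := test_function_support tphi.
have [M' M0' phi0'] := test_function_support (test_function_derive1 tphi).
(* [M + M'] lies beyond the supports of both [phi] and its derivative. *)
have M2 : 0 < M + M' by rewrite addr_gt0.
rewrite (@Rintegral_support _ (M + M')); last first.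
  by move=> x xM; apply: phi0'; apply: le_trans xM; rewrite lerDr ltW.
have c1 : continuous phi by exact: smooth_continuous.
rewrite /Rintegral (@continuous_FTC2 _ _ phi).
- have nM : M <= `|M + M'| by rewrite ger0_norm ?lerDl ltW.
  by rewrite (phi0 _ nM) phi0 ?normrN//= subrr.
- lra.
- apply: continuous_subspaceT; apply: smooth_continuous; exact: smooth_derive1.
- split.
  + by move=> x _; exact: smooth_derivable.
  + by apply: cvg_at_right_filter; exact: c1.
  + by apply: cvg_at_left_filter; exact: c1.
- by move=> x _.
Qed.

Lemma Rintegral_parts_test g phi : smooth g -> test_function phi ->
  \int[mu]_x (g x * derive1 phi x) = - \int[mu]_x (derive1 g x * phi x).
Proof.
move=> sg tphi; have [sphi _] := tphi.
have t1 := test_function_mul sg (test_function_derive1 tphi).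
have t2 := test_function_mul (smooth_derive1 sg) tphi.
apply/eqP; rewrite -addr_eq0 -RintegralD//; [|exact: integrable_test..].
have := Rintegral_derive1_test (test_function_mul sg tphi).
move=> <-; apply/eqP; apply: eq_Rintegral => x _.
have := is_deriveM (smooth_is_derive x sg) (smooth_is_derive x sphi).
move=> /is_derive_derive1 ->; rewrite /GRing.scale/=; ring.
Qed.

End TestFunctions.

(** * Integration by parts against smooth square integrable functions *)

Section WeakDerivative.
Context {R : realType}.
Local Notation mu := (@lebesgue_measure R).
Implicit Types (g h u v phi : R -> R) (f G V : R -> R[i]).

Definition weak_derivative_real u v := forall phi, test_function phi ->
  \int[mu]_x (u x * derive1 phi x) = - \int[mu]_x (v x * phi x).

(** The flanks keep a fixed shape and move outwards, so the derivatives are bounded uniformly in [n]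
    and tend to 0 pointwise; steepening the flanks instead would destroy that bound. *)
Definition cutoff (n : nat) : R -> R := bump 1 (- n%:R) n%:R.

Lemma test_function_cutoff n : test_function (cutoff n).
Proof. exact: test_function_bump. Qed.

Lemma cutoffE n x : cutoff n x = flat 0 (x + n%:R) * flat 0 (n%:R - x).
Proof. by rewrite /cutoff /bump !mul1r opprK. Qed.

Lemma derive1_cutoff n x : derive1 (cutoff n) x =
  flat 2 (x + n%:R) * flat 0 (n%:R - x) - flat 0 (x + n%:R) * flat 2 (n%:R - x).
Proof.
apply: is_derive_derive1.
rewrite (_ : cutoff n = (flat 0 \o (fun x => x + n%:R)) * (flat 0 \o (fun x => n%:R - x)));
  last by apply/funext => y; rewrite cutoffE.
have d1 : is_derive x 1 (flat 0 \o (fun x => x + n%:R)) (flat 2 (x + n%:R)).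
  have := smooth_is_derive (x + n%:R) (@smooth_flat R 0).
  rewrite derive1_flat0 => h1.
  have h2 : is_derive x 1 (fun x => x + n%:R) (1 + 0) by exact: is_deriveD.
  by have := @is_derive1_comp _ _ (fun x => x + n%:R) _ _ _ h1 h2; rewrite addr0 mulr1.
have d2 : is_derive x 1 (flat 0 \o (fun x => n%:R - x)) (- flat 2 (n%:R - x)).
  have := smooth_is_derive (n%:R - x) (@smooth_flat R 0).
  rewrite derive1_flat0 => h1.
  have h2 : is_derive x 1 (fun x => n%:R - x) (0 - 1) by exact: is_deriveB.
  by have := @is_derive1_comp _ _ (fun x => n%:R - x) _ _ _ h1 h2; rewrite sub0r mulrN1.
have := is_deriveM d1 d2; rewrite /GRing.scale/= => H.
by apply: (is_derive_eq H); ring.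
Qed.

Lemma cvg_addn (x : R) : x + n%:R @[n --> \oo] --> +oo.
Proof.
apply/cvgryPge => A; near=> n; rewrite -lerBlDl.
by near: n; exact: nbhs_infty_ger.
Unshelve. all: by end_near. Qed.

Lemma cvg_subn (x : R) : n%:R - x @[n --> \oo] --> +oo.
Proof. by under eq_fun do rewrite addrC; exact: cvg_addn. Qed.

Lemma cvg_cutoff x : cutoff n x @[n --> \oo] --> (1 : R).
Proof.
rewrite (_ : cutoff ^~ x = (fun n => flat 0 (x + n%:R) * flat 0 (n%:R - x))).
  have := cvgM (cvg_flat0 (cvg_addn x)) (cvg_flat0 (cvg_subn x)).
  by rewrite mulr1; apply.
by apply/funext => n; rewrite cutoffE.
Qed.

Lemma cvg_derive1_cutoff x : derive1 (cutoff n) x @[n --> \oo] --> (0 : R).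
Proof.
rewrite (_ : (fun n => _) = (fun n => flat 2 (x + n%:R) * flat 0 (n%:R - x) -
    flat 0 (x + n%:R) * flat 2 (n%:R - x))).
  have := cvgB (cvgM (cvg_flat2 (cvg_addn x)) (cvg_flat0 (cvg_subn x)))
               (cvgM (cvg_flat0 (cvg_addn x)) (cvg_flat2 (cvg_subn x))).
  by rewrite mulr1 mul1r subrr; apply.
by apply/funext => n; rewrite derive1_cutoff.
Qed.

Lemma derive1_cutoff_le n x : `|derive1 (cutoff n) x| <= 4.
Proof.
rewrite derive1_cutoff; apply: (le_trans (ler_normB _ _)).
have := @flat_le R 2; have := @flat_ge0 R 2; have := @flat_ge0 R 0; have := @flat_le R 0.
rewrite fact0 => a0 b0 b2 a2.
rewrite !normrM !ger0_norm//.
have a2' y : flat 2 y <= (2 : R) by exact: a2.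
have h1 : flat 2 (x + n%:R) * flat 0 (n%:R - x) <= 2 * (1 : R) by exact: ler_pM.
have h2 : flat 0 (x + n%:R) * flat 2 (n%:R - x) <= (1 : R) * 2 by exact: ler_pM.
lra.
Qed.

(** Gaussians are not compactly supported, so they are not test functions. The identity is applied
    to [g * cutoff n] and passes to the limit by dominated convergence, with dominating functions
    [|u| (|g'| + 4 |g|)] and [|v| |g|]. *)
Lemma weak_derivative_parts u v g :
  square_integrable u -> square_integrable v -> weak_derivative_real u v ->
  smooth g -> square_integrable g -> square_integrable (derive1 g) ->
  \int[mu]_x (u x * derive1 g x) = - \int[mu]_x (v x * g x).
Proof.
move=> u2 v2 uv sg g2 dg2; have [mu' _] := u2; have [mv _] := v2; have [mg _] := g2.
have dmul n x : derive1 (fun x => g x * cutoff n x) x =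
    derive1 g x * cutoff n x + g x * derive1 (cutoff n) x.
  have [sc _] := test_function_cutoff n.
  have := is_deriveM (smooth_is_derive x sg) (smooth_is_derive x sc).
  by move=> /is_derive_derive1 ->; rewrite /GRing.scale/=; ring.
have c01 n x : `|cutoff n x| <= 1 by rewrite ger0_norm ?bump_le1// bump_ge0.
have tc n := test_function_mul sg (test_function_cutoff n).
have [_ lhs] : mu.-integrable [set: R] (EFin \o (fun x => u x * derive1 g x)) /\
    \int[mu]_x (u x * derive1 (fun x => g x * cutoff n x) x) @[n --> \oo] -->
    \int[mu]_x (u x * derive1 g x).
  apply: (@Rintegral_dominated _ _ _ (fun x => `|u x| * (`|derive1 g x| + 4 * `|g x|))).
  - move=> n; apply: measurable_funM => //.
    exact: (square_integrable_test (test_function_derive1 (tc n))).1.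
  - move=> x; under eq_fun do rewrite dmul.
    have -> : u x * derive1 g x = u x * (derive1 g x * 1 + g x * 0) by ring.
    apply: cvgM; first exact: cvg_cst.
    apply: cvgD; apply: cvgM; [exact: cvg_cst|exact: cvg_cutoff|exact: cvg_cst|].
    exact: cvg_derive1_cutoff.
  - apply: square_integrableM; first exact: square_integrable_norm.
    apply: square_integrableD; first exact: square_integrable_norm.
    have [m1 i1] := square_integrable_norm g2; split; first exact: measurable_funM.
    have := integrableZl measurableT 16 i1.
    rewrite (_ : (fun x => _) = (EFin \o (fun x => (4 * `|g x|) ^+ 2)))//.
    by apply/funext => x /=; congr EFin; ring.
  - move=> n x; rewrite normrM ler_wpM2l// dmul (le_trans (ler_normD _ _))//.
    rewrite (normrM (derive1 g x)) (normrM (g x)) lerD//.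
      by rewrite ler_piMr ?c01.
    by rewrite mulrC ler_wpM2r// derive1_cutoff_le.
have [_ rhs] : mu.-integrable [set: R] (EFin \o (fun x => v x * g x)) /\
    \int[mu]_x (v x * (g x * cutoff n x)) @[n --> \oo] --> \int[mu]_x (v x * g x).
  apply: (@Rintegral_dominated _ _ _ (fun x => `|v x| * `|g x|)).
  - move=> n; apply: measurable_funM => //.
    exact: (square_integrable_test (tc n)).1.
  - move=> x; have -> : v x * g x = v x * (g x * 1) by rewrite mulr1.
    apply: cvgM; first exact: cvg_cst.
    by apply: cvgM; [exact: cvg_cst|exact: cvg_cutoff].
  - by apply: square_integrableM; exact: square_integrable_norm.
  - by move=> n x; rewrite (normrM (v x)) (normrM (g x)) ler_wpM2l// ler_piMr ?c01.
rewrite -(cvg_lim _ lhs)//; apply/cvg_lim => //.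
rewrite (_ : (fun n => _) = (fun n => - \int[mu]_x (v x * (g x * cutoff n x)))).
  exact: cvgN rhs.
by apply/funext => n; exact: uv.
Qed.

Lemma smooth_gauss : smooth (fun x : R => expR (- x ^+ 2)).
Proof.
rewrite (_ : (fun _ => _) = (fun x => expR (-1 * (x * x)))).
  apply: (@smooth_comp _ expR); first exact: smooth_expR.
  apply: smoothM; first exact: smooth_cst.
  by apply: smoothM; exact: smooth_id.
by apply/funext => x; rewrite mulN1r expr2.
Qed.

Lemma square_integrable_gauss : square_integrable (fun x : R => expR (- x ^+ 2)).
Proof.
split.
  by apply: continuous_measurable_fun; apply: smooth_continuous; exact: smooth_gauss.
apply: (@integrable_bounded _ _ (@gauss_fun R)); last 2 first.
- exact: integrableT_gauss.
- move=> x; rewrite ger0_norm ?sqr_ge0// /gauss_fun.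
  by rewrite expr2 ler_piMl ?expR_ge0// -expR0 ler_expR oppr_le0 sqr_ge0.
- apply: measurable_funX; exact: measurable_gauss_fun.
Qed.

(** The difference [v1 - v2] is square integrable but perhaps not integrable. Multiplying it by a
    Gaussian, which vanishes nowhere, makes it integrable and sends test functions to test
    functions. *)
Lemma weak_derivative_real_uniq u v1 v2 :
  square_integrable v1 -> square_integrable v2 ->
  weak_derivative_real u v1 -> weak_derivative_real u v2 ->
  {ae mu, forall x, v1 x = v2 x}.
Proof.
move=> s1 s2 w1 w2; pose G := fun x : R => expR (- x ^+ 2).
have sG : smooth G := smooth_gauss.
have G2 : square_integrable G := square_integrable_gauss.
have : {ae mu, forall x, v1 x * G x - v2 x * G x = 0}.
  apply: ae_eq0_of_test.
    exact: (integrableB measurableT (square_integrableM s1 G2) (square_integrableM s2 G2)).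
  move=> phi tphi; have tG := test_function_mul sG tphi.
  have t2 := square_integrable_test tG.
  under eq_Rintegral do rewrite mulrBl -!mulrA.
  rewrite RintegralB//; [|exact: square_integrableM..].
  by have := w1 _ tG; rewrite (w2 _ tG) => /oppr_inj ->; rewrite subrr.
apply: filterS; first exact: (ae_filter_ringOfSetsType mu).
move=> x /eqP; rewrite -mulrBl mulf_eq0 subr_eq0 => /orP[/eqP//|].
by rewrite gt_eqF// expR_gt0.
Qed.

End WeakDerivative.

(** * Complex-valued functions of a real variable *)

Section ComplexCalculus.
Context {R : realType}.
Local Notation mu := (@lebesgue_measure R).
Local Notation normc := (@ComplexField.Normc.normc R).
Local Notation Re := (@complex.Re R).
Local Notation Im := (@complex.Im R).
Implicit Types (f g G : R -> R[i]) (z w l : R[i]) (x t : R).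

(** The variable is real even when the function comes from a complex parameter: such functions are
    always restricted to a line. *)
Definition cderiv f x l :=
  is_derive x 1 (fun t => Re (f t)) (Re l) /\ is_derive x 1 (fun t => Im (f t)) (Im l).

Definition csmooth f := smooth (fun t => Re (f t)) /\ smooth (fun t => Im (f t)).

Definition cexp z : R[i] := Complex (expR (Re z) * cos (Im z)) (expR (Re z) * sin (Im z)).

Lemma cexp0 : cexp 0 = 1.
Proof. by rewrite /cexp/= expR0 cos0 sin0 mulr1 mulr0. Qed.

Lemma cexpD z w : cexp (z + w) = cexp z * cexp w.
Proof.
by apply: complex_ext; rewrite ?Re_mul ?Im_mul /= Re_add Im_add expRD ?cosD ?sinD; ring.
Qed.

Lemma cexpN z : cexp (- z) * cexp z = 1.
Proof. by rewrite -cexpD addNr cexp0. Qed.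

Lemma cexp_real x : cexp x%:C%C = (expR x)%:C%C.
Proof. by rewrite /cexp/= cos0 sin0 mulr1 mulr0. Qed.

Lemma cexp_conj z : cexp (z^*)%C = ((cexp z)^*)%C.
Proof. by case: z => a b; rewrite /cexp /= cosN sinN mulrN. Qed.

Lemma normc_cexp z : normc (cexp z) = expR (Re z).
Proof.
rewrite normc_sqrt /= !exprMn -mulrDr cos2Dsin2 mulr1 sqrtr_sqr.
by rewrite ger0_norm ?expR_ge0.
Qed.

Lemma cderiv_cst z x : cderiv (fun=> z) x 0.
Proof. by split; exact: is_derive_cst. Qed.

Lemma cderiv_real x : cderiv (fun t => t%:C%C) x 1.
Proof. by split; [exact: is_derive_id|exact: is_derive_cst]. Qed.

Lemma cderivD f g x l m : cderiv f x l -> cderiv g x m ->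
  cderiv (fun t => f t + g t) x (l + m).
Proof.
move=> [rf jf] [rg jg]; split.
- by under eq_fun do rewrite Re_add; rewrite Re_add; exact: is_deriveD.
- by under eq_fun do rewrite Im_add; rewrite Im_add; exact: is_deriveD.
Qed.

Lemma cderivM f g x l m : cderiv f x l -> cderiv g x m ->
  cderiv (fun t => f t * g t) x (l * g x + f x * m).
Proof.
move=> [rf jf] [rg jg]; split.
- under eq_fun do rewrite Re_mul.
  apply: (is_derive_eq (is_deriveB (is_deriveM rf rg) (is_deriveM jf jg))).
  by rewrite Re_add !Re_mul /GRing.scale/=; ring.
- under eq_fun do rewrite Im_mul.
  apply: (is_derive_eq (is_deriveD (is_deriveM rf jg) (is_deriveM jf rg))).
  by rewrite Im_add !Im_mul /GRing.scale/=; ring.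
Qed.

Lemma cderiv_eq f x l m : cderiv f x l -> l = m -> cderiv f x m.
Proof. by move=> ? <-. Qed.

Lemma cderivZ z f x l : cderiv f x l -> cderiv (fun t => z * f t) x (z * l).
Proof.
move=> fx; apply: cderiv_eq (cderivM (cderiv_cst z x) fx) _.
by rewrite mul0r add0r.
Qed.

Lemma cderiv_cexp f x l : cderiv f x l ->
  cderiv (fun t => cexp (f t)) x (l * cexp (f x)).
Proof.
move=> [rf jf].
have er := is_derive1_comp (is_derive_expR (Re (f x))) rf.
have cj := is_derive1_comp (is_derive_cos (Im (f x))) jf.
have sj := is_derive1_comp (is_derive_sin (Im (f x))) jf.
split.
- apply: (is_derive_eq (is_deriveM er cj)).
  by rewrite Re_mul /GRing.scale/=; ring.
- apply: (is_derive_eq (is_deriveM er sj)).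
  by rewrite Im_mul /GRing.scale/=; ring.
Qed.

Lemma csmooth_cst z : csmooth (fun=> z).
Proof. by split; exact: smooth_cst. Qed.

Lemma csmooth_real : csmooth (fun t => t%:C%C).
Proof. by split; [exact: smooth_id|exact: smooth_cst]. Qed.

Lemma smoothN (h : R -> R) : smooth h -> smooth (fun x => - h x).
Proof.
move=> sh; rewrite (_ : (fun _ => _) = (fun x => cst (-1) x * h x)).
  by apply: smoothM; [exact: smooth_cst|exact: sh].
by apply/funext => x; rewrite mulN1r.
Qed.

Lemma csmoothD f g : csmooth f -> csmooth g -> csmooth (fun t => f t + g t).
Proof.
move=> [rf jf] [rg jg]; split.
- by under eq_fun do rewrite Re_add; exact: smoothD.
- by under eq_fun do rewrite Im_add; exact: smoothD.
Qed.

Lemma csmoothM f g : csmooth f -> csmooth g -> csmooth (fun t => f t * g t).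
Proof.
move=> [rf jf] [rg jg]; split.
- under eq_fun do rewrite Re_mul.
  by apply: smoothD; [exact: smoothM|apply: smoothN; exact: smoothM].
- under eq_fun do rewrite Im_mul.
  by apply: smoothD; exact: smoothM.
Qed.

Lemma csmooth_cexp f : csmooth f -> csmooth (fun t => cexp (f t)).
Proof.
move=> [rf jf]; have er := smooth_comp (@smooth_expR R) rf; split.
- by apply: smoothM; [exact: er|exact: smooth_comp (@smooth_cos R) jf].
- by apply: smoothM; [exact: er|exact: smooth_comp (@smooth_sin R) jf].
Qed.

Lemma csmooth_cmeasurable f : csmooth f -> cmeasurable f.
Proof.
by move=> [/smooth_continuous rf /smooth_continuous jf]; split;
  exact: continuous_measurable_fun.
Qed.

Lemma L2_square_integrable f : L2 f ->
  square_integrable (fun x => Re (f x)) /\ square_integrable (fun x => Im (f x)).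
Proof.
move=> f2; have [rf jf _] := f2; have fi := L2_sqr_integrable f2.
split; split => //; apply: integrable_bounded fi _; try exact: measurable_funX.
- by move=> x; rewrite sqr_normcE ger0_norm ?sqr_ge0// lerDl sqr_ge0.
- by move=> x; rewrite sqr_normcE ger0_norm ?sqr_ge0// lerDr sqr_ge0.
Qed.

Lemma weak_derivativeP f g : weak_derivative f g <->
  weak_derivative_real (fun x => Re (f x)) (fun x => Re (g x)) /\
  weak_derivative_real (fun x => Im (f x)) (fun x => Im (g x)).
Proof.
have ReC (h : R -> R[i]) (k : R -> R) x : Re (h x * (k x)%:C%C) = Re (h x) * k x.
  by rewrite Re_mul /= mulr0 subr0.
have ImC (h : R -> R[i]) (k : R -> R) x : Im (h x * (k x)%:C%C) = Im (h x) * k x.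
  by rewrite Im_mul /= mulr0 add0r.
have cE (h : R -> R[i]) (k : R -> R) : cintegral (fun x => h x * (k x)%:C%C) =
    Complex (\int[mu]_x (Re (h x) * k x)) (\int[mu]_x (Im (h x) * k x)).
  rewrite /cintegral; congr Complex; apply: eq_Rintegral => x _.
    exact: ReC.
  exact: ImC.
split.
- move=> fg; split=> phi /fg; rewrite !cE => H.
  + by have := congr1 Re H; rewrite Re_opp.
  + by have := congr1 Im H; rewrite Im_opp.
- move=> [rfg jfg] phi tphi; rewrite !cE; apply: complex_ext.
  + by rewrite Re_opp; exact: rfg.
  + by rewrite Im_opp; exact: jfg.
Qed.

Lemma weak_derivative_uniq f g1 g2 : L2 g1 -> L2 g2 ->
  weak_derivative f g1 -> weak_derivative f g2 -> {ae mu, forall x, g1 x = g2 x}.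
Proof.
move=> /L2_square_integrable[r1 j1] /L2_square_integrable[r2 j2].
move=> /weak_derivativeP[wr1 wj1] /weak_derivativeP[wr2 wj2].
have := weak_derivative_real_uniq j1 j2 wj1 wj2.
have := weak_derivative_real_uniq r1 r2 wr1 wr2.
apply: filterS2; first exact: (ae_filter_ringOfSetsType mu).
by move=> x; exact: complex_ext.
Qed.

Lemma wderivP f : W12 f -> L2 (wderiv f) /\ weak_derivative f (wderiv f).
Proof.
move=> [_ [g g2 fg]].
by have := @xgetPex _ (cst 0) [set f' | L2 f' /\ weak_derivative f f']; apply; exists g.
Qed.

Lemma csmooth_weak_derivative G G' : csmooth G -> (forall x, cderiv G x (G' x)) ->
  weak_derivative G G'.
Proof.
move=> [rG jG] dG; apply/weak_derivativeP; split => phi tphi.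
- rewrite (Rintegral_parts_test rG tphi); congr (- _); apply: eq_Rintegral => x _.
  by rewrite (is_derive_derive1 (dG x).1).
- rewrite (Rintegral_parts_test jG tphi); congr (- _); apply: eq_Rintegral => x _.
  by rewrite (is_derive_derive1 (dG x).2).
Qed.

(** The pairing is bilinear, so four real integrations by parts, one for each choice of real or
    imaginary parts, recombine into the complex identity. *)
Lemma weak_derivative_cparts (u V : R -> R[i]) G G' : L2 u -> L2 V ->
  weak_derivative u V -> csmooth G -> (forall x, cderiv G x (G' x)) ->
  L2 G -> L2 G' ->
  cintegral (fun x => u x * G' x) = - cintegral (fun x => V x * G x).
Proof.
move=> u2 V2 /weak_derivativeP[wr wj] [sr sj] dG G2 G'2.
have [ru ju] := L2_square_integrable u2; have [rV jV] := L2_square_integrable V2.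
have [rG jG] := L2_square_integrable G2; have [rG' jG'] := L2_square_integrable G'2.
have dr : derive1 (fun x => Re (G x)) = (fun x => Re (G' x)).
  by apply/funext => x; rewrite (is_derive_derive1 (dG x).1).
have dj : derive1 (fun x => Im (G x)) = (fun x => Im (G' x)).
  by apply/funext => x; rewrite (is_derive_derive1 (dG x).2).
have rr := weak_derivative_parts ru rV wr sr rG; rewrite dr in rr.
have rj := weak_derivative_parts ru rV wr sj jG; rewrite dj in rj.
have jr := weak_derivative_parts ju jV wj sr rG; rewrite dr in jr.
have jj := weak_derivative_parts ju jV wj sj jG; rewrite dj in jj.
have I2 := square_integrableM.
apply: complex_ext; rewrite ?Re_opp ?Im_opp /=.
- under eq_Rintegral do rewrite Re_mul.
  under [in RHS]eq_Rintegral do rewrite Re_mul.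
  rewrite RintegralB//; [|exact: I2..].
  rewrite RintegralB//; [|exact: I2..].
  by rewrite rr// jj//; ring.
- under eq_Rintegral do rewrite Im_mul.
  under [in RHS]eq_Rintegral do rewrite Im_mul.
  rewrite RintegralD//; [|exact: I2..].
  rewrite RintegralD//; [|exact: I2..].
  by rewrite rj// jr//; ring.
Qed.

End ComplexCalculus.

(** * Gaussians *)

Section Gaussians.
Context {R : realType}.
Local Notation mu := (@lebesgue_measure R).
Local Notation normc := (@ComplexField.Normc.normc R).
Local Notation Re := (@complex.Re R).
Implicit Types (a w C z : R[i]) (x t e m : R).

Lemma integral_gauss_shift e : 0 < e -> exists2 I : R, 0 < I & forall m,
  mu.-integrable [set: R] (EFin \o (fun x => expR (- e * (x - m) ^+ 2))) /\
  \int[mu]_x expR (- e * (x - m) ^+ 2) = I.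
Proof.
(* The normal density of variance [1 / (2 e)] has exponent [- e (x - m)^2]. Only positivity of the
   mass and its independence of [m] are kept. *)
move=> e0; pose s := Num.sqrt (2 * e)^-1.
have s0 : s != 0 by rewrite gt_eqF// sqrtr_gt0 invr_gt0 mulr_gt0.
have s2 : s ^+ 2 = (2 * e)^-1 by rewrite sqr_sqrtr// invr_ge0 mulr_ge0// ltW.
have peak0 := normal_peak_gt0 s0.
have pdfE m : normal_pdf m s = (fun x => normal_peak s * expR (- e * (x - m) ^+ 2)).
  rewrite normal_pdfE//; apply/funext => x; rewrite /normal_fun; congr (_ * expR _).
  by rewrite s2; field; rewrite gt_eqF.
exists (normal_peak s)^-1; first by rewrite invr_gt0.
move=> m; have im : mu.-integrable [set: R] (EFin \o (fun x => expR (- e * (x - m) ^+ 2))).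
  have := integrableZl measurableT (normal_peak s)^-1 (integrable_normal_pdf m s).
  rewrite pdfE (_ : (fun x => _) = (EFin \o (fun x => expR (- e * (x - m) ^+ 2))))//.
  by apply/funext => x /=; rewrite -EFinM mulKf// gt_eqF.
split=> //; apply: (@mulfI _ (normal_peak s)); first by rewrite gt_eqF.
rewrite -RintegralZl// mulfV ?gt_eqF//.
have := integral_normal_pdf m s; rewrite pdfE => /(congr1 fine) /= <-.
by [].
Qed.

Definition gq a w C (x : R) : R[i] := cexp (- (a / 2) * x%:C%C ^+ 2 + w * x%:C%C + C).

Lemma csmooth_gq a w C : csmooth (gq a w C).
Proof.
apply: csmooth_cexp; apply: csmoothD; last exact: csmooth_cst.
apply: csmoothD.
  apply: csmoothM; first exact: csmooth_cst.
  by under eq_fun do rewrite expr2; apply: csmoothM; exact: csmooth_real.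
by apply: csmoothM; [exact: csmooth_cst|exact: csmooth_real].
Qed.

Lemma cderiv_gq a w C x : cderiv (gq a w C) x ((- a * x%:C%C + w) * gq a w C x).
Proof.
apply: cderiv_cexp; apply: cderiv_eq.
  apply: cderivD; last exact: cderiv_cst.
  apply: cderivD; last exact: cderivZ (cderiv_real x).
  apply: cderivZ; under eq_fun do rewrite expr2.
  exact: cderivM (cderiv_real x) (cderiv_real x).
by field.
Qed.

Lemma gq_conj a w C x : ((gq a w C x)^*)%C = gq (a^*)%C (w^*)%C (C^*)%C x.
Proof.
rewrite /gq -cexp_conj; congr cexp.
rewrite !rmorphD !rmorphM rmorphN rmorphM fmorphV rmorph_nat.
by rewrite -[in RHS](conjc_real x) expr2.
Qed.

Lemma normc_gq a w C x :
  normc (gq a w C x) = expR (- (Re a / 2) * x ^+ 2 + Re w * x + Re C).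
Proof.
rewrite normc_cexp; congr expR.
rewrite !Re_add (Re_mul w) /= mulr0 subr0; congr (_ + _ + _).
have -> : - (a / 2) * x%:C%C ^+ 2 = (- a) * ((x ^+ 2 / 2)%:C%C).
  rewrite rmorphM rmorphXn/= fmorphV/= rmorph_nat; ring.
by rewrite Re_mul Re_opp/= mulr0 subr0; ring.
Qed.

Lemma sqr_normc_gq a w C x : 0 < Re a -> normc (gq a w C x) ^+ 2 =
  expR (2 * Re C + Re w ^+ 2 / Re a) * expR (- Re a * (x - Re w / Re a) ^+ 2).
Proof.
move=> a0; rewrite normc_gq expr2 -!expRD; congr expR; field.
by rewrite gt_eqF.
Qed.

(** The decay rate [e] is shared out: [e / 4] absorbs the polynomial, [e / 4] absorbs the linear
    term by completing a square, and [e / 2] remains for integrability. *)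
Lemma sqr_growth_gauss_le e B x : 0 < e ->
  (1 + x ^+ 2) ^+ 2 * expR (- e * x ^+ 2 + B * x) <=
  (1 + 8 / e) ^+ 2 * expR (B ^+ 2 / e) * expR (- (e / 2) * (x - 0) ^+ 2).
Proof.
move=> e0; have e8 : 0 < 8 / e by rewrite divr_gt0.
have h1 : 1 + x ^+ 2 <= (1 + 8 / e) * expR (e / 8 * x ^+ 2).
  have h := expR_ge1Dx (e / 8 * x ^+ 2).
  apply: le_trans (ler_wpM2l _ h); last by rewrite addr_ge0// ltW.
  have -> : (1 + 8 / e) * (1 + e / 8 * x ^+ 2) = 1 + x ^+ 2 + 8 / e + e / 8 * x ^+ 2.
    by field; rewrite gt_eqF.
  have h3 : 0 <= e / 8 * x ^+ 2 by rewrite mulr_ge0 ?sqr_ge0// divr_ge0 ?ltW.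
  by have := ltW e8; move: h3; set u := e / 8 * _; set v := 8 / e; lra.
have h2 : (1 + x ^+ 2) ^+ 2 <= (1 + 8 / e) ^+ 2 * expR (e / 4 * x ^+ 2).
  have -> : expR (e / 4 * x ^+ 2) = expR (e / 8 * x ^+ 2) ^+ 2.
    by rewrite (expr2 (expR _)) -expRD; congr expR; field.
  by rewrite -exprMn ler_pXn2r// nnegrE ?addr_ge0 ?sqr_ge0// ?mulr_ge0 ?expR_ge0 ?addr_ge0// ltW.
apply: (le_trans (ler_wpM2r (expR_ge0 _) h2)).
have : 0 <= (1 + 8 / e) ^+ 2 by rewrite sqr_ge0.
move: (_ ^+ 2) => Q Q0; rewrite -!(mulrA Q) ler_wpM2l// -!expRD ler_expR subr0.
rewrite -subr_ge0.
have -> : B ^+ 2 / e + - (e / 2) * x ^+ 2 - (e / 4 * x ^+ 2 + (- e * x ^+ 2 + B * x)) =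
  (B - e / 2 * x) ^+ 2 / e by field; rewrite gt_eqF.
by rewrite divr_ge0 ?sqr_ge0 ?ltW.
Qed.

Lemma L2_gauss_dominated (f : R -> R[i]) e B K : 0 < e -> cmeasurable f ->
  (forall x, normc (f x) ^+ 2 <= K * ((1 + x ^+ 2) ^+ 2 * expR (- e * x ^+ 2 + B * x))) ->
  0 <= K -> L2 f.
Proof.
move=> e0 mf fK K0; have e20 : 0 < e / 2 by rewrite divr_gt0.
have [I I0 /(_ 0)[iG _]] := integral_gauss_shift e20.
have := integrableZl measurableT (K * ((1 + 8 / e) ^+ 2 * expR (B ^+ 2 / e))) iG.
move=> iG'; apply: (L2_bounded mf iG') => x; apply: (le_trans (fK x)).
rewrite /= -(mulrA K) ler_wpM2l//; exact: sqr_growth_gauss_le.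
Qed.

Lemma L2_poly_gq (p : R -> R[i]) (M : R) a w C : 0 < Re a -> cmeasurable p ->
  (forall x, normc (p x) <= M * (1 + x ^+ 2)) -> L2 (fun x => p x * gq a w C x).
Proof.
move=> a0 mp pM; have mgq := csmooth_cmeasurable (csmooth_gq a w C).
apply: (@L2_gauss_dominated _ (Re a) (2 * Re w) (M ^+ 2 * expR (2 * Re C))) => //.
- exact: cmeasurableM.
- move=> x; have M0 : 0 <= M * (1 + x ^+ 2) by exact: le_trans (normc_ge0 _) (pM x).
  rewrite normcM exprMn.
  have -> : M ^+ 2 * expR (2 * Re C) *
     ((1 + x ^+ 2) ^+ 2 * expR (- Re a * x ^+ 2 + 2 * Re w * x)) =
     (M * (1 + x ^+ 2)) ^+ 2 * (expR (2 * Re C) * expR (- Re a * x ^+ 2 + 2 * Re w * x)).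
    ring.
  rewrite -expRD normc_gq [expR _ ^+ 2]expr2 -expRD.
  apply: ler_pM; rewrite ?sqr_ge0 ?expR_ge0 ?exprn_ge0 ?normc_ge0//.
    by rewrite ler_pXn2r// nnegrE normc_ge0.
  by rewrite ler_expR le_eqVlt; apply/orP; left; apply/eqP; field.
- by rewrite mulr_ge0 ?sqr_ge0 ?expR_ge0.
Qed.

End Gaussians.

(** * The form of the oscillator tested on Gaussians *)

Section Pairing.
Context {R : realType}.
Local Notation mu := (@lebesgue_measure R).
Local Notation normc := (@ComplexField.Normc.normc R).
Local Notation Re := (@complex.Re R).
Implicit Types (a w C z c : R[i]) (x t e m : R) (u k : R -> R[i]).

Definition quad (p2 p1 p0 : R[i]) (x : R) : R[i] :=
  p2 * x%:C%C ^+ 2 + p1 * x%:C%C + p0.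

Lemma csmooth_quad (p2 p1 p0 : R[i]) : csmooth (quad p2 p1 p0).
Proof.
apply: csmoothD; last exact: csmooth_cst.
apply: csmoothD; last by apply: csmoothM; [exact: csmooth_cst|exact: csmooth_real].
apply: csmoothM; first exact: csmooth_cst.
by under eq_fun do rewrite expr2; apply: csmoothM; exact: csmooth_real.
Qed.

Lemma cderiv_quad (p2 p1 p0 : R[i]) x :
  cderiv (quad p2 p1 p0) x (2 * p2 * x%:C%C + p1).
Proof.
apply: cderiv_eq.
  apply: cderivD; last exact: cderiv_cst.
  apply: cderivD; last exact: cderivZ (cderiv_real x).
  apply: cderivZ; under eq_fun do rewrite expr2.
  exact: cderivM (cderiv_real x) (cderiv_real x).
by ring.
Qed.

Lemma normc_quad_le (p2 p1 p0 : R[i]) x :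
  normc (quad p2 p1 p0 x) <= (normc p2 + normc p1 + normc p0) * (1 + x ^+ 2).
Proof.
apply: (le_trans (ler_normcD _ _)); apply: (le_trans (lerD (ler_normcD _ _) (lexx _))).
rewrite !normcM !normc_real -expr2 real_normK ?num_real//.
have n2 := normc_ge0 p2; have n1 := normc_ge0 p1; have n0 := normc_ge0 p0.
have x2 := sqr_ge0 x; have xx : `|x| <= 1 + x ^+ 2.
  by have := real_normK (num_real x); have := sqr_ge0 (`|x| - 1); have := normr_ge0 x; nra.
by have := ler_wpM2l n1 xx; nra.
Qed.

Lemma L2_quad_gq (p2 p1 p0 : R[i]) a w C : 0 < Re a ->
  L2 (fun x => quad p2 p1 p0 x * gq a w C x).
Proof.
move=> a0; apply: L2_poly_gq => //; last exact: normc_quad_le.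
exact/csmooth_cmeasurable/csmooth_quad.
Qed.

Lemma L2_gq a w C : 0 < Re a -> L2 (gq a w C).
Proof.
move=> a0; have := L2_quad_gq 0 0 1 w C a0.
rewrite (_ : (fun x => _) = gq a w C)//.
by apply/funext => x; rewrite /quad; ring.
Qed.

Lemma weak_derivative_gq a w C :
  weak_derivative (gq a w C) (fun x => quad 0 (- a) w x * gq a w C x).
Proof.
apply: csmooth_weak_derivative; first exact: csmooth_gq.
move=> x; apply: cderiv_eq; first exact: cderiv_gq.
by rewrite /quad; ring.
Qed.

Lemma osc_domain_gq a w C : 0 < Re a -> osc_domain (gq a w C).
Proof.
move=> a0; split.
  split; first exact: L2_gq.
  exists (fun x => quad 0 (- a) w x * gq a w C x); first exact: L2_quad_gq.
  exact: weak_derivative_gq.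
have := L2_sqr_integrable (L2_quad_gq 0 1 0 w C a0).
move=> /integrableP[_]; apply: le_lt_trans; rewrite le_eqVlt; apply/orP; left.
apply/eqP; apply: eq_integral => x _.
transitivity ((normc (quad 0 1 0 x * gq a w C x) ^+ 2)%:E); last first.
  by rewrite gee0_abs// lee_fin sqr_ge0.
congr EFin; rewrite normcM exprMn /quad mul0r add0r mul1r addr0 normc_real.
by rewrite real_normK// num_real.
Qed.

Lemma ae_wderiv_gq a w C : 0 < Re a ->
  {ae mu, forall x, wderiv (gq a w C) x = quad 0 (- a) w x * gq a w C x}.
Proof.
move=> a0; have [W _] := osc_domain_gq w C a0; have [W2 wd] := wderivP W.
apply: weak_derivative_uniq W2 _ wd _; first exact: L2_quad_gq.
exact: weak_derivative_gq.
Qed.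

Lemma conj_quad (p2 p1 p0 : R[i]) x :
  ((quad p2 p1 p0 x)^*)%C = quad (p2^*)%C (p1^*)%C (p0^*)%C x.
Proof.
rewrite /quad !rmorphD !rmorphM.
by rewrite -[in RHS](conjc_real x) expr2.
Qed.

(* [- F'' + a^2 x^2 F - z F] is [quad 0 (2 a w) (a - w^2 - z) * F] for the Gaussian
   [F := gq a w C]; the form is tested against the conjugate of [F]. *)
Lemma resolvent_pairing a z w C u k : 0 < Re a -> L2 k ->
  shift_operator (harmonic_oscillator (a ^+ 2)) z (u, k) ->
  cintegral (fun x => u x * (quad 0 (2 * a * w) (a - w ^+ 2 - z) x * gq a w C x)) =
  cintegral (fun x => k x * gq a w C x).
Proof.
move=> a0 k2 [h [/= [[u2 [V0 V02 wV0]] _] h2 form] kE].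
have ca0 : 0 < Re (a^*)%C by case: (a) a0.
have Wu : W12 u by split=> //; exists V0.
have [V2 wV] := wderivP Wu.
pose G := gq a w C.
have GE x : ((gq (a^*)%C (w^*)%C (C^*)%C x)^*)%C = G x by rewrite gq_conj !conjcK.
have := form _ (osc_domain_gq (w^*)%C (C^*)%C ca0).
have [Wg _] := osc_domain_gq (w^*)%C (C^*)%C ca0; have [W2 _] := wderivP Wg.
pose F1 x := quad 0 (- a) w x * G x.
have F12 : L2 F1 by exact: L2_quad_gq.
pose F2 x := quad (a ^+ 2) (- (2 * a * w)) (w ^+ 2 - a) x * G x.
have F22 : L2 F2 by exact: L2_quad_gq.
have dF1 x : cderiv F1 x (F2 x).
  apply: cderiv_eq (cderivM (cderiv_quad 0 (- a) w x) (cderiv_gq a w C x)) _.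
  by rewrite /F2 /G /quad; ring.
have sF1 : csmooth F1 by apply: csmoothM; [exact: csmooth_quad|exact: csmooth_gq].
have G2 : L2 G by exact: L2_gq.
pose X2 x := quad 1 0 0 x * G x.
have X22 : L2 X2 by exact: L2_quad_gq.
rewrite /osc_form /L2inner.
(* [wderiv] picks an arbitrary representative, so it agrees with the classical derivative of the
   Gaussian only almost everywhere. *)
have -> : cintegral (fun x => wderiv u x * (wderiv (gq (a^*)%C (w^*)%C (C^*)%C) x)^*%C) =
    cintegral (fun x => wderiv u x * F1 x).
  apply: ae_eq_cintegral.
  - by apply: cmeasurableM; [exact: L2_cmeasurable|apply: cmeasurable_conj; exact: L2_cmeasurable].
  - by apply: cmeasurableM; exact: L2_cmeasurable.
  - have := ae_wderiv_gq (w^*)%C (C^*)%C ca0.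
    apply: filterS; first exact: (ae_filter_ringOfSetsType mu).
    have conjM (p q : R[i]) : ((p * q)^*)%C = (p^*)%C * (q^*)%C by exact: rmorphM.
    move=> x ->; rewrite conjM conj_quad GE /F1; congr (_ * (quad _ _ _ x * _)).
    + by rewrite rmorph0.
    + by rewrite rmorphN; congr (- _); exact: conjcK.
    + by rewrite conjcK.
(* The remaining derivative is moved from [u] onto [F1], the derivative of [G]; thus [u] needs no
   second derivative. *)
have := weak_derivative_cparts u2 V2 wV sF1 dF1 F12 F22.
move=> /eqP; rewrite eq_sym eqr_oppLR => /eqP ->.
have -> : (fun x => (x ^+ 2)%:C%C * u x * (gq (a^*)%C (w^*)%C (C^*)%C x)^*%C) =
    (fun x => u x * X2 x).
  by apply/funext => x; rewrite GE /X2 /quad rmorphXn/=; ring.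
have hE : (fun x => h x * (gq (a^*)%C (w^*)%C (C^*)%C x)^*%C) =
    (fun x => k x * G x + z * (u x * G x)).
  by apply/funext => x; rewrite GE kE; ring.
rewrite hE cintegralD ?cintegralZl//; last 3 first.
- exact: L2M.
- exact: L2M.
- by apply: cintegrableZl; exact: L2M.
move=> eqn.
have -> : (fun x => u x * (quad 0 (2 * a * w) (a - w ^+ 2 - z) x * gq a w C x)) =
   (fun x => (a ^+ 2 * (u x * X2 x) - u x * F2 x) - z * (u x * G x)).
  by apply/funext => x; rewrite /X2 /F2 /quad; rewrite -/G; ring.
have iX := L2M u2 X22; have iF := L2M u2 F22; have iG := L2M u2 G2.
have iX' := cintegrableZl (a ^+ 2) iX.
rewrite cintegralB; [|exact: cintegrableB|exact: cintegrableZl].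
rewrite cintegralB// !cintegralZl//.
by apply/eqP; rewrite subr_eq -eqn addrC.
Qed.

End Pairing.

(** * Differentiating pairings with respect to the parameters of a Gaussian *)

Section Differentiation.
Context {R : realType}.
Local Notation mu := (@lebesgue_measure R).
Local Notation normc := (@ComplexField.Normc.normc R).
Local Notation Re := (@complex.Re R).
Local Notation Im := (@complex.Im R).
Implicit Types (a : R[i]) (w C : R -> R[i]) (x t s B : R) (u : R -> R[i]).

Lemma is_derive_Rintegral (f df : R -> R -> R) (G : R -> R) (lo hi t : R) :
  lo < t < hi ->
  (forall s, lo < s < hi -> mu.-integrable [set: R] (EFin \o f s)) ->
  (forall s x, lo < s < hi -> is_derive s 1 (f ^~ x) (df s x)) ->
  mu.-integrable [set: R] (EFin \o G) ->
  (forall s x, lo < s < hi -> `|df s x| <= G x) ->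
  is_derive t 1 (fun s => \int[mu]_x f s x) (\int[mu]_x df t x).
Proof.
move=> th fi fd iG dfG.
have dfE s x : lo < s < hi -> partial1of2 f s x = df s x.
  by move=> sI; rewrite /partial1of2 (is_derive_derive1 (fd s x sI)).
have It : (`]lo, hi[%classic : set R) t by rewrite /= in_itv.
have G0 x : 0 <= G x by exact: le_trans (dfG t x th).
have h1 s : (`]lo, hi[%classic : set R) s -> mu.-integrable [set: R] (EFin \o f s).
  by rewrite /= in_itv/= => /fi.
have h2 s x : (`]lo, hi[%classic : set R) s -> [set: R] x -> derivable (f ^~ x) s 1.
  by rewrite /= in_itv/= => sI _; exact: is_derive_derivable (fd s x sI).
have h3 s x : (`]lo, hi[%classic : set R) s -> [set: R] x -> `|partial1of2 f s x| <= G x.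
  by rewrite /= in_itv/= => sI _; rewrite dfE//; exact: dfG.
have D := derivable_under_integral measurableT It h1 h2 G0 iG h3.
have E := differentiation_under_integral measurableT It h1 h2 G0 iG h3.
apply: DeriveDef; first exact: D.
rewrite -derive1E E; apply: eq_Rintegral => x _; exact: dfE.
Qed.

Lemma cderiv_cintegral (f df : R -> R -> R[i]) (G : R -> R) (lo hi t : R) :
  lo < t < hi ->
  (forall s, lo < s < hi -> cintegrable (f s)) ->
  (forall s x, lo < s < hi -> cderiv (f ^~ x) s (df s x)) ->
  mu.-integrable [set: R] (EFin \o G) ->
  (forall s x, lo < s < hi -> normc (df s x) <= G x) ->
  cderiv (fun s => cintegral (f s)) t (cintegral (df t)).
Proof.
move=> th fi fd iG dfG; split.
- apply: (@is_derive_Rintegral (fun s x => Re (f s x)) (fun s x => Re (df s x)) G lo hi) => //.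
  + by move=> s sI; exact: (fi s sI).1.
  + by move=> s x sI; exact: (fd s x sI).1.
  + by move=> s x sI; exact: le_trans (normc_Re _) (dfG s x sI).
- apply: (@is_derive_Rintegral (fun s x => Im (f s x)) (fun s x => Im (df s x)) G lo hi) => //.
  + by move=> s sI; exact: (fi s sI).2.
  + by move=> s x sI; exact: (fd s x sI).2.
  + by move=> s x sI; exact: le_trans (normc_Im _) (dfG s x sI).
Qed.

(** Since [Re w0 * x <= B |x|], the slope [B] serves for [x >= 0] and [- B] for [x < 0]; the sum of
    the two Gaussians dominates on the whole line, independently of the parameters. *)
Lemma normc_gq_le a (w0 C0 : R[i]) B x : normc w0 <= B -> normc C0 <= B ->
  normc (gq a w0 C0 x) <=
  expR B * (normc (gq a B%:C%C 0 x) + normc (gq a (- B)%:C%C 0 x)).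
Proof.
move=> wB CB; rewrite !normc_gq/= mulrDr -!expRD.
have rw := le_trans (normc_Re w0) wB; have rC := le_trans (normc_Re C0) CB.
have {}rC : Re C0 <= B by exact: le_trans (ler_norm _) rC.
have [x0|x0] := leP 0 x.
- apply: (@le_trans _ _ (expR (B + (- (Re a / 2) * x ^+ 2 + B * x + 0)))).
    rewrite ler_expR; have : Re w0 <= B by exact: le_trans (ler_norm _) rw.
    move=> /(ler_wpM2r x0); lra.
  by rewrite lerDl expR_ge0.
- apply: (@le_trans _ _ (expR (B + (- (Re a / 2) * x ^+ 2 + - B * x + 0)))).
    rewrite ler_expR; have : - B <= Re w0 by rewrite lerNl; apply: le_trans rw; rewrite -normrN ler_norm.
    move=> /(ler_wnM2r (ltW x0)); lra.
  by rewrite lerDr expR_ge0.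
Qed.

Lemma cderiv_pairing a w C (w' C' : R -> R[i]) (lo hi B t : R) u : 0 < Re a -> L2 u -> lo < t < hi ->
  (forall s, lo < s < hi -> cderiv w s (w' s) /\ cderiv C s (C' s)) ->
  (forall s, lo < s < hi ->
     [/\ normc (w s) <= B, normc (C s) <= B, normc (w' s) <= B & normc (C' s) <= B]) ->
  cderiv (fun s => cintegral (fun x => u x * gq a (w s) (C s) x)) t
    (cintegral (fun x => u x * (quad 0 (w' t) (C' t) x * gq a (w t) (C t) x))).
Proof.
move=> a0 u2 th dwC bd.
have B0 : 0 <= B by have [+ _ _ _] := bd t th; apply: le_trans (normc_ge0 _).
pose G1 x := normc (u x * (quad 1 0 1 x * gq a B%:C%C 0 x)).
pose G2 x := normc (u x * (quad 1 0 1 x * gq a (- B)%:C%C 0 x)).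
(* The factor [2 * B] bounds the polynomial [w' x + C'] against [1 + x^2], and [expR B] comes from
   [normc_gq_le]. *)
pose K := 2 * B * expR B.
apply: (@cderiv_cintegral (fun s x => u x * gq a (w s) (C s) x)
  (fun s x => u x * (quad 0 (w' s) (C' s) x * gq a (w s) (C s) x))
  (fun x => K * (G1 x + G2 x)) lo hi) => //.
- by move=> s sI; apply: L2M => //; exact: L2_gq.
- move=> s x sI; have [dw dC] := dwC s sI; apply: cderivZ.
  have h : cderiv (fun s => - (a / 2) * x%:C%C ^+ 2 + w s * x%:C%C + C s) s
      (0 + (w' s * x%:C%C + w s * 0) + C' s).
    apply: cderivD dC; apply: cderivD; first exact: cderiv_cst.
    by apply: cderivM => //; exact: cderiv_cst.
  by apply: cderiv_eq (cderiv_cexp h) _; rewrite /quad /gq; ring.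
- have i1 := cintegrable_normc (L2M u2 (L2_quad_gq 1 0 1 B%:C%C 0 a0)).
  have i2 := cintegrable_normc (L2M u2 (L2_quad_gq 1 0 1 (- B)%:C%C 0 a0)).
  exact: (integrableZl measurableT K (integrableD measurableT i1 i2)).
- move=> s x sI; have [wB CB w'B C'B] := bd s sI.
  have q1 : normc (quad 1 0 1 x) = 1 + x ^+ 2.
    rewrite (_ : quad 1 0 1 x = (1 + x ^+ 2)%:C%C); last first.
      by rewrite /quad rmorphD rmorphXn/= rmorph1; ring.
    by rewrite normc_real ger0_norm// addr_ge0// sqr_ge0.
  rewrite /G1 /G2 !normcM q1 -!mulrDr.
  have -> : K * (normc (u x) * ((1 + x ^+ 2) *
      (normc (gq a B%:C%C 0 x) + normc (gq a (- B)%:C%C 0 x)))) =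
    normc (u x) * ((2 * B * (1 + x ^+ 2)) * (expR B *
      (normc (gq a B%:C%C 0 x) + normc (gq a (- B)%:C%C 0 x)))) by rewrite /K; ring.
  rewrite ler_wpM2l ?normc_ge0//; apply: ler_pM; rewrite ?normc_ge0//; last exact: normc_gq_le.
  rewrite /quad mul0r add0r; apply: (le_trans (ler_normcD _ _)).
  rewrite normcM normc_real.
  have xx : `|x| <= 1 + x ^+ 2.
    by have := real_normK (num_real x); have := sqr_ge0 (`|x| - 1); have := normr_ge0 x; nra.
  have := ler_pM (normc_ge0 (w' s)) (normr_ge0 x) w'B xx; have := sqr_ge0 x; nra.
Qed.

Lemma cderiv_eq0_cst (f : R -> R[i]) (s t : R) : (forall x, s <= x <= t -> cderiv f x 0) ->
  s <= t -> f s = f t.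
Proof.
move=> f0; rewrite le_eqVlt => /predU1P[->//|st].
have key (h : R -> R) : (forall x, s <= x <= t -> is_derive x 1 h 0) -> h s = h t.
  move=> dh.
  have h1 x : x \in `]s, t[ -> is_derive x 1 h (cst 0 x).
    by rewrite in_itv/= => /andP[sx xt]; apply: dh; rewrite !ltW.
  have [|c _] := MVT st h1; last by rewrite mul0r => /eqP; rewrite subr_eq0 => /eqP.
  apply: derivable_within_continuous => x; rewrite in_itv/= => /dh.
  exact: is_derive_derivable.
apply: complex_ext.
- by apply: (key (fun x => Re (f x))) => x /f0[].
- by apply: (key (fun x => Im (f x))) => x /f0[].
Qed.

End Differentiation.

(** * The integral of a Gaussian with complex slope *)

Section Potential.
Context {R : realType}.
Local Notation mu := (@lebesgue_measure R).
Local Notation normc := (@ComplexField.Normc.normc R).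
Local Notation Re := (@complex.Re R).
Implicit Types (a w C z th d : R[i]) (x t s : R) (u k : R -> R[i]).

Lemma gqM a1 a2 w1 w2 C1 C2 x : gq a1 w1 C1 x * gq a2 w2 C2 x =
  gq (a1 + a2) (w1 + w2) (C1 + C2) x :> R[i].
Proof. by rewrite /gq -cexpD; congr cexp; field. Qed.

Lemma gq_real (e : R) x : gq (2 * e)%:C%C 0 0 x = (expR (- e * (x - 0) ^+ 2))%:C%C.
Proof.
rewrite -cexp_real /gq subr0; congr cexp.
by rewrite !rmorphM rmorphN /= rmorph_nat; field.
Qed.

(* Both sides, with [w] replaced by [s w], solve the same linear equation in [s];
   the left one does by integration by parts. *)
Lemma cintegral_gq0 (e : R) w : 0 < e ->
  cintegral (gq (2 * e)%:C%C w 0) =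
  (\int[mu]_x expR (- e * (x - 0) ^+ 2))%:C%C * cexp (w ^+ 2 / (4 * e)%:C%C).
Proof.
move=> e0; have e0' : 0 < Re e%:C%C by [].
have ec0 : e%:C%C != 0 :> R[i] by rewrite -normc_eq0 normc_real normr_eq0 gt_eqF.
have e2 : e%:C%C + e%:C%C = (2 * e)%:C%C :> R[i].
  by rewrite -rmorphD/=; congr (real_complex _ _); ring.
(* The Gaussian is split into two square integrable halves, a fixed [u] and a moving [G s], so that
   the results on pairings apply. *)
pose u := gq e%:C%C 0 0; have u2 : L2 u by exact: L2_gq.
pose G s := gq e%:C%C (s%:C%C * w) 0.
have uG s x : u x * G s x = gq (2 * e)%:C%C (s%:C%C * w) 0 x.
  by rewrite /u /G gqM e2 !add0r.
have parts s : cintegral (fun x => u x * (quad 0 w 0 x * G s x)) =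
    s%:C%C * w ^+ 2 / (2 * e)%:C%C * cintegral (fun x => u x * G s x).
  have G2 : L2 (G s) by exact: L2_gq.
  have dG x : cderiv (G s) x (quad 0 (- e%:C%C) (s%:C%C * w) x * G s x).
    by apply: cderiv_eq (cderiv_gq _ _ _ _) _; rewrite /quad /G; ring.
  have := weak_derivative_cparts u2 (L2_quad_gq 0 (- e%:C%C) 0 0 0 e0')
    (weak_derivative_gq _ _ _) (csmooth_gq e%:C%C (s%:C%C * w) 0) dG G2
    (L2_quad_gq _ _ _ _ _ e0').
  have ix : cintegrable (fun x => u x * (quad 0 1 0 x * G s x)).
    by apply: L2M => //; exact: L2_quad_gq.
  have iG : cintegrable (fun x => u x * G s x) by exact: L2M.
  rewrite (_ : (fun x => u x * (quad 0 (- e%:C%C) (s%:C%C * w) x * G s x)) =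
    (fun x => - e%:C%C * (u x * (quad 0 1 0 x * G s x)) + s%:C%C * w * (u x * G s x)));
    last by apply/funext => x; rewrite /quad; ring.
  rewrite (_ : (fun x => quad 0 (- e%:C%C) 0 x * gq e%:C%C 0 0 x * gq e%:C%C (s%:C%C * w) 0 x) =
    (fun x => - e%:C%C * (u x * (quad 0 1 0 x * G s x))));
    last by apply/funext => x; rewrite /quad /u /G; ring.
  rewrite cintegralD ?cintegralZl//; [|exact: cintegrableZl|exact: cintegrableZl].
  rewrite (_ : (fun x => u x * (quad 0 w 0 x * G s x)) =
    (fun x => w * (u x * (quad 0 1 0 x * G s x)))); last first.
    by apply/funext => x; rewrite /quad; ring.
  rewrite cintegralZl//.
  move: (cintegral _) (cintegral _) => X Y /eqP; rewrite mulNr opprK addrC.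
  rewrite subr_eq => /eqP E; rewrite rmorphM/= rmorph_nat.
  have -> : s%:C%C * w ^+ 2 / (2 * e%:C%C) * X = w * (s%:C%C * w * X) / (2 * e%:C%C).
    by rewrite expr2; ring.
  by rewrite E; field.
(* The reciprocal exponential is an integrating factor: instead of uniqueness for the equation, only
   constancy of [J] on [[0, 1]] is needed. *)
pose J s := cintegral (fun x => u x * G s x) * cexp (- (s%:C%C ^+ 2 * (w ^+ 2 / (4 * e)%:C%C))).
have dJ s : 0 <= s <= 1 -> cderiv J s 0.
  move=> s01.
  have h1 : cderiv (fun s => cintegral (fun x => u x * G s x)) s
      (cintegral (fun x => u x * (quad 0 w 0 x * G s x))).
    (* The open interval []-1, 2[] leaves room around [[0, 1]], so that the derivatives at the end
       points are two-sided. *)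
    apply: (@cderiv_pairing _ e%:C%C (fun s => s%:C%C * w) (fun=> 0)
      (fun=> w) (fun=> 0) (-1) 2 (2 * normc w)) => //.
    - by apply/andP; split; lra.
    - move=> r _; split; last exact: cderiv_cst.
      apply: cderiv_eq (cderivM (cderiv_real r) (cderiv_cst w r)) _.
      by rewrite mul1r mulr0 addr0.
    - move=> r r12; rewrite normcM normc_real ComplexField.Normc.normc0.
      have w0 := normc_ge0 w; split=> //; last 3 first.
      + by rewrite mulr_ge0.
      + by rewrite ler_peMl//; lra.
      + by rewrite mulr_ge0.
      + rewrite ler_wpM2r// ler_norml; lra.
  have h2 : cderiv (fun s => cexp (- (s%:C%C ^+ 2 * (w ^+ 2 / (4 * e)%:C%C)))) s
      (- (s%:C%C * w ^+ 2 / (2 * e)%:C%C) * cexp (- (s%:C%C ^+ 2 * (w ^+ 2 / (4 * e)%:C%C)))).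
    apply: cderiv_cexp; under eq_fun do rewrite -mulN1r expr2.
    have h := cderivZ (-1) (cderivM (cderivM (cderiv_real s) (cderiv_real s))
      (cderiv_cst (w ^+ 2 / (4 * e)%:C%C) s)).
    apply: cderiv_eq h _; rewrite !rmorphM/= !rmorph_nat; field.
    exact: ec0.
  apply: cderiv_eq (cderivM h1 h2) _; rewrite parts; ring.
have := cderiv_eq0_cst dJ (@ler01 R).
rewrite /J rmorph0 rmorph1 expr0n/= mul0r oppr0 cexp0 mulr1 expr1n mul1r => J01.
have -> : gq (2 * e)%:C%C w 0 = (fun x => u x * G 1 x).
  by apply/funext => x; rewrite uG rmorph1 mul1r.
rewrite -[LHS]mulr1 -(cexpN (w ^+ 2 / (4 * e)%:C%C)) mulrA -J01.
congr (_ * _); have -> : (fun x => u x * G 0 x) = (fun x => (expR (- e * (x - 0) ^+ 2))%:C%C).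
  by apply/funext => x; rewrite uG rmorph0 mul0r gq_real.
rewrite /cintegral/=; congr Complex.
by rewrite /Rintegral integral0.
Qed.

End Potential.

(** * Pairing the resolvent with the evolution of a Gaussian *)

Section ResolventPotential.
Context {R : realType}.
Local Notation mu := (@lebesgue_measure R).
Local Notation normc := (@ComplexField.Normc.normc R).
Local Notation Re := (@complex.Re R).
Implicit Types (a w C z b th d : R[i]) (x t s : R) (u k : R -> R[i]).

Definition gauss_mass (e : R) : R := \int[mu]_x expR (- e * (x - 0) ^+ 2).

Lemma gauss_mass_gt0 (e : R) : 0 < e -> 0 < gauss_mass e.
Proof.
move=> e0; have [I I0 /(_ 0)[_ E]] := integral_gauss_shift e0.
by rewrite /gauss_mass E.
Qed.

Lemma cintegrable_gq (e : R) w C : 0 < e -> cintegrable (gq (2 * e)%:C%C w C).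
Proof.
move=> e0; have ec : 0 < Re e%:C%C by [].
have := L2M (L2_gq w C ec) (L2_gq 0 0 ec).
rewrite (_ : (fun x => _) = gq (2 * e)%:C%C w C)//; apply/funext => x.
have e2 : e%:C%C + e%:C%C = (2 * e)%:C%C :> R[i].
  by rewrite -rmorphD/=; congr (real_complex _ _); ring.
by rewrite gqM !addr0 e2.
Qed.

Lemma L2norm_gq a w C : 0 < Re a -> L2norm (gq a w C) =
  (Num.sqrt (gauss_mass (Re a) * expR (2 * Re C + Re w ^+ 2 / Re a)))%:E.
Proof.
move=> a0; have g2 := L2_gq w C a0.
rewrite L2normE; [|exact: L2_cmeasurable|exact: L2_sqr_integrable].
have [I I0 IE] := integral_gauss_shift a0.
congr (Num.sqrt _)%:E; rewrite /sqnorm /gauss_mass (IE 0).2.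
under eq_Rintegral do rewrite sqr_normc_gq//.
by rewrite RintegralZl//; [rewrite (IE _).2 mulrC|exact: (IE _).1].
Qed.

(* [orbit_gauss a z b th] is, up to a constant, [exp (- tau (H - z))] applied to a
   coherent state, at the complex time [tau = - th / (2 a)]: it satisfies
   [(H - z) F = 2 a (d/dth) F] exactly. *)
Definition orbit_center b th : R[i] := b * cexp th.

Definition orbit_phase a z b th : R[i] :=
  - ((z - a) / (2 * a)) * th - orbit_center b th ^+ 2 / (4 * a).

(* The exponents of [<F_th, F_0> / |F_0|^2] and of [|F_th| / |F_0|], where [F_th] is
   [orbit_gauss a z b th]. *)
Definition overlap_exponent a z b th : R[i] :=
  ((b^*%C + orbit_center b th) ^+ 2 - (b^*%C + b) ^+ 2) / (4 * Re a)%:C%C +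
  (orbit_phase a z b th - orbit_phase a z b 0).

Definition norm_exponent a z b th : R :=
  Re (orbit_phase a z b th - orbit_phase a z b 0) +
  (Re (orbit_center b th) ^+ 2 - Re b ^+ 2) / (2 * Re a).

Definition orbit_gauss a z b th := gq a (orbit_center b th) (orbit_phase a z b th).

Lemma cderiv_line th d t : cderiv (fun t => th + t%:C%C * d) t d.
Proof.
apply: cderiv_eq (cderivD (cderiv_cst th t) (cderivM (cderiv_real t) (cderiv_cst d t))) _.
by rewrite add0r mul1r mulr0 addr0.
Qed.

Lemma cderiv_orbit_center b th d t :
  cderiv (fun t => orbit_center b (th + t%:C%C * d)) t
         (d * orbit_center b (th + t%:C%C * d)).
Proof.
apply: cderiv_eq (cderivZ b (cderiv_cexp (cderiv_line th d t))) _.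
by rewrite /orbit_center; ring.
Qed.

(** Together with the rate [d * w] of the center [w], this rate of the phase makes the derivative of
    the Gaussian equal to [d / (2 a)] times the polynomial factor [2 a w x + a - w^2 - z] of
    [(H - z) F]. *)
Lemma cderiv_orbit_phase a z b th d t : a != 0 ->
  cderiv (fun t => orbit_phase a z b (th + t%:C%C * d)) t
    (- (d / (2 * a)) * (z - a + orbit_center b (th + t%:C%C * d) ^+ 2)).
Proof.
move=> a0; have W := cderiv_orbit_center b th d t.
have h := cderivD (cderivZ (- ((z - a) / (2 * a))) (cderiv_line th d t))
  (cderivZ (- (4 * a)^-1) (cderivM W W)).
rewrite (_ : (fun t => _) = (fun t => - ((z - a) / (2 * a)) * (th + t%:C%C * d) +
   - (4 * a)^-1 * (orbit_center b (th + t%:C%C * d) * orbit_center b (th + t%:C%C * d)))).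
  by apply: (cderiv_eq h); field.
by apply/funext => s; rewrite /orbit_phase expr2; field.
Qed.

(** Supplies the uniform bounds that dominated differentiation of the pairing requires; the size of
    [B] is irrelevant. *)
Lemma orbit_bound a z b th d : exists B, forall s, -1 < s < 2 ->
  [/\ normc (orbit_center b (th + s%:C%C * d)) <= B,
      normc (orbit_phase a z b (th + s%:C%C * d)) <= B,
      normc (d * orbit_center b (th + s%:C%C * d)) <= B &
      normc (- (d / (2 * a)) * (z - a + orbit_center b (th + s%:C%C * d) ^+ 2)) <= B].
Proof.
pose T := normc th + 2 * normc d.
pose W := normc b * expR T.
pose B2 := normc ((z - a) / (2 * a)) * T + W ^+ 2 * normc ((4 * a)^-1).
pose B4 := normc (d / (2 * a)) * (normc (z - a) + W ^+ 2).
have T0 : 0 <= T by rewrite addr_ge0 ?mulr_ge0 ?normc_ge0.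
have W0 : 0 <= W by rewrite mulr_ge0 ?normc_ge0 ?expR_ge0.
have p1 : 0 <= normc d * W by rewrite mulr_ge0 ?normc_ge0.
have p2 : 0 <= B2.
  by apply: addr_ge0; apply: mulr_ge0; rewrite ?normc_ge0 ?sqr_ge0.
have p4 : 0 <= B4 by apply: mulr_ge0; rewrite ?addr_ge0 ?normc_ge0 ?sqr_ge0.
exists (W + B2 + normc d * W + B4) => s s12.
have thT : normc (th + s%:C%C * d) <= T.
  apply: (le_trans (ler_normcD _ _)); rewrite lerD2l normcM normc_real.
  by rewrite ler_wpM2r ?normc_ge0// ler_norml; lra.
have h1 : normc (orbit_center b (th + s%:C%C * d)) <= W.
  rewrite /orbit_center normcM ler_wpM2l ?normc_ge0// normc_cexp ler_expR.
  exact: le_trans (ler_norm _) (le_trans (normc_Re _) thT).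
have h1' : normc (orbit_center b (th + s%:C%C * d) ^+ 2) <= W ^+ 2.
  by rewrite normcX ler_pXn2r// nnegrE normc_ge0.
have h2 : normc (orbit_phase a z b (th + s%:C%C * d)) <= B2.
  apply: (le_trans (ler_normcB _ _)); apply: lerD.
    by rewrite (normcM (- _)) normc_opp ler_wpM2l ?normc_ge0.
  by rewrite (normcM _ (4 * a)^-1) ler_wpM2r ?normc_ge0.
have h3 : normc (d * orbit_center b (th + s%:C%C * d)) <= normc d * W.
  by rewrite normcM ler_wpM2l ?normc_ge0.
have h4 : normc (- (d / (2 * a)) * (z - a + orbit_center b (th + s%:C%C * d) ^+ 2)) <= B4.
  rewrite (normcM _ (_ + _)) normc_opp ler_wpM2l ?normc_ge0//.
  by apply: (le_trans (ler_normcD _ _)); rewrite lerD2l.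
by split; lra.
Qed.

(* [Phi th] is the pairing of [F_th] with [(H - z)^-1] applied to the normalized
   conjugate of [F_0]. *)
Lemma resolvent_potential a z b : 0 < Re a ->
  resolvent_set (harmonic_oscillator (a ^+ 2)) z ->
  exists Phi : R[i] -> R[i], exists nu : R,
  [/\ 0 <= nu, (nu%:E <= resolvent_norm (harmonic_oscillator (a ^+ 2)%R) z)%E,
      forall th, normc (Phi th) <= 2 * nu * expR (norm_exponent a z b th) &
      forall th d t, -1 < t < 2 ->
        cderiv (fun t => Phi (th + t%:C%C * d)) t
          (d / (2 * a) * cexp (overlap_exponent a z b (th + t%:C%C * d)))].
Proof.
move=> a0 rz; have an0 : a != 0.
  by apply: contraTneq a0 => ->; rewrite ltxx.
have ac0 : 0 < Re (a^*)%C by case: (a) a0.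
pose I := gauss_mass (Re a); have I0 : 0 < I by exact: gauss_mass_gt0.
pose C0 := orbit_phase a z b 0.
pose m0 := I * expR (2 * Re C0 + Re b ^+ 2 / Re a).
have m00 : 0 < m0 by rewrite mulr_gt0// expR_gt0.
(* [m0] is the squared norm of [F_0], so [expR l] is its norm, and [k] below is the conjugate of
   [F_0] divided by that norm. *)
pose l := ln m0 / 2.
have m0E : m0 = expR (2 * l) by rewrite /l mulrC mulfVK// lnK.
pose k := gq (a^*)%C (b^*)%C ((C0^*)%C - l%:C%C).
have k2 : L2 k by exact: L2_gq.
have Rec w : Re (w^*)%C = Re w by case: w.
have kn : L2norm k = 1%E.
  rewrite L2norm_gq// !Rec -[RHS](_ : (Num.sqrt 1)%:E = _); last by rewrite sqrtr1.
  congr (Num.sqrt _)%:E; rewrite Re_add Re_opp Rec/= -/I.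
  have -> : I * expR (2 * (Re C0 - l) + Re b ^+ 2 / Re a) = m0 * expR (- (2 * l)).
    by rewrite /m0 -mulrA -expRD; congr (_ * expR _); ring.
  by rewrite m0E -expRD subrr expR0.
have [surj _ _] := rz; have [u uk] := surj k k2.
have u2 : L2 u by have [h [/= [[[]]]]] := uk.
pose U th := cintegral (fun x => u x * orbit_gauss a z b th x).
(* The prefactor divides [F_th] as well by the norm of [F_0], so that both conclusions involve
   exponents relative to [th = 0]. The bound [nu] is the norm of [u], which competes in the supremum
   because [k] is a unit vector. *)
exists (fun th => (expR (- l))%:C%C * U th), (fine (L2norm u)).
split.
- by rewrite fine_ge0// /L2norm Lnorm_ge0.
- rewrite L2_fineK// /resolvent_norm ifF; last by apply/asboolPn => nz; exact: nz.
  by apply: ereal_sup_ubound; exists (u, k) => //; split=> //=; rewrite kn.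
- move=> th; have g2 : L2 (orbit_gauss a z b th) by exact: L2_gq.
  have gn : fine (L2norm (orbit_gauss a z b th)) = expR (l + norm_exponent a z b th).
    rewrite /orbit_gauss L2norm_gq//= -/I.
    have -> : I * expR (2 * Re (orbit_phase a z b th) + Re (orbit_center b th) ^+ 2 / Re a) =
        expR (l + norm_exponent a z b th) ^+ 2.
      have -> : I = m0 * expR (- (2 * Re C0 + Re b ^+ 2 / Re a)).
        by rewrite /m0 -mulrA -expRD subrr expR0 mulr1.
      rewrite m0E (expr2 (expR _)) -!expRD; congr expR.
      rewrite /norm_exponent Re_add Re_opp -/C0; field.
      by rewrite gt_eqF.
    by rewrite sqrtr_sqr ger0_norm// expR_ge0.
  rewrite normcM normc_real ger0_norm ?expR_ge0//.
  have := normc_cintegralM_le u2 g2; rewrite gn => h.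
  apply: (le_trans (ler_wpM2l (expR_ge0 _) h)).
  rewrite expRD; have -> : expR (- l) * (2 * (fine (L2norm u) *
      (expR l * expR (norm_exponent a z b th)))) =
    (expR (- l) * expR l) * (2 * fine (L2norm u) * expR (norm_exponent a z b th)) by ring.
  by rewrite -expRD addNr expR0 mul1r.
- move=> th d t t12; have [B HB] := orbit_bound a z b th d.
  have h := cderiv_pairing a0 u2 t12
    (fun s _ => conj (cderiv_orbit_center b th d s) (cderiv_orbit_phase z b th d s an0)) HB.
  apply: cderiv_eq (cderivZ (expR (- l))%:C%C h) _.
  set th' := th + t%:C%C * d; set W := orbit_center b th'.
  have pair := resolvent_pairing W (orbit_phase a z b th') a0 k2 uk.
  have -> : (fun x => u x * (quad 0 (d * W) (- (d / (2 * a)) * (z - a + W ^+ 2)) x *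
      gq a W (orbit_phase a z b th') x)) =
    (fun x => d / (2 * a) * (u x * (quad 0 (2 * a * W) (a - W ^+ 2 - z) x *
      gq a W (orbit_phase a z b th') x))).
    by apply/funext => x; rewrite /quad; field.
  rewrite cintegralZl; last by apply: L2M; [exact: u2|exact: L2_quad_gq].
  rewrite pair mulrCA; congr (_ * _).
  have -> : (fun x => k x * gq a W (orbit_phase a z b th') x) =
     (fun x => cexp ((C0^*)%C - l%:C%C + orbit_phase a z b th') *
               gq (2 * Re a)%:C%C ((b^*)%C + W) 0 x).
    apply/funext => x; rewrite /k gqM.
    have -> : (a^*)%C + a = (2 * Re a)%:C%C.
      by rewrite addrC addcJ rmorphM /= rmorph_nat.
    by rewrite /gq -cexpD; congr cexp; ring.
  rewrite cintegralZl; last exact: cintegrable_gq.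
  rewrite cintegral_gq0// -/(gauss_mass (Re a)) -/I.
  (* Writing the Gaussian mass through the norm of [F_0] turns everything into one exponential, in
     which the normalization [l] cancels. *)
  have -> : I = expR (2 * l - (2 * Re C0 + Re b ^+ 2 / Re a)).
    by rewrite expRD -m0E /m0 -mulrA -expRD subrr expR0 mulr1.
  rewrite -!cexp_real -!cexpD; congr cexp.
  have e1 : (2 * Re C0)%:C%C = C0 + (C0^*)%C by rewrite addcJ rmorphM/= rmorph_nat.
  have r0 : (Re a)%:C%C != 0 :> R[i] by rewrite -normc_eq0 normc_real normr_eq0 gt_eqF.
  have e2 : (Re b ^+ 2 / Re a)%:C%C = ((b^*)%C + b) ^+ 2 / (4 * Re a)%:C%C.
    rewrite [(b^*)%C + b]addrC addcJ !rmorphM/= fmorphV !rmorph_nat/=; field.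
    exact: r0.
  have eN (x : R) : (- x)%:C%C = - x%:C%C :> R[i] by exact: rmorphN.
  have eB (x y : R) : (x - y)%:C%C = x%:C%C - y%:C%C :> R[i] by exact: rmorphB.
  have eD (x y : R) : (x + y)%:C%C = x%:C%C + y%:C%C :> R[i] by exact: rmorphD.
  rewrite eN eB eD e1 e2 /overlap_exponent -/W -/C0.
  have -> : (2 * l)%:C%C = 2 * l%:C%C :> R[i] by rewrite rmorphM/= rmorph_nat.
  by ring.
Qed.

End ResolventPotential.

(** * Expansion of the exponents *)

Section Taylor.
Context {R : realType}.
Local Notation normc := (@ComplexField.Normc.normc R).
Local Notation Re := (@complex.Re R).
Local Notation Im := (@complex.Im R).
Implicit Types (a b z w s m : R[i]) (x t : R).

Lemma is_derive_diff_le (h h' : R -> R) (B : R) :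
  (forall t, 0 <= t <= 1 -> is_derive t 1 h (h' t)) ->
  (forall t, 0 <= t <= 1 -> `|h' t| <= B) -> `|h 1 - h 0| <= B.
Proof.
move=> dh hB.
have [||c + ->] := @MVT _ h h' 0 1 ltr01.
- by move=> c; rewrite in_itv/= => /andP[c0 c1]; apply: dh; rewrite !ltW.
- apply: derivable_within_continuous => x; rewrite in_itv/= => /dh.
  exact: is_derive_derivable.
- by rewrite in_itv/= => /andP[c0 c1]; rewrite subr0 mulr1 hB// !ltW.
Qed.

Lemma cderiv_diff_le (f f' : R -> R[i]) (B : R) :
  (forall t, 0 <= t <= 1 -> cderiv f t (f' t)) ->
  (forall t, 0 <= t <= 1 -> normc (f' t) <= B) -> normc (f 1 - f 0) <= 2 * B.
Proof.
move=> df fB; apply: (le_trans (normc_le_ReIm _)).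
rewrite mulr_natl mulr2n Re_add Re_opp Im_add Im_opp; apply: lerD.
- apply: (@is_derive_diff_le (fun t => Re (f t)) (fun t => Re (f' t))).
  + by move=> t /df[].
  + by move=> t /fB; apply: le_trans (normc_Re _).
- apply: (@is_derive_diff_le (fun t => Im (f t)) (fun t => Im (f' t))).
  + by move=> t /df[].
  + by move=> t /fB; apply: le_trans (normc_Im _).
Qed.

Lemma cderiv_scale w t : cderiv (fun t => t%:C%C * w) t w.
Proof.
apply: cderiv_eq (cderivM (cderiv_real t) (cderiv_cst w t)) _.
by rewrite mul1r mulr0 addr0.
Qed.

Lemma cexp_taylor : exists2 K : R, 1 <= K & forall w, normc w <= 1 ->
  [/\ normc (cexp w - 1) <= K * normc w,
      normc (cexp w - 1 - w) <= K * normc w ^+ 2 &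
      normc (cexp w - 1 - w - w ^+ 2 / 2) <= K * normc w ^+ 3].
Proof.
pose e := expR 1 : R; have e1 : 1 <= e by rewrite /e -expR0 ler_expR.
have tw w t : 0 <= t <= 1 -> normc (t%:C%C * w) <= normc w.
  by move=> /andP[t0 t1]; rewrite normcM normc_real ger0_norm// ler_piMl// normc_ge0.
have dE w t : cderiv (fun t => cexp (t%:C%C * w)) t (w * cexp (t%:C%C * w)).
  exact: cderiv_cexp (cderiv_scale w t).
have h1 w : normc w <= 1 -> normc (cexp w - 1) <= 2 * e * normc w.
  move=> w1; have := @cderiv_diff_le (fun t => cexp (t%:C%C * w))
    (fun t => w * cexp (t%:C%C * w)) (normc w * e) (fun t _ => dE w t).
  rewrite rmorph1 rmorph0 mul1r mul0r cexp0 => H.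
  apply: le_trans (H _) _; last by rewrite mulrA mulrAC.
  move=> t t01; rewrite normcM ler_wpM2l ?normc_ge0// normc_cexp /e ler_expR.
  exact: le_trans (ler_norm _) (le_trans (normc_Re _) (le_trans (tw w t t01) w1)).
have h2 w : normc w <= 1 -> normc (cexp w - 1 - w) <= 4 * e * normc w ^+ 2.
  move=> w1; have d2 t : cderiv (fun t => cexp (t%:C%C * w) + - 1 * (t%:C%C * w)) t
      (w * (cexp (t%:C%C * w) - 1)).
    by apply: cderiv_eq (cderivD (dE w t) (cderivZ (-1) (cderiv_scale w t))) _; ring.
  have := @cderiv_diff_le _ _ (normc w * (2 * e * normc w)) (fun t _ => d2 t).
  rewrite rmorph1 rmorph0 !mul1r !mul0r cexp0 mulr0 addr0 => H.
  rewrite (_ : cexp w - 1 - w = cexp w + -1 * w - 1); last by ring.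
  apply: le_trans (H _) _; last by rewrite le_eqVlt; apply/orP; left; apply/eqP; ring.
  move=> t t01; have twt := tw w t t01.
  rewrite normcM ler_wpM2l ?normc_ge0//; apply: (le_trans (h1 _ (le_trans twt w1))).
  by rewrite ler_wpM2l//; rewrite mulr_ge0//; lra.
have h3 w : normc w <= 1 -> normc (cexp w - 1 - w - w ^+ 2 / 2) <= 8 * e * normc w ^+ 3.
  move=> w1; have d3 t : cderiv (fun t => cexp (t%:C%C * w) + - 1 * (t%:C%C * w) +
      - (2^-1) * ((t%:C%C * w) * (t%:C%C * w))) t
      (w * (cexp (t%:C%C * w) - 1 - t%:C%C * w)).
    apply: cderiv_eq (cderivD (cderivD (dE w t) (cderivZ (-1) (cderiv_scale w t)))
      (cderivZ (- 2^-1) (cderivM (cderiv_scale w t) (cderiv_scale w t)))) _.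
    by field.
  have := @cderiv_diff_le _ _ (normc w * (4 * e * normc w ^+ 2)) (fun t _ => d3 t).
  rewrite rmorph1 rmorph0 !mul1r !mul0r cexp0 !mulr0 !addr0 => H.
  rewrite (_ : cexp w - 1 - w - w ^+ 2 / 2 =
    cexp w + -1 * w + - 2^-1 * (w * w) - 1); last by field.
  apply: le_trans (H _) _; last by rewrite le_eqVlt; apply/orP; left; apply/eqP; ring.
  move=> t t01; have twt := tw w t t01.
  rewrite normcM ler_wpM2l ?normc_ge0//; apply: (le_trans (h2 _ (le_trans twt w1))).
  rewrite ler_wpM2l//; first by rewrite mulr_ge0//; lra.
  by rewrite ler_pXn2r// nnegrE normc_ge0.
have Kle (x : R) : 0 <= x -> 2 * e * x <= 8 * e * x /\ 4 * e * x <= 8 * e * x.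
  by move=> x0; have := mulr_ge0 (le_trans ler01 e1) x0; split; nra.
exists (8 * e); first by lra.
move=> w w1; split.
- exact: le_trans (h1 w w1) (Kle _ (normc_ge0 w)).1.
- exact: le_trans (h2 w w1) (Kle _ (exprn_ge0 2 (normc_ge0 w))).2.
- exact: h3.
Qed.

End Taylor.

(** * Quadratic approximation with cubic error *)

Section Exponents.
Context {R : realType}.
Local Notation normc := (@ComplexField.Normc.normc R).
Local Notation Re := (@complex.Re R).
Implicit Types (a b z w s m : R[i]) (x t : R).

(* Here [b = a x - i xi] and [z = a^2 x^2 + xi^2], for a coherent state centred at the
   phase space point [(x, - xi)], so that [m = 2 i xi / (a b)]. *)
Lemma exponent_expansion a (B : R) : 0 < Re a -> exists2 K : R, 0 < K &
  forall b z m s x, b != 0 -> Re b = Re a * x -> z = b * (2 * a * x%:C%C - b) ->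
    m = 2 * (x%:C%C / b - a^-1) -> normc m <= B -> 2 * normc s <= normc b ->
    normc (overlap_exponent a z b (2 * s / b) - s ^+ 2 * (m + (Re a)^-1%:C%C)) <=
      K * ((normc s ^+ 3 + normc s) / normc b) /\
    `|norm_exponent a z b (2 * s / b) - (Re (m * s ^+ 2) + 2 * Re s ^+ 2 / Re a)| <=
      K * ((normc s ^+ 3 + normc s) / normc b).
Proof.
move=> a0; have [K0 K01 taylor] := @cexp_taylor R.
have an0 : a != 0 by apply: contraTneq a0 => ->; rewrite ltxx.
have ra0 : (Re a)%:C%C != 0 :> R[i] by rewrite -normc_eq0 normc_real normr_eq0 gt_eqF.
pose c1 := normc (2 * a)^-1 + `|B|.
pose c2 := normc ((4 * Re a)%:C%C^-1 - (4 * a)^-1).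
pose c3 := normc (4 * a)^-1.
pose K1 := K0 * (K0 + 1).
have K00 : 0 < K0 by exact: lt_le_trans K01.
have c10 : 0 <= c1 by rewrite addr_ge0 ?normc_ge0.
have c20 : 0 <= c2 by exact: normc_ge0.
have c30 : 0 <= c3 by exact: normc_ge0.
have K10 : 0 <= K1 by rewrite mulr_ge0//; lra.
have ia : 0 <= (2 * Re a)^-1 by rewrite invr_ge0 mulr_ge0// ltW.
have g1 : 0 <= c1 * K0 by rewrite mulr_ge0// ltW.
have g2 : 0 <= c2 * K1 by rewrite mulr_ge0.
have g3 : 0 <= c3 * K1 by rewrite mulr_ge0.
have g4 : 0 <= (2 * Re a)^-1 * K1 by rewrite mulr_ge0.
exists (8 * (c1 * K0) + 8 * (c2 * K1) + 8 * (c3 * K1) + 8 * ((2 * Re a)^-1 * K1) + 1).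
  lra.
move=> b z m s x b0 Rb zE mE mB sb.
have nb : 0 < normc b by rewrite normc_gt0.
have n0 := normc_ge0 s.
set th := 2 * s / b.
have two : normc (2 : R[i]) = 2.
  by rewrite (_ : 2 = (2 : R)%:C%C) ?normc_real ?ger0_norm// rmorph_nat.
have nth : normc th = 2 * normc s / normc b by rewrite !normcM normcV two.
have th1 : normc th <= 1 by rewrite nth ler_pdivrMr// mul1r.
have th0 := normc_ge0 th.
have [t1 t2 t3] := taylor th th1.
set y := cexp th - 1 in t1 t2 t3.
(* The scale of every cubic error: the exponents carry a factor of size [|b|^2], and
   [th = 2 s / b]. *)
have n3 : normc b ^+ 2 * normc th ^+ 3 = 8 * (normc s ^+ 3 / normc b).
  by rewrite nth; field; rewrite gt_eqF.
have sq : normc (y ^+ 2 - th ^+ 2) <= K1 * normc th ^+ 3.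
  rewrite subr_sqr normcM.
  have h : normc (y + th) <= (K0 + 1) * normc th.
    by apply: (le_trans (ler_normcD _ _)); rewrite mulrDl mul1r lerD2r.
  apply: le_trans (ler_pM (normc_ge0 _) (normc_ge0 _) t2 h) _.
  by rewrite le_eqVlt; apply/orP; left; apply/eqP; rewrite /K1; ring.
have bs : b * th = 2 * s by rewrite /th; field.
(* The coefficient is [b x - b^2 / (2 a)], by the definition of [m]. The term [th / 2] comes from
   the summand [a] in [(z - a) / (2 a)], and gives the linear part of the error. *)
pose E1 := b ^+ 2 * ((2 * a)^-1 + m / 2) * (y - th - th ^+ 2 / 2) + th / 2.
have nE1 : normc E1 <= 8 * (c1 * K0) * (normc s ^+ 3 / normc b) + normc s / normc b.
  apply: (le_trans (ler_normcD _ _)); apply: lerD; last first.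
    by rewrite normcM normcV two nth; rewrite le_eqVlt; apply/orP; left; apply/eqP; field; rewrite gt_eqF.
  rewrite !normcM -(expr2 (normc b)).
  have h : normc ((2 * a)^-1 + m / 2) <= c1.
    apply: (le_trans (ler_normcD _ _)); rewrite lerD2l normcM normcV two.
    have := ler_norm B; have := normc_ge0 m; lra.
  apply: (@le_trans _ _ (normc b ^+ 2 * c1 * (K0 * normc th ^+ 3))).
    apply: ler_pM; rewrite ?mulr_ge0 ?exprn_ge0 ?normc_ge0//.
    by rewrite ler_wpM2l ?exprn_ge0 ?normc_ge0.
  have -> : normc b ^+ 2 * c1 * (K0 * normc th ^+ 3) =
    c1 * K0 * (normc b ^+ 2 * normc th ^+ 3) by ring.
  by rewrite n3 le_eqVlt; apply/orP; left; apply/eqP; ring.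
(* The constant [c] is [(4 Re a)^-1 - (4 a)^-1] for the overlap, [- (4 a)^-1] for the phase in the
   norm, and 1 for the squared real part of the center. *)
have nE2 c : normc (b ^+ 2 * (y ^+ 2 - th ^+ 2) * c) <=
    8 * (normc c * K1) * (normc s ^+ 3 / normc b).
  rewrite 2!normcM normcX.
  apply: (@le_trans _ _ (normc b ^+ 2 * (K1 * normc th ^+ 3) * normc c)).
    by rewrite ler_wpM2r ?normc_ge0// ler_wpM2l// exprn_ge0// normc_ge0.
  have -> : normc b ^+ 2 * (K1 * normc th ^+ 3) * normc c =
    normc c * K1 * (normc b ^+ 2 * normc th ^+ 3) by ring.
  by rewrite n3 le_eqVlt; apply/orP; left; apply/eqP; ring.
have p3 : 0 <= normc s ^+ 3 / normc b by rewrite divr_ge0 ?exprn_ge0// ltW.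
have p1 : 0 <= normc s / normc b by rewrite divr_ge0// ltW.
have dE : (normc s ^+ 3 + normc s) / normc b = normc s ^+ 3 / normc b + normc s / normc b.
  by rewrite mulrDl.
have cE : cexp th = 1 + y by rewrite /y; ring.
have bb : b^*%C + b = 2 * ((Re a)%:C%C * x%:C%C).
  by rewrite addrC addcJ Rb rmorphM.
have ra4 : (4 * Re a)%:C%C = 4 * (Re a)%:C%C :> R[i] by rewrite rmorphM/= rmorph_nat.
have ra1 : (Re a)^-1%:C%C = (Re a)%:C%C^-1 :> R[i] by rewrite fmorphV.
have sE : s = b * th / 2 by rewrite bs; field.
split.
- have -> : overlap_exponent a z b th - s ^+ 2 * (m + (Re a)^-1%:C%C) =
      E1 + b ^+ 2 * (y ^+ 2 - th ^+ 2) * ((4 * Re a)%:C%C^-1 - (4 * a)^-1).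
    rewrite /overlap_exponent /orbit_phase /orbit_center cexp0 cE bb /E1 ra4 ra1.
    rewrite (_ : b^*%C = 2 * ((Re a)%:C%C * x%:C%C) - b); last by rewrite -bb addrK.
    rewrite mE zE; clear -b0 an0 ra0 sE; rewrite sE; clearbody th y.
    by field; rewrite b0 an0 ra0.
  apply: (le_trans (ler_normcD _ _)); apply: (le_trans (lerD nE1 (nE2 _))).
  rewrite dE -/c2.
  set u := _ / _ in p3 *; set v := _ / _ in p1 *.
  have := mulr_ge0 g1 p3; have := mulr_ge0 g2 p3; have := mulr_ge0 g3 p3.
  have := mulr_ge0 g4 p3; have := mulr_ge0 g1 p1; have := mulr_ge0 g2 p1.
  have := mulr_ge0 g3 p1; have := mulr_ge0 g4 p1; lra.
- pose P := Re (b * y).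
  have WE : Re (orbit_center b th) = Re a * x + P.
    by rewrite /orbit_center cE mulrDr mulr1 Re_add Rb.
  have QE : Re (b * th) = 2 * Re s by rewrite bs mulr_natl mulr2n Re_add; ring.
  have PQ : P ^+ 2 - (2 * Re s) ^+ 2 = Re (b * (y - th)) * Re (b * (y + th)).
    by rewrite -QE subr_sqr /P -Re_opp -!Re_add; congr (Re _ * Re _); ring.
  have nPQ : `|P ^+ 2 - (2 * Re s) ^+ 2| <= 8 * K1 * (normc s ^+ 3 / normc b).
    rewrite PQ normrM.
    apply: (le_trans (ler_pM (normr_ge0 _) (normr_ge0 _) (normc_Re _) (normc_Re _))).
    rewrite -normcM (_ : b * (y - th) * (b * (y + th)) = b ^+ 2 * (y ^+ 2 - th ^+ 2) * 1);
      last by ring.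
    apply: (le_trans (nE2 1)); rewrite ComplexField.Normc.normc1.
    by rewrite le_eqVlt; apply/orP; left; apply/eqP; ring.
  pose D := orbit_phase a z b th - orbit_phase a z b 0.
  (* The phase alone has a first order term; it is cancelled by [x * P], which arises from squaring
     the real part [Re a * x + P] of the center. *)
  have DE : D + x%:C%C * (b * y) = m * s ^+ 2 + (E1 + b ^+ 2 * (y ^+ 2 - th ^+ 2) * - (4 * a)^-1).
    rewrite /D /orbit_phase /orbit_center cexp0 cE /E1.
    rewrite mE zE; clear -b0 an0 sE; rewrite sE; clearbody th y.
    by field; rewrite b0 an0.
  have RDE : Re D + x * P = Re (m * s ^+ 2) +
      Re (E1 + b ^+ 2 * (y ^+ 2 - th ^+ 2) * - (4 * a)^-1).
    by rewrite -Re_add -DE Re_add (Re_mul _ (b * y))/= mul0r subr0.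
  have -> : norm_exponent a z b th - (Re (m * s ^+ 2) + 2 * Re s ^+ 2 / Re a) =
    Re (E1 + b ^+ 2 * (y ^+ 2 - th ^+ 2) * - (4 * a)^-1) +
    (2 * Re a)^-1 * (P ^+ 2 - (2 * Re s) ^+ 2).
    have -> : norm_exponent a z b th = Re D + x * P + (2 * Re a)^-1 * P ^+ 2.
      by rewrite /norm_exponent -/D WE Rb; field; rewrite gt_eqF.
    by rewrite RDE; field; rewrite gt_eqF.
  apply: (le_trans (ler_normD _ _)).
  have h1 := le_trans (normc_Re _) (le_trans (ler_normcD _ _) (lerD nE1 (nE2 (- (4 * a)^-1)))).
  have h2 := ler_wpM2l ia nPQ.
  apply: (le_trans (lerD h1 _)).
    by rewrite normrM (ger0_norm ia); exact: h2.
  rewrite dE normc_opp -/c3.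
  set u := _ / _ in p3 *; set v := _ / _ in p1 *.
  have := mulr_ge0 g1 p3; have := mulr_ge0 g2 p3; have := mulr_ge0 g3 p3.
  have := mulr_ge0 g4 p3; have := mulr_ge0 g1 p1; have := mulr_ge0 g2 p1.
  have := mulr_ge0 g3 p1; have := mulr_ge0 g4 p1; lra.
Qed.

End Exponents.

(** * The contour *)

Section Path.
Context {R : realType}.
Local Notation normc := (@ComplexField.Normc.normc R).
Local Notation Re := (@complex.Re R).
Local Notation Im := (@complex.Im R).
Implicit Types (M e s d w : R[i]) (x t r X Y : R) (Psi L : R[i] -> R[i]).

(** Expanding the square leaves the cross term [2 t (1 - t) r p], and [Y <= r p] follows by
    multiplying [Y <= r^2] and [Y <= p^2]. *)
Lemma hyperbola_convex r p q Y t : 0 <= r -> 0 <= p -> 0 <= Y -> Y <= r ^+ 2 ->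
  Y <= p ^+ 2 - q ^+ 2 -> 0 <= t <= 1 ->
  Y <= ((1 - t) * r + t * p) ^+ 2 - (t * q) ^+ 2.
Proof.
move=> r0 p0 Y0 Yr Yp /andP[t0 t1].
have Yrp : Y <= r * p.
  have := sqr_ge0 q => q2; have Yp2 : Y <= p ^+ 2 by lra.
  have := ler_pM Y0 Y0 Yr Yp2; rewrite -expr2 -exprMn.
  by rewrite ler_pXn2r// nnegrE mulr_ge0.
have u0 : 0 <= 1 - t by rewrite subr_ge0.
have h1 := ler_wpM2l (sqr_ge0 (1 - t)) Yr.
have h2 := ler_wpM2l (sqr_ge0 t) Yp.
have h3 := ler_wpM2l (mulr_ge0 t0 u0) Yrp.
nra.
Qed.

(** [Psi] is a primitive of [exp L] along every straight line; this replaces holomorphy and path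
    independence, since increments over consecutive segments telescope. *)
Definition potential Psi L := forall s d t, -1 < t < 2 ->
  cderiv (fun t => Psi (s + t%:C%C * d)) t (d * cexp (L (s + t%:C%C * d))).

Lemma potential_segment_le Psi L s1 s2 (B : R) : potential Psi L ->
  (forall t, 0 <= t <= 1 -> normc (cexp (L (s1 + t%:C%C * (s2 - s1)))) <= B) ->
  normc (Psi s2 - Psi s1) <= 2 * (normc (s2 - s1) * B).
Proof.
move=> pot LB; have := @cderiv_diff_le _ (fun t => Psi (s1 + t%:C%C * (s2 - s1)))
  (fun t => (s2 - s1) * cexp (L (s1 + t%:C%C * (s2 - s1)))) (normc (s2 - s1) * B).
rewrite rmorph1 rmorph0 mul1r mul0r addr0 (addrC s1) subrK; apply.
- by move=> t t01; apply: pot; lra.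
- by move=> t t01; rewrite normcM ler_wpM2l ?normc_ge0// LB.
Qed.

Lemma normc_cexp_near M L s (dl : R) : normc (L s - M * s ^+ 2) <= dl -> dl <= ln 2 ->
  normc (cexp (L s)) <= 2 * expR (Re (M * s ^+ 2)).
Proof.
move=> Ls dl2; rewrite normc_cexp.
have -> : Re (L s) = Re (L s - M * s ^+ 2) + Re (M * s ^+ 2) by rewrite -Re_add subrK.
rewrite expRD ler_wpM2r ?expR_ge0//.
rewrite -[leRHS](lnK (_ : (2 : R) \is Num.pos)) ?posrE// ler_expR.
exact: le_trans (ler_norm _) (le_trans (normc_Re _) (le_trans Ls dl2)).
Qed.

(* In the coordinate [s / e] the region where [- Re (M s^2)] is large is bounded by a
   branch of a hyperbola, hence convex. *)
Lemma potential_connect Psi L M e s1 r X (dl : R) : potential Psi L ->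
  normc e = 1 -> e ^+ 2 * M = - (normc M)%:C%C -> 0 < normc M ->
  0 <= r -> 0 <= X -> X <= normc M * r ^+ 2 -> X <= - Re (M * s1 ^+ 2) ->
  0 <= Re (s1 / e) -> dl <= ln 2 ->
  (forall s, normc s <= Num.max r (normc s1) -> normc (L s - M * s ^+ 2) <= dl) ->
  normc (Psi s1 - Psi (r%:C%C * e)) <= 4 * (normc s1 + r) * expR (- X).
Proof.
move=> pot e1 eM M0 r0 X0 Xr Xs s1e dl2 Ldl.
have e0 : e != 0 by rewrite -normc_eq0 e1 oner_eq0.
set w := s1 / e in s1e.
have s1E : s1 = e * w by rewrite /w mulrCA divff ?mulr1.
have MsE (v : R[i]) : Re (M * (e * v) ^+ 2) = - (normc M) * (Re v ^+ 2 - Im v ^+ 2).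
  have -> : M * (e * v) ^+ 2 = (e ^+ 2 * M) * (v * v) by ring.
  by rewrite eM Re_mul Re_opp Re_mul Im_opp /=; ring.
have wn : normc w = normc s1 by rewrite /w normcM normcV e1 invr1 mulr1.
apply: le_trans (@potential_segment_le _ _ (r%:C%C * e) s1 (2 * expR (- X)) pot _) _; last first.
  have : normc (s1 - r%:C%C * e) <= normc s1 + r.
    by apply: (le_trans (ler_normcB _ _)); rewrite normcM normc_real e1 mulr1 ger0_norm.
  by move=> /(ler_wpM2r (expR_ge0 (- X))); lra.
move=> t t01; have /andP[t0 t1] := t01.
have uE : (1 - t)%:C%C = 1 - t%:C%C :> R[i] by rewrite rmorphB rmorph1.
pose v : R[i] := Complex ((1 - t) * r + t * Re w) (t * Im w).
have vE : r%:C%C * e + t%:C%C * (s1 - r%:C%C * e) = e * v.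
  have -> : v = (1 - t)%:C%C * r%:C%C + t%:C%C * w.
    by apply: complex_ext; rewrite /v ?Re_add ?Im_add ?Re_mul ?Im_mul /=; ring.
  by rewrite s1E uE; ring.
rewrite vE; apply: le_trans (normc_cexp_near (Ldl _ _) dl2) _.
  rewrite -vE; have -> : r%:C%C * e + t%:C%C * (s1 - r%:C%C * e) =
    (1 - t)%:C%C * (r%:C%C * e) + t%:C%C * s1 by rewrite uE; ring.
  apply: (le_trans (ler_normcD _ _)); rewrite !normcM !normc_real e1 mulr1.
  rewrite !ger0_norm ?subr_ge0//.
  have m1 : r <= Num.max r (normc s1) by rewrite le_max lexx.
  have m2 : normc s1 <= Num.max r (normc s1) by rewrite le_max lexx orbT.
  have u0 : 0 <= 1 - t by rewrite subr_ge0.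
  have := ler_wpM2l u0 m1; have := ler_wpM2l t0 m2; lra.
rewrite ler_wpM2l// ler_expR MsE mulNr lerN2 /=.
pose Y := X / normc M.
have Y0 : 0 <= Y by rewrite divr_ge0// ltW.
have YX : X = normc M * Y by rewrite /Y mulrCA divff ?mulr1// gt_eqF.
rewrite [leLHS]YX ler_pM2l//.
apply: hyperbola_convex => //.
- by rewrite /Y ler_pdivrMr// mulrC.
- rewrite /Y ler_pdivrMr// mulrC; move: Xs; rewrite s1E MsE; lra.
Qed.

(** On the line through [e] the exponent [M s^2] is real and equals [- |M| |s|^2], so the integrand,
    up to the factor [e], has real part at least half a Gaussian. Nothing cancels, and the portion
    [|s| <= 1] already gives the bound. *)
Lemma core_gain Psi L M e r : potential Psi L ->
  normc e = 1 -> e ^+ 2 * M = - (normc M)%:C%C ->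
  1 <= r ->
  (forall s, normc s <= r -> normc (cexp (L s - M * s ^+ 2) - 1) <= 1 / 2) ->
  expR (- normc M) <= normc (Psi (r%:C%C * e) - Psi (- (r%:C%C * e))).
Proof.
move=> pot e1 eM r1 LM.
have r0 : 0 < r by exact: lt_le_trans r1.
pose s t := - (r%:C%C * e) + t%:C%C * (2 * (r%:C%C * e)).
(* The conjugate of the unit vector [e] removes the direction of the path from the derivative. *)
pose f t := e^*%C * Psi (s t).
have ee : e^*%C * e = 1.
  have := sqr_normcE e; rewrite e1 expr1n => h; apply: complex_ext.
    by rewrite Re_mul; case: (e) h => p q /= h; rewrite mulNr opprK -!expr2 -h.
  by rewrite Im_mul; case: (e) => p q /=; ring.
have sE t : s t = (r * (2 * t - 1))%:C%C * e.
  have -> : (r * (2 * t - 1))%:C%C = r%:C%C * (2 * t%:C%C - 1) :> R[i].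
    by rewrite rmorphM rmorphB rmorphM rmorph1 rmorph_nat.
  by rewrite /s; ring.
have df t : -1 < t < 2 -> cderiv f t (2 * r%:C%C * cexp (L (s t))).
  move=> t12; apply: cderiv_eq (cderivZ (e^*%C) (pot _ _ t t12)) _.
  rewrite -/(s t); have -> : e^*%C * (2 * (r%:C%C * e) * cexp (L (s t))) =
    (e^*%C * e) * (2 * r%:C%C * cexp (L (s t))) by ring.
  by rewrite ee mul1r.
have reL t : 0 <= t <= 1 ->
    expR (- normc M * (r * (2 * t - 1)) ^+ 2) / 2 <= Re (cexp (L (s t))).
  move=> /andP[t0 t1]; have st : normc (s t) <= r.
    rewrite sE normcM normc_real e1 mulr1 normrM (ger0_norm (ltW r0)).
    by rewrite ler_piMr ?(ltW r0)// ler_norml; lra.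
  have h := LM _ st.
  have Ms : M * s t ^+ 2 = (- normc M * (r * (2 * t - 1)) ^+ 2)%:C%C.
    rewrite sE; have -> : M * ((r * (2 * t - 1))%:C%C * e) ^+ 2 =
      (e ^+ 2 * M) * ((r * (2 * t - 1)) ^+ 2)%:C%C by rewrite rmorphXn/=; ring.
    by rewrite eM -rmorphN -rmorphM.
  have -> : L (s t) = M * s t ^+ 2 + (L (s t) - M * s t ^+ 2) by ring.
  rewrite cexpD Ms cexp_real Re_mul/= mul0r subr0 ler_wpM2l ?expR_ge0//.
  rewrite -Ms; have := le_trans (normc_Re _) h; rewrite Re_add Re_opp/= ler_norml; lra.
pose h t := Re (f t).
have dh t : 0 <= t <= 1 -> is_derive t 1 h (2 * r * Re (cexp (L (s t)))).
  move=> t01; have t12 : -1 < t < 2 by lra.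
  apply: (is_derive_eq (df t t12).1).
  rewrite -mulrA [2 * (_ * _)]mulr_natl mulr2n Re_add (Re_mul r%:C%C)/= mul0r subr0; ring.
have mono x y : 0 <= x -> x < y -> y <= 1 -> exists2 c, x < c < y &
    h y - h x = 2 * r * Re (cexp (L (s c))) * (y - x).
  move=> x0 xy y1.
  have [||c] := @MVT _ h (fun t => 2 * r * Re (cexp (L (s t)))) x y xy.
  - by move=> c; rewrite in_itv/= => /andP[xc cy]; apply: dh; lra.
  - apply: derivable_within_continuous => c; rewrite in_itv/= => /andP[xc cy].
    by apply: is_derive_derivable (dh c _); lra.
  - by rewrite in_itv/= => xcy E; exists c.
have incr x y : 0 <= x -> x <= y -> y <= 1 -> h x <= h y.
  move=> x0; rewrite le_eqVlt => /predU1P[->//|xy] y1.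
  have [c /andP[xc cy] E] := mono x y x0 xy y1.
  have c01 : 0 <= c <= 1 by lra.
  rewrite -subr_ge0 E mulr_ge0 ?subr_ge0 ?(ltW xy)//.
  apply: mulr_ge0; first by rewrite mulr_ge0// ltW.
  by apply: le_trans (reL c c01); rewrite divr_ge0 ?expR_ge0.
(* These parameters bound the portion [|s t| <= 1]. Its length [1 / r] cancels the speed [2 r], up
   to the factor 2 lost in [reL]. *)
pose x := (1 - r^-1) / 2; pose y := (1 + r^-1) / 2.
have ri0 : 0 < r^-1 by rewrite invr_gt0.
have ri1 : r^-1 <= 1 by rewrite invf_le1.
have x0 : 0 <= x by rewrite /x; lra.
have y1 : y <= 1 by rewrite /y; lra.
have xy : x < y by rewrite /x /y; lra.
have [c /andP[xc cy] E] := mono x y x0 xy y1.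
have gain : expR (- normc M) <= h y - h x.
  rewrite E; have -> : y - x = r^-1 by rewrite /x /y; field; rewrite gt_eqF.
  have -> : 2 * r * Re (cexp (L (s c))) / r = 2 * Re (cexp (L (s c))).
    by field; rewrite gt_eqF.
  have c01 : 0 <= c <= 1 by lra.
  have := reL c c01.
  have : expR (- normc M) <= expR (- normc M * (r * (2 * c - 1)) ^+ 2).
    rewrite ler_expR -{1}[- normc M]mulr1 ler_wnM2l ?oppr_le0 ?normc_ge0//.
    have : `|2 * c - 1| <= r^-1 by move: xc cy; rewrite ler_norml /x /y; lra.
    move=> /(ler_wpM2l (ltW r0)); rewrite divff ?gt_eqF// => le1.
    rewrite -(real_normK (num_real (_ * _))) normrM (ger0_norm (ltW r0)).
    by rewrite exprn_ile1// mulr_ge0// ltW.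
  lra.
have h01 : expR (- normc M) <= h 1 - h 0.
  have := incr 0 x (lexx _) x0 (le_trans (ltW xy) y1).
  have := incr y 1 (le_trans x0 (ltW xy)) y1 (lexx _); lra.
apply: (le_trans h01); rewrite /h -Re_opp -Re_add /f.
apply: (le_trans (ler_norm _)); apply: (le_trans (normc_Re _)).
rewrite -mulrBr normcM normc_conj e1 mul1r !sE.
have -> : (r * (2 * 1 - 1))%:C%C * e = r%:C%C * e by congr (_%:C%C * _); ring.
have -> : (r * (2 * 0 - 1))%:C%C * e = - (r%:C%C * e).
  by rewrite mulr0 sub0r mulrN1 rmorphN mulNr.
exact: lexx.
Qed.

End Path.

(** * From the contour to a lower bound for the resolvent *)

Section LowerBound.
Context {R : realType}.
Local Notation normc := (@ComplexField.Normc.normc R).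
Local Notation Re := (@complex.Re R).
Implicit Types (a b z m e s : R[i]) (x r X Q : R).

(** [e] is a square root of [- |M| / M]; its sign is chosen so that [s] lies on the same side as
    [e], as convexity of one hyperbola branch requires. *)
Lemma steepest_direction (M s : R[i]) : M != 0 -> exists e : R[i],
  [/\ normc e = 1, e ^+ 2 * M = - (normc M)%:C%C & 0 <= Re (s / e)].
Proof.
move=> M0; pose e := sqrtc (- (normc M)%:C%C / M).
have e2 : e ^+ 2 = - (normc M)%:C%C / M by exact: sqr_sqrtc.
have nM : 0 < normc M by rewrite normc_gt0.
have ne : normc e = 1.
  apply/eqP; rewrite -(eqrXn2 (n := 2))// ?normc_ge0// expr1n -normcX e2.
  by rewrite normcM normc_opp normc_real normcV ger0_norm ?normc_ge0// divff// gt_eqF.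
have eM : e ^+ 2 * M = - (normc M)%:C%C by rewrite e2 divfK.
have [se|se] := leP 0 (Re (s / e)); first by exists e.
exists (- e); rewrite normc_opp sqrrN; split=> //.
by rewrite invrN mulrN Re_opp oppr_ge0 ltW.
Qed.

(** The core gains [expR (- |M|)]. The two connecting segments cost [4 (|s| + r) expR (- X)] each,
    so the hypothesis with factor 16 lets them consume at most half of it. The other half is bounded
    by [|Psi s| + |Psi (- s)|], at most [4 |a| |b| nu expR (1 - Q)]; this gives the factor 8. *)
Lemma resolvent_norm_ge a (B : R) : 0 < Re a -> exists2 K : R, 0 < K &
  forall b z m s x r X Q, b != 0 -> Re b = Re a * x -> z = b * (2 * a * x%:C%C - b) ->
    m = 2 * (x%:C%C / b - a^-1) -> normc m <= B ->
    let M := m + (Re a)^-1%:C%C in let rho := Num.max r (normc s) in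
    M != 0 -> 1 <= r -> 2 * rho <= normc b ->
    K * ((rho ^+ 3 + rho) / normc b) <= 1 ->
    0 <= X -> X <= normc M * r ^+ 2 -> X <= - Re (M * s ^+ 2) ->
    16 * (normc s + r) * expR (- X) <= expR (- normc M) ->
    Re (m * s ^+ 2) + 2 * Re s ^+ 2 / Re a <= - Q ->
    ((expR (Q - 1 - normc M) / (8 * (normc a * normc b)))%:E <=
      resolvent_norm (harmonic_oscillator (a ^+ 2)%R) z)%E.
Proof.
move=> a0; have [K1 K10 expansion] := exponent_expansion B a0.
have [K0 K01 taylor] := @cexp_taylor R.
have an0 : a != 0 by apply: contraTneq a0 => ->; rewrite ltxx.
have ln2 : 0 < ln 2 :> R by rewrite ln_gt0// ltr1n.
(* Tolerance for the error in the exponent: [ln 2] costs a factor 2 on the connecting segments, and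
   [(2 * K0)^-1] keeps the integrand on the core within relative error 1/2. *)
pose dl := Num.min (ln 2) (2 * K0)^-1.
have K00 : 0 < K0 by exact: lt_le_trans K01.
have dl0 : 0 < dl by rewrite lt_min ln2 invr_gt0 mulr_gt0.
have dl_ln : dl <= ln 2 by rewrite ge_min lexx.
have dlK : K0 * dl <= 1 / 2.
  apply: (@le_trans _ _ (K0 * (2 * K0)^-1)); first by rewrite ler_wpM2l ?(ltW K00)// ge_min lexx orbT.
  by rewrite le_eqVlt; apply/orP; left; apply/eqP; field; rewrite gt_eqF.
have dl1 : dl <= 1.
  have : dl <= K0 * dl by rewrite ler_peMl ?(ltW dl0).
  lra.
exists (K1 / dl); first by rewrite divr_gt0.
move=> b z m s x r X Q b0 Rb zE mE mB M rho M0 r1 rb Kr X0 Xr Xs small NQ.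
have r0 : 0 <= r by lra.
have rho_s : normc s <= rho by rewrite le_max lexx orbT.
have rho_r : r <= rho by rewrite le_max lexx.
have rho0 : 0 <= rho by exact: le_trans rho_r.
have nb : 0 < normc b by rewrite normc_gt0.
have na : 0 < normc a by rewrite normc_gt0.
have err v : normc v <= rho -> K1 * ((normc v ^+ 3 + normc v) / normc b) <= dl.
  move=> vr; apply: (@le_trans _ _ (K1 * ((rho ^+ 3 + rho) / normc b))).
    rewrite ler_wpM2l ?(ltW K10)// ler_wpM2r ?invr_ge0 ?(ltW nb)// lerD//.
    by rewrite ler_pXn2r// nnegrE normc_ge0.
  have := ler_wpM2l (ltW dl0) Kr.
  by rewrite mulr1; apply: le_trans; rewrite le_eqVlt; apply/orP; left; apply/eqP; field; rewrite !gt_eqF.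
have exp v : normc v <= rho -> _ := fun vr => expansion b z m v x b0 Rb zE mE mB
  (le_trans (ler_wpM2l (ler0n R 2) vr) rb).
(* On the spectrum the norm is infinite by convention, so only points of the resolvent set
   remain. *)
rewrite /resolvent_norm; case: ifPn => [_|]; first exact: leey.
move=> /asboolPn nspec; have rz : resolvent_set (harmonic_oscillator (a ^+ 2)) z.
  exact: contrapT.
have [Phi [nu [nu0 nu_le Phi_le dPhi]]] := resolvent_potential b a0 rz.
move: nu_le; rewrite /resolvent_norm ifF; last exact/asboolPn.
apply: le_trans; rewrite lee_fin.
pose L v := overlap_exponent a z b (2 * v / b).
(* The factor [a * b] cancels [1 / (2 a)] from the derivative of [Phi] and [2 / b] from the change
   of variable. *)
pose Psi v := a * b * Phi (2 * v / b).
have pot : potential Psi L.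
  move=> v d t t12; have lE y : 2 * (v + y%:C%C * d) / b = 2 * v / b + y%:C%C * (2 * d / b).
    by field.
  have := cderivZ (a * b) (dPhi (2 * v / b) (2 * d / b) t t12).
  rewrite /Psi /L lE; under [X in cderiv X _ _ -> _]eq_fun do rewrite -lE.
  by move=> h; apply: cderiv_eq h _; field; rewrite an0 b0.
have LM v : normc v <= rho -> normc (L v - M * v ^+ 2) <= dl.
  by move=> vr; have [+ _] := exp v vr; rewrite (mulrC (v ^+ 2)) => h; exact: le_trans h (err v vr).
have [e [e1 eM se]] := steepest_direction s M0.
have nM : 0 < normc M by rewrite normc_gt0.
have core : expR (- normc M) <= normc (Psi (r%:C%C * e) - Psi (- (r%:C%C * e))).
  apply: (core_gain pot e1 eM r1) => v vr.
  have vr' := le_trans vr rho_r.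
  have h := LM v vr'; have [h1 _ _] := taylor _ (le_trans h dl1).
  apply: (le_trans h1); apply: le_trans dlK; by rewrite ler_wpM2l// ltW.
have c1 := potential_connect pot e1 eM nM r0 X0 Xr Xs se dl_ln LM.
(* The mirror image of the first segment: the hypotheses involve only moduli, squares and the
   quotient [s / e], all unchanged when both signs are reversed. *)
have c2 : normc (Psi (- s) - Psi (- (r%:C%C * e))) <= 4 * (normc s + r) * expR (- X).
  have -> : - (r%:C%C * e) = r%:C%C * (- e) by rewrite mulrN.
  rewrite -(normc_opp s); apply: (potential_connect pot _ _ nM r0 X0 Xr _ _ dl_ln).
  - by rewrite normc_opp.
  - by rewrite sqrrN.
  - by rewrite sqrrN.
  - by rewrite invrN mulrNN.
  - by rewrite normc_opp.
have tri : normc (Psi (r%:C%C * e) - Psi (- (r%:C%C * e))) <=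
    normc (Psi s - Psi (r%:C%C * e)) + normc (Psi (- s) - Psi (- (r%:C%C * e))) +
    (normc (Psi s) + normc (Psi (- s))).
  have -> : Psi (r%:C%C * e) - Psi (- (r%:C%C * e)) =
    - (Psi s - Psi (r%:C%C * e)) + (Psi (- s) - Psi (- (r%:C%C * e))) + (Psi s - Psi (- s)).
    by ring.
  apply: (le_trans (ler_normcD _ _)); apply: lerD; last exact: ler_normcB.
  by apply: (le_trans (ler_normcD _ _)); rewrite normc_opp.
have Psi_le v : normc v = normc s -> v ^+ 2 = s ^+ 2 -> Re v ^+ 2 = Re s ^+ 2 ->
    normc (Psi v) <= normc a * normc b * (2 * nu * expR (1 - Q)).
  move=> vs v2 Rv; have vr : normc v <= rho by rewrite vs.
  have [_ h] := exp v vr; rewrite /Psi 2!normcM ler_wpM2l ?mulr_ge0 ?(ltW na) ?(ltW nb)//.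
  apply: (le_trans (Phi_le _)); rewrite ler_wpM2l ?mulr_ge0// ler_expR.
  have := le_trans h (le_trans (err v vr) dl1); rewrite v2 Rv ler_norml => /andP[_].
  lra.
have p1 := Psi_le s erefl erefl erefl.
have p2 := Psi_le (- s) (normc_opp _) (sqrrN _) (_ : Re (- s) ^+ 2 = _).
have {}p2 : normc (Psi (- s)) <= normc a * normc b * (2 * nu * expR (1 - Q)).
  by apply: p2; rewrite Re_opp sqrrN.
have tot : expR (- normc M) <= 8 * (normc a * normc b) * nu * expR (1 - Q).
  move: tri c1 c2 core small p1 p2.
  set A := normc (Psi s - _); set A' := normc (Psi (- s) - _); set D := normc (Psi _ - _).
  set E := expR (- X); set F := expR (- normc M); set G := expR (1 - Q).
  set S := normc (Psi s); set S' := normc (Psi (- s)).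
  have -> : normc a * normc b * (2 * nu * G) = 2 * (normc a * normc b * nu * G) by ring.
  have -> : 8 * (normc a * normc b) * nu * G = 8 * (normc a * normc b * nu * G) by ring.
  set H := normc a * normc b * nu * G.
  have -> : 16 * (normc s + r) * E = 16 * ((normc s + r) * E) by ring.
  have -> : 4 * (normc s + r) * E = 4 * ((normc s + r) * E) by ring.
  set V := (normc s + r) * E; lra.
rewrite ler_pdivrMr ?mulr_gt0// mulrC -ler_pdivrMl ?mulr_gt0//.
have -> : Q - 1 - normc M = - normc M + (Q - 1) by ring.
rewrite expRD.
have := ler_wpM2r (expR_ge0 (Q - 1)) tot.
rewrite -(mulrA _ _ (expR (Q - 1))) -expRD.
have -> : 1 - Q + (Q - 1) = 0 by ring.
rewrite expR0 mulr1 => h.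
rewrite mulrC ler_pdivrMr ?mulr_gt0// (mulrC nu).
exact: h.
Qed.

End LowerBound.

(** * Choice of the end points *)

Section SaddleGeometry.
Context {R : realType}.

(** With [n = a1^2 + a2^2] and [D = saddle_D a1 a2 rho], the quantity [2 P / (a1 n D)] is the
    coefficient of [(Re s)^2] in [Re (m s^2) + 2 (Re s)^2 / a1]; its positivity makes this form
    convex in [Re s]. *)
Definition saddle_P (a1 a2 rho : R) : R :=
  (a1 ^+ 2 + a2 ^+ 2) ^+ 2 * rho ^+ 2 - 2 * a2 ^+ 3 * rho + a2 ^+ 2.

(** This is [|a x - i xi|^2 / xi^2] for [a = a1 + i a2] and [rho = x / xi]. *)
Definition saddle_D (a1 a2 rho : R) : R := (a1 ^+ 2 + a2 ^+ 2) * rho ^+ 2 - 2 * a2 * rho + 1.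

Lemma saddle_P_ge (a1 a2 : R) : 0 < a1 -> 0 < a2 ->
  exists2 c : R, 0 < c & forall rho : R, c * (1 + rho ^+ 2) <= saddle_P a1 a2 rho.
Proof.
move=> h1 h2; set n := a1 ^+ 2 + a2 ^+ 2.
have n0 : 0 < n by rewrite addr_gt0// exprn_gt0.
pose u := n * a1 ^+ 2; pose v := a1 ^+ 2 * a2 ^+ 2 / n.
have u0 : 0 < u by rewrite mulr_gt0// exprn_gt0.
have v0 : 0 < v by rewrite divr_gt0// mulr_gt0// exprn_gt0.
exists (Num.min u v); first by rewrite lt_min u0.
move=> rho.
have -> : saddle_P a1 a2 rho = v + u * rho ^+ 2 + a2 ^+ 2 / n * (n * rho - a2) ^+ 2.
  rewrite /saddle_P -/n /u /v; have -> : a1 ^+ 2 = n - a2 ^+ 2 by rewrite /n; ring.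
  by field; rewrite gt_eqF.
have h : 0 <= a2 ^+ 2 / n * (n * rho - a2) ^+ 2.
  by rewrite mulr_ge0 ?sqr_ge0// divr_ge0 ?sqr_ge0// ltW.
rewrite mulrDr mulr1 -[leLHS]addr0; apply: lerD h; apply: lerD.
  by rewrite ge_min lexx orbT.
by rewrite ler_wpM2r ?sqr_ge0// ge_min lexx.
Qed.

(** The average of two completions of the square: one leaves [a1^2 / n], the other [a1^2 rho^2], and
    together they control [1 + rho^2]. *)
Lemma saddle_D_ge (a1 a2 : R) : 0 < a1 -> 0 < a2 ->
  exists2 c : R, 0 < c & forall rho : R, c * (1 + rho ^+ 2) <= saddle_D a1 a2 rho.
Proof.
move=> h1 h2; set n := a1 ^+ 2 + a2 ^+ 2.
have n0 : 0 < n by rewrite addr_gt0// exprn_gt0.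
pose u := a1 ^+ 2 / 2; pose v := a1 ^+ 2 / n / 2.
have u0 : 0 < u by rewrite divr_gt0// exprn_gt0.
have v0 : 0 < v by rewrite !divr_gt0// exprn_gt0.
exists (Num.min u v); first by rewrite lt_min u0.
move=> rho.
have -> : saddle_D a1 a2 rho =
    v + u * rho ^+ 2 + ((n * rho - a2) ^+ 2 / n + (1 - a2 * rho) ^+ 2) / 2.
  rewrite /saddle_D -/n /u /v; have -> : a1 ^+ 2 = n - a2 ^+ 2 by rewrite /n; ring.
  by field; rewrite gt_eqF.
have h : 0 <= ((n * rho - a2) ^+ 2 / n + (1 - a2 * rho) ^+ 2) / 2.
  by rewrite divr_ge0// addr_ge0 ?sqr_ge0// divr_ge0 ?sqr_ge0// ltW.
rewrite mulrDr mulr1 -[leLHS]addr0; apply: lerD h; apply: lerD.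
  by rewrite ge_min lexx orbT.
by rewrite ler_wpM2r ?sqr_ge0// ge_min lexx.
Qed.

Lemma saddle_P_le (a1 a2 rho : R) : 0 < a2 -> 0 < rho ->
  saddle_P a1 a2 rho <= ((a1 ^+ 2 + a2 ^+ 2) ^+ 2 + a2 ^+ 2) * (1 + rho ^+ 2).
Proof.
move=> h2 rho0; rewrite /saddle_P; set n2 := (_ + _) ^+ 2.
have : 0 <= n2 by exact: sqr_ge0.
have : 0 <= 2 * a2 ^+ 3 * rho by rewrite !mulr_ge0// ?exprn_ge0// ltW.
have : 0 <= a2 ^+ 2 * rho ^+ 2 by rewrite mulr_ge0 ?sqr_ge0.
rewrite mulrDr mulr1 mulrDl; lra.
Qed.

Lemma saddle_D_le (a1 a2 rho : R) : 0 < a2 -> 0 < rho ->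
  saddle_D a1 a2 rho <= ((a1 ^+ 2 + a2 ^+ 2) + 1) * (1 + rho ^+ 2).
Proof.
move=> h2 rho0; rewrite /saddle_D; set n2 := a1 ^+ 2 + a2 ^+ 2.
have : 0 <= n2 by rewrite addr_ge0// sqr_ge0.
have : 0 <= 2 * a2 * rho by rewrite !mulr_ge0// ltW.
have := sqr_ge0 rho.
rewrite mulrDr mulr1 mulrDl; lra.
Qed.

(* This is [2 i xi / (a b)]. *)
Definition saddle_m (a1 a2 x xi : R) : R[i] :=
  2 * (x%:C%C / Complex (a1 * x) (a2 * x - xi) - (Complex a1 a2)^-1).

Lemma saddle_mE (a1 a2 x xi : R) : 0 < a1 -> 0 < a2 -> 0 < x -> 0 < xi ->
  let rho := x / xi in
  let n := (a1 ^+ 2 + a2 ^+ 2) * saddle_D a1 a2 rho in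
  saddle_m a1 a2 x xi = Complex (2 * (2 * a1 * a2 * rho - a1) / n)
    (2 * ((a1 ^+ 2 - a2 ^+ 2) * rho + a2) / n).
Proof.
move=> h1 h2 x0 xi0 rho n.
have b0 : Complex (a1 * x) (a2 * x - xi) != 0.
  by rewrite eq_complex negb_and /= gt_eqF// mulr_gt0.
have a0 : Complex a1 a2 != 0 by rewrite eq_complex negb_and /= gt_eqF.
have [c c0 cD] := saddle_D_ge h1 h2.
have D0 : 0 < saddle_D a1 a2 rho.
  by apply: lt_le_trans (cD rho); rewrite mulr_gt0// ltr_wpDr// sqr_ge0.
have n0 : 0 < n by rewrite mulr_gt0// addr_gt0// exprn_gt0.
apply: (mulIf b0); apply: (mulIf a0).
have -> : saddle_m a1 a2 x xi * Complex (a1 * x) (a2 * x - xi) * Complex a1 a2 =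
    2 * (x%:C%C * Complex a1 a2 - Complex (a1 * x) (a2 * x - xi)).
  by rewrite /saddle_m; field; rewrite b0 a0.
have xE : x = rho * xi by rewrite /rho divfK// gt_eqF.
(* Here [n] is [|a (a x - i xi)|^2 / xi^2], written with real and imaginary parts. *)
have nE : n = ((a1 ^+ 2 - a2 ^+ 2) * rho + a2) ^+ 2 + (2 * a1 * a2 * rho - a1) ^+ 2.
  by rewrite /n /saddle_D; ring.
rewrite xE mulr_natl mulr2n.
apply: complex_ext; rewrite !(Re_mul, Im_mul, Re_add, Im_add, Re_opp, Im_opp) /=.
- by field; rewrite gt_eqF.
- rewrite nE in n0 *; field; rewrite gt_eqF//.
Qed.

End SaddleGeometry.

Section SaddleChoice.
Context {R : realType}.
Local Notation normc := (@ComplexField.Normc.normc R).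
Local Notation Re := (@complex.Re R).
Local Notation Im := (@complex.Im R).

Lemma saddle_bounds (a1 a2 : R) : 0 < a1 -> 0 < a2 -> exists2 C : R, 0 < C &
  forall x xi : R, 0 < x -> 0 < xi ->
  [/\ normc (saddle_m a1 a2 x xi) <= C,
      normc (Complex (a1 * x) (a2 * x - xi)) ^+ 2 <= C * (x ^+ 2 + xi ^+ 2) &
      x ^+ 2 + xi ^+ 2 <= C * normc (Complex (a1 * x) (a2 * x - xi)) ^+ 2].
Proof.
move=> h1 h2; have [c c0 cD] := saddle_D_ge h1 h2.
set n := a1 ^+ 2 + a2 ^+ 2.
have n0 : 0 < n by rewrite addr_gt0// exprn_gt0.
have k1 : 0 < 4 / (n * c) by rewrite divr_gt0// mulr_gt0.
have k2 : 0 < c^-1 by rewrite invr_gt0.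
exists (1 + 4 / (n * c) + (n + 1) + c^-1); first by lra.
move=> x xi x0 xi0; set C := _ + _ + _ + _.
pose rho := x / xi; have rho0 : 0 < rho by rewrite divr_gt0.
have D0 : 0 < saddle_D a1 a2 rho.
  by apply: lt_le_trans (cD rho); rewrite mulr_gt0// ltr_wpDr// sqr_ge0.
have nbE : normc (Complex (a1 * x) (a2 * x - xi)) ^+ 2 = xi ^+ 2 * saddle_D a1 a2 rho.
  by rewrite sqr_normcE /saddle_D /rho/=; field; rewrite gt_eqF.
have xE : xi ^+ 2 * (1 + rho ^+ 2) = x ^+ 2 + xi ^+ 2.
  by rewrite /rho; field; rewrite gt_eqF.
have x2 : 0 <= x ^+ 2 + xi ^+ 2 by rewrite addr_ge0 ?sqr_ge0.
split.
(* That is, [|m| = 2 xi / (|a| |a x - i xi|)]. *)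
- have nm2 : normc (saddle_m a1 a2 x xi) ^+ 2 = 4 / (n * saddle_D a1 a2 rho).
    rewrite sqr_normcE saddle_mE//= -/rho -/n.
    have nE : n * saddle_D a1 a2 rho =
        ((a1 ^+ 2 - a2 ^+ 2) * rho + a2) ^+ 2 + (2 * a1 * a2 * rho - a1) ^+ 2.
      by rewrite /n /saddle_D; ring.
    have nD0 : 0 < n * saddle_D a1 a2 rho by rewrite mulr_gt0.
    rewrite nE in nD0 *; field; by rewrite gt_eqF.
  have m2 : normc (saddle_m a1 a2 x xi) ^+ 2 <= 4 / (n * c).
    rewrite nm2 ler_pM2l// lef_pV2 ?posrE ?mulr_gt0// ler_pM2l//.
    by apply: le_trans (cD rho); rewrite ler_peMr ?(ltW c0)// lerDl sqr_ge0.
  have := sqr_ge0 (normc (saddle_m a1 a2 x xi) - 1).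
  have := normc_ge0 (saddle_m a1 a2 x xi); rewrite /C; nra.
- rewrite nbE; have := ler_wpM2l (sqr_ge0 xi) (saddle_D_le a1 h2 rho0).
  rewrite mulrCA xE => h; apply: (le_trans h).
  by rewrite ler_wpM2r// /C; rewrite -/n; lra.
- rewrite nbE; have := ler_wpM2l (sqr_ge0 xi) (cD rho).
  rewrite mulrCA xE => h.
  apply: (@le_trans _ _ (c^-1 * (c * (x ^+ 2 + xi ^+ 2)))); first by rewrite mulKf// gt_eqF.
  apply: ler_pM => //; rewrite ?(ltW k2) ?mulr_ge0 ?(ltW c0)//.
  by rewrite /C; lra.
Qed.

(* [s] is a multiple of [S + i], where the real [S] minimizes the quadratic form
   [Re (m s^2) + 2 (Re s)^2 / a1] on [Im s = 1]; the minimum is [- 4 a1 a2 rho / P] with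
   [rho = x / xi] and [P = saddle_P a1 a2 rho]. *)
Lemma saddle_choice (a1 a2 : R) : 0 < a1 -> 0 < a2 -> exists2 C : R, 0 < C &
  forall x xi Q : R, 0 < x -> 0 < xi -> 0 < Q -> exists r, exists s : R[i],
  let m := saddle_m a1 a2 x xi in
  [/\ 0 < r /\ Q <= C * r ^+ 2, r ^+ 6 * (x * xi) ^+ 3 <= C * (Q ^+ 3 * (x ^+ 2 + xi ^+ 2) ^+ 3),
      normc s <= C * r, Re (m * s ^+ 2) + 2 * Re s ^+ 2 / a1 <= - Q &
      r ^+ 2 / a1 <= - Re ((m + a1^-1%:C%C) * s ^+ 2) /\ a1^-1 <= normc (m + a1^-1%:C%C)].
Proof.
move=> h1 h2; have [c c0 cP] := saddle_P_ge h1 h2.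
have [c' c'0 cD] := saddle_D_ge h1 h2.
set n := a1 ^+ 2 + a2 ^+ 2.
have n0 : 0 < n by rewrite addr_gt0// exprn_gt0.
pose CP := n ^+ 2 + a2 ^+ 2; have CP0 : 0 < CP by rewrite addr_gt0// exprn_gt0.
pose g := 4 * a1 * a2; have g0 : 0 < g by rewrite !mulr_gt0.
pose k1 := g / c; have k10 : 0 < k1 by rewrite divr_gt0.
pose k2 := (CP / g) ^+ 3; have k20 : 0 < k2 by rewrite exprn_gt0// divr_gt0.
pose k3 := a1 * (a2 + n) / c; have k30 : 0 < k3 by rewrite divr_gt0// mulr_gt0// addr_gt0.
exists (k1 + k2 + (k3 + 1)); first by lra.
move=> x xi Q x0 xi0 Q0; set C := _ + _ + _.
pose rho := x / xi; have rho0 : 0 < rho by rewrite divr_gt0.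
pose P := saddle_P a1 a2 rho.
have r21 : 0 < 1 + rho ^+ 2 by rewrite ltr_wpDr// sqr_ge0.
have P0 : 0 < P by apply: lt_le_trans (cP rho); rewrite mulr_gt0.
have D0 : 0 < saddle_D a1 a2 rho by apply: lt_le_trans (cD rho); rewrite mulr_gt0.
have r2P : 0 < Q * P / (g * rho) by rewrite divr_gt0// mulr_gt0.
(* The form is homogeneous of degree 2, so this scale makes its value at [s] exactly [- Q]. *)
pose r := Num.sqrt (Q * P / (g * rho)).
have r0 : 0 < r by rewrite sqrtr_gt0.
have r2 : r ^+ 2 = Q * P / (g * rho) by rewrite sqr_sqrtr// ltW.
pose S := a1 * (a2 + (a1 ^+ 2 - a2 ^+ 2) * rho) / P.
pose s := Complex (r * S) r : R[i].
have mE := saddle_mE h1 h2 x0 xi0; rewrite /= -/rho -/n in mE.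
have nD : n * saddle_D a1 a2 rho != 0 by rewrite gt_eqF// mulr_gt0.
have a10 : a1 != 0 by rewrite gt_eqF.
have Pn0 : P != 0 by rewrite gt_eqF.
have rhon0 : rho != 0 by rewrite gt_eqF.
have a20 : a2 != 0 by rewrite gt_eqF.
have normE : Re (saddle_m a1 a2 x xi * s ^+ 2) + 2 * Re s ^+ 2 / a1 = - Q.
  have -> : - Q = - (g * rho / P) * r ^+ 2.
    by rewrite r2; field; rewrite Pn0 rhon0 gt_eqF.
  rewrite expr2 mE !Re_mul !Im_mul /s /=.
  move: nD Pn0; rewrite /S /g /P /saddle_P /saddle_D /n => nD Pn0.
  move: (nD); rewrite mulf_eq0 negb_or => /andP[nn0 Dn0].
  by field; rewrite exprMn Pn0 a10 nn0 Dn0.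
(* The quadratic parts of the two exponents differ by [|s|^2 / a1]: where the norm is small, the
   overlap is smaller still, so no second choice of end point is needed. *)
have overE : - Re ((saddle_m a1 a2 x xi + a1^-1%:C%C) * s ^+ 2) =
    Q + (S ^+ 2 + 1) * (r ^+ 2 / a1).
  rewrite mulrDl Re_add; have -> : Re (saddle_m a1 a2 x xi * s ^+ 2) = - Q - 2 * Re s ^+ 2 / a1.
    by rewrite -normE; ring.
  by rewrite expr2 Re_mul Re_mul Im_mul /s /=; field.
have ra0 : 0 < r ^+ 2 / a1 by rewrite divr_gt0// exprn_gt0.
have ns2 : normc s ^+ 2 = (S ^+ 2 + 1) * r ^+ 2 by rewrite sqr_normcE /s/=; ring.
have rho1 : rho <= 1 + rho ^+ 2 by have := sqr_ge0 (rho - 1); nra.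
have Sk : `|S| <= k3.
  rewrite /S /k3 !normrM normfV (gtr0_norm P0) (gtr0_norm h1) -!mulrA ler_pM2l//.
  have h : `|a2 + (a1 ^+ 2 - a2 ^+ 2) * rho| <= (a2 + n) * (1 + rho ^+ 2).
    apply: (le_trans (ler_normD _ _)); rewrite [leRHS]mulrDl; apply: lerD.
      by rewrite gtr0_norm// ler_peMr ?(ltW h2)// lerDl sqr_ge0.
    rewrite normrM (gtr0_norm rho0); apply: ler_pM => //; first exact: ltW.
    by rewrite /n ler_norml; have := sqr_ge0 a1; have := sqr_ge0 a2; lra.
  rewrite ler_pdivrMr//; apply: (le_trans h).
  have an0 : 0 <= a2 + n by rewrite addr_ge0// ltW.
  rewrite -mulrA ler_wpM2l// mulrC ler_pdivlMr// mulrC.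
  exact: cP.
exists r, s; split.
- split; first exact: r0.
  have : Q <= k1 * r ^+ 2.
    rewrite r2 /k1; have -> : g / c * (Q * P / (g * rho)) = Q * (P / (c * rho)).
      by field; rewrite rhon0 !gt_eqF.
    have h : 1 <= P / (c * rho).
      rewrite ler_pdivlMr; last exact: mulr_gt0.
      rewrite mul1r.
      by apply: le_trans (cP rho); rewrite ler_pM2l.
    by rewrite ler_peMr// ltW.
  by move=> h; apply: (le_trans h); rewrite ler_wpM2r ?sqr_ge0// /C; lra.
- have r6 : r ^+ 6 * (x * xi) ^+ 3 = (Q / g) ^+ 3 * (xi ^+ 2 * P) ^+ 3.
    have -> : r ^+ 6 = (r ^+ 2) ^+ 3 by rewrite -exprM.
    by rewrite r2 /rho; field; rewrite !gt_eqF.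
  have xE : xi ^+ 2 * (1 + rho ^+ 2) = x ^+ 2 + xi ^+ 2.
    by rewrite /rho; field; rewrite gt_eqF.
  have hP : xi ^+ 2 * P <= CP * (x ^+ 2 + xi ^+ 2).
    have := ler_wpM2l (sqr_ge0 xi) (saddle_P_le a1 h2 rho0).
    by rewrite [X in _ <= X]mulrCA xE.
  have p0 : 0 <= xi ^+ 2 * P by rewrite mulr_ge0 ?sqr_ge0// ltW.
  have h3 : (xi ^+ 2 * P) ^+ 3 <= (CP * (x ^+ 2 + xi ^+ 2)) ^+ 3.
    by rewrite ler_pXn2r// nnegrE (le_trans p0).
  have q0 : 0 <= (Q / g) ^+ 3 by rewrite exprn_ge0// divr_ge0// ltW.
  rewrite r6; apply: (le_trans (ler_wpM2l q0 h3)).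
  have -> : (Q / g) ^+ 3 * (CP * (x ^+ 2 + xi ^+ 2)) ^+ 3 =
    k2 * (Q ^+ 3 * (x ^+ 2 + xi ^+ 2) ^+ 3) by rewrite /k2; field; rewrite gt_eqF.
  rewrite ler_wpM2r//; last by rewrite /C; lra.
  by rewrite mulr_ge0// exprn_ge0 ?(ltW Q0)// addr_ge0 ?sqr_ge0.
- apply: (le_trans (normc_le_ReIm _)); rewrite /s/= normrM (gtr0_norm r0).
  have := ler_wpM2l (ltW r0) Sk; have : r * (k3 + 1) <= r * C.
    by rewrite ler_pM2l// /C; lra.
  lra.
- by rewrite normE.
- split.
  + rewrite overE; have : r ^+ 2 / a1 <= (S ^+ 2 + 1) * (r ^+ 2 / a1).
      by rewrite ler_peMl ?(ltW ra0)// lerDr sqr_ge0.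
    lra.
  (* The lower bound on [|M|] comes for free: [|M| |s|^2 >= - Re (M s^2) >= |s|^2 / a1]. *)
  + have s0 : 0 < normc s ^+ 2.
      by rewrite ns2 mulr_gt0 ?exprn_gt0// ltr_wpDl ?sqr_ge0.
    rewrite -(ler_pM2r s0) -[X in _ <= _ * X]normcX -normcM.
    apply: le_trans (normc_Re _); rewrite ler_normr; apply/orP; right.
    rewrite overE ns2; have -> : a1^-1 * ((S ^+ 2 + 1) * r ^+ 2) = (S ^+ 2 + 1) * (r ^+ 2 / a1).
      by ring.
    lra.
Qed.

End SaddleChoice.

(** * Asymptotics *)

Section Scales.
Context {R : realType}.
Local Notation Re := (@complex.Re R).
Local Notation Im := (@complex.Im R).

Lemma complex_sqrt_pos (c : R[i]) : 0 < Re c -> 0 < Im c ->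
  exists a1 a2 : R, [/\ 0 < a1, 0 < a2 & c = Complex a1 a2 ^+ 2].
Proof.
case: c => x y /= x0 y0; pose n := Num.sqrt (x ^+ 2 + y ^+ 2).
have n0 : 0 <= n by exact: sqrtr_ge0.
have n2 : n ^+ 2 = x ^+ 2 + y ^+ 2 by rewrite sqr_sqrtr// addr_ge0 ?sqr_ge0.
pose a1 := Num.sqrt ((n + x) / 2).
have nx0 : 0 < n + x by rewrite ltr_wpDl.
have a10 : 0 < a1 by rewrite sqrtr_gt0 divr_gt0.
have a12 : a1 ^+ 2 = (n + x) / 2 by rewrite sqr_sqrtr// divr_ge0// ltW.
exists a1, (y / (2 * a1)); split=> //; first by rewrite divr_gt0// mulr_gt0.
rewrite expr2; apply: complex_ext; rewrite ?Re_mul ?Im_mul /=; last by field; rewrite gt_eqF.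
have -> : y / (2 * a1) * (y / (2 * a1)) = y ^+ 2 / (4 * a1 ^+ 2) by field; rewrite gt_eqF.
have -> : y ^+ 2 = n ^+ 2 - x ^+ 2 by rewrite n2; ring.
by rewrite -expr2 a12; field; rewrite gt_eqF.
Qed.

(* [(x^2 + xi^2)^2 / (x xi)^3 = O (t `^ (- gap p))]: the hypothesis [1/3 < p < 3] is
   exactly the positivity of [gap p]. *)
Definition gap (p : R) : R := Num.min ((3 * p - 1) / 2) ((3 - p) / 2).

Lemma gap_gt0 (p : R) : 1 / 3 < p -> p < 3 -> 0 < gap p.
Proof. by move=> p1 p2; rewrite lt_min; apply/andP; split; lra. Qed.

Lemma powR_sqrtK (t q : R) : 0 < t -> (t `^ (q / 2)) ^+ 2 = t `^ q.
Proof.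
move=> t0; by rewrite -powR_mulrn ?powR_ge0// -powRrM; congr (_ `^ _); field.
Qed.

(** [(x xi)^3] has exponent [3 (p + 1) / 2], exceeding [2 p] by [(3 - p) / 2] and 2 by
    [(3 p - 1) / 2]; the factor [Q^6 = t^gap] fits under both. Three of these powers of [Q] pay for
    [r^6], the other three make the error small. *)
Lemma scale_estimate (b p t : R) : 0 < b -> p < 3 -> 1 <= t ->
  let x := t `^ (p / 2) in let xi := Num.sqrt b * t `^ (1 / 2) in
  let Q := t `^ (gap p / 6) in
  [/\ x ^+ 2 = t `^ p, xi ^+ 2 = b * t, x ^+ 2 + xi ^+ 2 <= (1 + b) * t ^+ 3 &
      Q ^+ 6 * (x ^+ 2 + xi ^+ 2) ^+ 2 <=
      (2 * (1 + b ^+ 2) / Num.sqrt b ^+ 3) * (x * xi) ^+ 3].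
Proof.
move=> b0 p3 t1 x xi Q; have t0 : 0 < t by exact: lt_le_trans t1.
have sb0 : 0 < Num.sqrt b by rewrite sqrtr_gt0.
have x2 : x ^+ 2 = t `^ p by exact: powR_sqrtK.
have xi2 : xi ^+ 2 = b * t.
  by rewrite exprMn sqr_sqrtr ?(ltW b0)// powR_sqrtK// powRr1// ltW.
have pw n (q : R) : (t `^ q) ^+ n = t `^ (q * n%:R).
  by rewrite -powR_mulrn ?powR_ge0// powRrM.
have pD (q q' : R) : t `^ q * t `^ q' = t `^ (q + q').
  by rewrite powRD// lt0r_neq0// implybT.
have tp (q q' : R) : q <= q' -> t `^ q <= t `^ q' by exact: ler_powR.
have tn n : t ^+ n = t `^ n%:R by rewrite powR_mulrn// ltW.
split=> //.
- rewrite x2 xi2 mulrDl mul1r; apply: lerD.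
    by rewrite tn; apply: tp; exact: ltW.
  by rewrite ler_wpM2l ?(ltW b0)// ler_eXnr.
- rewrite x2 xi2.
  have h1 : (t `^ p + b * t) ^+ 2 <= 2 * (t `^ p) ^+ 2 + 2 * b ^+ 2 * t ^+ 2.
    have := sqr_ge0 (t `^ p - b * t); nra.
  have Q0 : 0 <= Q ^+ 6 by rewrite exprn_ge0// powR_ge0.
  apply: (le_trans (ler_wpM2l Q0 h1)).
  have xx : (x * xi) ^+ 3 = Num.sqrt b ^+ 3 * t `^ (3 * (p + 1) / 2).
    by rewrite /x /xi mulrCA exprMn pD pw; congr (_ * _ `^ _); field.
  rewrite xx; set T := t `^ (3 * (p + 1) / 2).
  have -> : 2 * (1 + b ^+ 2) / Num.sqrt b ^+ 3 * (Num.sqrt b ^+ 3 * T) =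
      2 * (1 + b ^+ 2) * T by field; rewrite gt_eqF.
  have QE : Q ^+ 6 = t `^ gap p by rewrite /Q pw; congr (_ `^ _); field.
  have g1 : gap p <= (3 * p - 1) / 2 by rewrite ge_min lexx.
  have g2 : gap p <= (3 - p) / 2 by rewrite ge_min lexx orbT.
  have e1 : Q ^+ 6 * (t `^ p) ^+ 2 <= T.
    by rewrite /T QE pw pD; apply: tp; lra.
  have e2 : Q ^+ 6 * t ^+ 2 <= T.
    by rewrite /T QE tn pD; apply: tp; lra.
  have e3 := ler_wpM2l (sqr_ge0 b) e2.
  rewrite mulrDr; lra.
Qed.

End Scales.

(** * An explicit lower bound along the curve *)

Section Growth.
Context {R : realType}.
Local Notation normc := (@ComplexField.Normc.normc R).

Lemma resolvent_norm_scale_ge (a1 a2 b p : R) : 0 < a1 -> 0 < a2 -> 0 < b -> p < 3 ->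
  exists W : R, exists2 C : R, 0 < C & forall t : R, 1 <= t -> W <= t `^ (gap p / 6) ->
    ((C * (expR (t `^ (gap p / 6)) / t ^+ 2))%:E <=
     resolvent_norm (harmonic_oscillator (Complex a1 a2 ^+ 2)%R)
       ((b * t)%:C%C + Complex a1 a2 ^+ 2 * (t `^ p)%:C%C)%R)%E.
Proof.
move=> h1 h2 b0 p3.
have [C1 C10 bounds] := saddle_bounds h1 h2.
have [C2 C20 choice] := saddle_choice h1 h2.
have [K K0 lower] := @resolvent_norm_ge R (Complex a1 a2) C1 h1.
have sb0 : 0 < Num.sqrt b by rewrite sqrtr_gt0.
pose C3 := 2 * (1 + b ^+ 2) / Num.sqrt b ^+ 3.
have C30 : 0 < C3.
  by rewrite divr_gt0 ?exprn_gt0// mulr_gt0// ltr_wpDr// sqr_ge0.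
pose C5 := 1 + C2; have C50 : 0 < C5 by rewrite addr_gt0.
pose M1 := C1 + a1^-1; have M10 : 0 < M1 by rewrite addr_gt0// invr_gt0.
(* With [rho <= C5 * r] and [r >= 1], the bound [r^3 <= eps |bb|] yields both [2 rho <= |bb|] and
   the smallness of the cubic error. *)
pose eps := (2 * C5 + 2 * K * C5 ^+ 3)^-1.
have C53 : 0 < C5 ^+ 3 by rewrite exprn_gt0.
have eps0 : 0 < eps by rewrite invr_gt0 addr_gt0 ?mulr_gt0.
(* For [r >= R0] the crude bound [expR (- X) <= 1 / X = a1 / r^2] already makes the connecting
   segments negligible. *)
pose R0 := 1 + 16 * C5 * a1 * expR M1.
have R00 : 1 <= R0 by rewrite lerDl !mulr_ge0 ?expR_ge0// ltW.
pose C6 := C1 * (1 + b) + 1.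
have C1b : 0 < C1 * (1 + b) by rewrite mulr_gt0// addr_gt0.
have C61 : 1 <= C6 by rewrite /C6; lra.
pose na := normc (Complex a1 a2).
have a0 : Complex a1 a2 != 0 by rewrite eq_complex negb_and /= gt_eqF.
have na0 : 0 < na by rewrite normc_gt0.
(* The three thresholds give [1 <= Q], [R0 <= r] and [r^3 <= eps |bb|] respectively. *)
pose W := Num.max 1 (Num.max (C2 * R0 ^+ 2) (C1 * C2 * C3 / eps ^+ 2)).
exists W, (expR (- 1 - M1) / (8 * na * C6)).
  by rewrite divr_gt0 ?expR_gt0// !mulr_gt0//; exact: lt_le_trans C61.
move=> t t1; set Q := t `^ _ => WQ.
have t0 : 0 < t by exact: lt_le_trans t1.
have Q1 : 1 <= Q by apply: le_trans WQ; rewrite le_max lexx.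
have QR : C2 * R0 ^+ 2 <= Q by apply: le_trans WQ; rewrite !le_max lexx orbT.
have Qe : C1 * C2 * C3 / eps ^+ 2 <= Q by apply: le_trans WQ; rewrite !le_max lexx !orbT.
have Q0 : 0 < Q by exact: lt_le_trans Q1.
have [x2 xi2 sum_le gap_le] := scale_estimate b0 p3 t1.
set x := t `^ (p / 2) in x2 sum_le gap_le; set xi := Num.sqrt b * _ in xi2 sum_le gap_le.
rewrite -/Q -/C3 in gap_le.
have x0 : 0 < x by exact: powR_gt0.
have xi0 : 0 < xi by rewrite mulr_gt0// powR_gt0.
have [mB b_le b_ge] := bounds x xi x0 xi0.
have [r [s [[r0 Qr] r6 sr NQ [Xs Mge]]]] := choice x xi Q x0 xi0 Q0.
set bb := Complex (a1 * x) (a2 * x - xi) in b_le b_ge.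
have bb0 : bb != 0 by rewrite eq_complex negb_and /= gt_eqF// mulr_gt0.
have nb0 : 0 < normc bb by rewrite normc_gt0.
pose V := x ^+ 2 + xi ^+ 2.
have V0 : 0 < V by rewrite addr_gt0// exprn_gt0.
have xx0 : 0 < (x * xi) ^+ 3 by rewrite exprn_gt0// mulr_gt0.
have rR : R0 <= r.
  have h := le_trans QR Qr; rewrite ler_pM2l// in h.
  by rewrite -(ler_pXn2r (n := 2))// nnegrE ?(ltW r0)//; exact: le_trans R00.
have r1 : 1 <= r by exact: le_trans rR.
(* The surplus [Q^3] on the left is what makes [r^6 / |bb|^2] small. *)
have r6b : r ^+ 6 * Q ^+ 3 <= C1 * C2 * C3 * normc bb ^+ 2.
  have e1 : r ^+ 6 * Q ^+ 3 * (x * xi) ^+ 3 <= C2 * (Q ^+ 6 * V ^+ 2) * V.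
    have := ler_wpM2r (exprn_ge0 3 (ltW Q0)) r6.
    have -> : C2 * (Q ^+ 3 * (x ^+ 2 + xi ^+ 2) ^+ 3) * Q ^+ 3 = C2 * (Q ^+ 6 * V ^+ 2) * V.
      by rewrite /V; ring.
    by have -> : r ^+ 6 * (x * xi) ^+ 3 * Q ^+ 3 = r ^+ 6 * Q ^+ 3 * (x * xi) ^+ 3 by ring.
  have e2 : C2 * (Q ^+ 6 * V ^+ 2) * V <= C2 * (C3 * (x * xi) ^+ 3) * (C1 * normc bb ^+ 2).
    by apply: ler_pM => //; rewrite ?mulr_ge0 ?exprn_ge0 ?(ltW C20) ?(ltW Q0) ?(ltW V0)// ler_wpM2l// ltW.
  rewrite -(ler_pM2r xx0); apply: (le_trans e1); apply: (le_trans e2).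
  by rewrite le_eqVlt; apply/orP; left; apply/eqP; ring.
have r3b : r ^+ 3 <= eps * normc bb.
  rewrite -(ler_pXn2r (n := 2))// ?nnegrE ?mulr_ge0 ?exprn_ge0 ?(ltW r0) ?(ltW eps0) ?(ltW nb0)//.
  rewrite -exprM exprMn.
  have Q3 : Q <= Q ^+ 3 by rewrite ler_eXnr.
  have e0 : C1 * C2 * C3 <= eps ^+ 2 * Q ^+ 3.
    have h := le_trans Qe Q3; rewrite ler_pdivrMr ?exprn_gt0// in h.
    by rewrite (mulrC (eps ^+ 2)).
  have Q30 : 0 < Q ^+ 3 by rewrite exprn_gt0.
  rewrite -(ler_pM2r Q30); apply: (le_trans r6b).
  apply: (le_trans (ler_wpM2r (exprn_ge0 2 (ltW nb0)) e0)).
  by rewrite le_eqVlt; apply/orP; left; apply/eqP; ring.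
pose rho := Num.max r (normc s).
have sC5 : normc s <= C5 * r by apply: (le_trans sr); rewrite ler_wpM2r ?(ltW r0)// lerDr.
have rC5 : r <= C5 * r by rewrite ler_peMl ?(ltW r0)// lerDl ltW.
have rho_le : rho <= C5 * r by rewrite ge_max rC5 sC5.
have rho1 : 1 <= rho by rewrite le_max r1.
have rr3 : r <= r ^+ 3 by rewrite ler_eXnr.
have epsE : eps * (2 * C5 + 2 * K * C5 ^+ 3) = 1.
  by rewrite mulVf// gt_eqF// -invr_gt0.
have k50 : 0 < 2 * K * C5 ^+ 3 by rewrite !mulr_gt0.
have r3C : r ^+ 3 * (2 * C5 + 2 * K * C5 ^+ 3) <= normc bb.
  have D0 : 0 <= 2 * C5 + 2 * K * C5 ^+ 3 by rewrite addr_ge0 ?(ltW k50)// mulr_ge0 ?(ltW C50).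
  apply: (le_trans (ler_wpM2r D0 r3b)).
  by rewrite mulrAC epsE mul1r.
have r30 : 0 < r ^+ 3 by rewrite exprn_gt0.
have p5 := mulr_gt0 r30 C50.
have p6 := mulr_gt0 r30 k50.
have rho_b : 2 * rho <= normc bb.
  have : C5 * r <= C5 * r ^+ 3 by rewrite ler_pM2l.
  rewrite mulrDr in r3C; lra.
have Krho : K * ((rho ^+ 3 + rho) / normc bb) <= 1.
  rewrite mulrA ler_pdivrMr// mul1r.
  have g1 : rho <= rho ^+ 3 by rewrite ler_eXnr.
  have g2 : rho ^+ 3 <= (C5 * r) ^+ 3.
    by rewrite ler_pXn2r// nnegrE; [exact: le_trans rho1|rewrite mulr_ge0// ltW].
  have g3 := ler_wpM2l (ltW K0) g2; have g4 := ler_wpM2l (ltW K0) g1.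
  have g5 : K * (C5 * r) ^+ 3 = r ^+ 3 * (2 * K * C5 ^+ 3) / 2 by field.
  rewrite mulrDr in r3C; rewrite mulrDr; lra.
pose m := saddle_m a1 a2 x xi.
pose X := r ^+ 2 / a1.
have X0 : 0 < X by rewrite divr_gt0// exprn_gt0.
have M_le : normc (m + a1^-1%:C%C) <= M1.
  apply: (le_trans (ler_normcD _ _)); apply: lerD => //.
  by rewrite normc_real ger0_norm// invr_ge0 ltW.
have XM : X <= normc (m + a1^-1%:C%C) * r ^+ 2.
  by rewrite /X mulrC ler_wpM2r// sqr_ge0.
have expX : expR (- X) <= a1 / r ^+ 2.
  rewrite expRN /X -[leRHS]invf_div lef_pV2 ?posrE ?expR_gt0//.
  by apply: le_trans (expR_ge1Dx _); rewrite lerDr.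
have small : 16 * (normc s + r) * expR (- X) <= expR (- normc (m + a1^-1%:C%C)).
  apply: (@le_trans _ _ (expR (- M1))); last by rewrite ler_expR lerN2.
  have s2 : normc s + r <= C5 * r by rewrite /C5 mulrDl mul1r addrC lerD2l.
  apply: (@le_trans _ _ (16 * (C5 * r) * (a1 / r ^+ 2))).
    apply: ler_pM; rewrite ?expR_ge0 ?mulr_ge0 ?addr_ge0 ?normc_ge0 ?(ltW r0)//.
    by rewrite ler_pM2l.
  have -> : 16 * (C5 * r) * (a1 / r ^+ 2) = 16 * C5 * a1 / r by field; rewrite gt_eqF.
  rewrite expRN ler_pdivrMr// [leRHS]mulrC ler_pdivlMr ?expR_gt0//.
  by apply: le_trans rR; rewrite /R0 lerDr.
(* The factorization [a^2 x^2 + xi^2 = (a x - i xi) (a x + i xi)]. *)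
have zE : (b * t)%:C%C + Complex a1 a2 ^+ 2 * (t `^ p)%:C%C =
    bb * (2 * Complex a1 a2 * x%:C%C - bb).
  rewrite -x2 -xi2 !expr2 mulr_natl mulr2n.
  by apply: complex_ext; rewrite !(Re_mul, Im_mul, Re_add, Im_add, Re_opp, Im_opp) /=; ring.
have := lower bb _ m s x r X Q bb0 erefl zE erefl mB.
have Mn0 : m + a1^-1%:C%C != 0.
  by rewrite -normc_gt0; apply: lt_le_trans Mge; rewrite invr_gt0.
move=> /(_ Mn0 r1 rho_b Krho (ltW X0) XM Xs small NQ).
apply: le_trans; rewrite lee_fin -/na.
have nbt : normc bb <= C6 * t ^+ 2.
  rewrite -(ler_pXn2r (n := 2))// ?nnegrE ?(ltW nb0)//; last first.
    by rewrite mulr_ge0 ?sqr_ge0//; exact: le_trans C61.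
  have g1 : normc bb ^+ 2 <= C1 * (1 + b) * t ^+ 3.
    by apply: (le_trans b_le); rewrite -mulrA ler_wpM2l// ltW.
  apply: (le_trans g1); rewrite exprMn.
  have t34 : t ^+ 3 <= (t ^+ 2) ^+ 2 by rewrite -exprM ler_weXn2l.
  apply: ler_pM; rewrite ?(ltW C1b) ?exprn_ge0 ?(ltW t0)//.
  apply: (@le_trans _ _ C6); first by rewrite lerDl.
  by rewrite ler_eXnr.
have E1 : expR (- 1 - M1) * expR Q <= expR (Q - 1 - normc (m + a1^-1%:C%C)).
  by rewrite -expRD ler_expR (addrC _ Q) addrA lerB.
have C60 : 0 < C6 by exact: lt_le_trans C61.
have -> : expR (-1 - M1) / (8 * na * C6) * (expR Q / t ^+ 2) =
    (expR (-1 - M1) * expR Q) * (8 * (na * (C6 * t ^+ 2)))^-1.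
  by field; rewrite !gt_eqF.
have d0 : 0 < 8 * (na * (C6 * t ^+ 2)).
  by apply: mulr_gt0 => //; apply: mulr_gt0 => //; apply: mulr_gt0 => //; exact: exprn_gt0.
have d1 : 0 < 8 * (na * normc bb) by rewrite mulr_gt0// mulr_gt0.
apply: ler_pM E1 _; first by rewrite mulr_ge0 ?expR_ge0.
  by rewrite invr_ge0 ltW.
by rewrite lef_pV2 ?posrE// ler_pM2l// ler_pM2l.
Qed.

End Growth.

Theorem theorem5 (R : realType) (c : R[i]) (b p : R)
  (hRe : 0 < complex.Re c) (hIm : 0 < complex.Im c)
  (hb : 0 < b) (hp1 : 1 / 3 < p) (hp2 : p < 3) :
  resolvent_norm (harmonic_oscillator c)
    ((b * eta)%:C%C + c * (eta `^ p)%:C%C) @[eta --> +oo] --> +oo%E.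
Proof.
have [a1 [a2 [h1 h2 ->]]] := complex_sqrt_pos hRe hIm.
have [W [C C0 lower]] := resolvent_norm_scale_ge h1 h2 hb hp2.
have g0 := gap_gt0 hp1 hp2; set g := gap p in g0 lower.
have g60 : 0 < g / 6 by rewrite divr_gt0.
(* One term of the exponential series of [t^(g/6)], of order [N + 1], is then at least a multiple of
   [t^3], which beats the denominator [t^2]. *)
have [N Ng] : exists N : nat, 3 <= g / 6 * N.+1%:R.
  exists (Num.truncn (18 / g)); have := truncnS_gt (18 / g).
  rewrite ltr_pdivrMr// => h; lra.
apply/cvgeyPge => A; near=> t.
have t1 : 1 <= t by near: t; exact: nbhs_pinfty_ge.
have t0 : 0 < t by exact: lt_le_trans t1.
have WQ : W <= t `^ (g / 6).
  have hW : `|W| `^ (g / 6)^-1 <= t by near: t; apply: nbhs_pinfty_ge; exact: num_real.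
  apply: (le_trans (ler_norm W)).
  have -> : `|W| = (`|W| `^ (g / 6)^-1) `^ (g / 6).
    by rewrite -powRrM mulVf ?lt0r_neq0// powRr1.
  by apply: (ge0_ler_powR (ltW g60)) => //; rewrite nnegrE ?powR_ge0// ltW.
apply: le_trans (lower t t1 WQ); rewrite lee_fin.
set Q := t `^ _ in WQ *.
have Q0 : 0 <= Q by exact: powR_ge0.
have f0 : (0 : R) < N.+1`!%:R by rewrite ltr0n fact_gt0.
have eQ : t ^+ 3 / N.+1`!%:R <= expR Q.
  apply: le_trans (expR_ge1Dxn N Q0); apply: (@le_trans _ _ (Q ^+ N.+1 / N.+1`!%:R)).
    rewrite ler_pM2r ?invr_gt0// -[leRHS]powR_mulrn// -[leLHS]powR_mulrn ?(ltW t0)//.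
    by rewrite /Q -powRrM; exact: ler_powR.
  by rewrite lerDr.
have tA : A * N.+1`!%:R / C <= t by near: t; apply: nbhs_pinfty_ge; exact: num_real.
apply: (@le_trans _ _ (C * (t / N.+1`!%:R))).
  rewrite ler_pdivrMr// in tA.
  by rewrite mulrA ler_pdivlMr// (mulrC C).
rewrite ler_pM2l// ler_pdivlMr ?exprn_gt0//.
by apply: le_trans eQ; rewrite mulrAC -exprS.
Unshelve. all: by end_near. Qed.
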